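(* Let $K$ be an algebraically closed field of characteristic zero, let $m,n>1$ be coprime integers, $l\in\mathbb{N}$, and let $(A_0,(\rho_0,\sigma_0)),(A_1,(\rho_1,\sigma_1)),\dots,(A_k,(\rho_k,\sigma_k))$ be the regular corners of an $(m,n)$-pair $(P,Q)$ in $L^{(l)}$, where $(\rho_i,\sigma_i)<(\rho_{i+1},\sigma_{i+1})$ in $I$ for all $i<k$. Write $A_j=(a_j/l,b_j)$. The following facts hold: (1) $A(P)=\{(\rho_1,\sigma_1),\dots,(\rho_k,\sigma_k)\}$. In particular, if $(P,Q)$ is a standard $(m,n)$-pair, then $(A_0,A_0',(\rho_0,\sigma_0))$ is the starting triple of $(P,Q)$, where $A_0':=\frac1m\mathrm{st}_{\rho_0,\sigma_0}(P)$. (2) For all $j\ge1$ there exists a maximum $d_j\in\mathbb{N}$ such that $\ell_{\rho_j,\sigma_j}(P)=R_j^{md_j}$ for some $(\rho_j,\sigma_j)$-homogeneous $R_j\in L^{(l)}$. If $(A_0,(\rho_0,\sigma_0))$ is of type II, then this holds also for $j=0$. (3) For all $j>0$ the element $F_j$ associated with $(P,Q)$ and $(\rho_j,\sigma_j)$ (see context) satisfies $\mathrm{en}_{\rho_j,\sigma_j}(F_j)=\frac{p_j}{q_j}\frac1m\mathrm{en}_{\rho_j,\sigma_j}(P)$, where $p_j,q_j\in\mathbb{N}$ are coprime. If $(A_0,(\rho_0,\sigma_0))$ is of type II, then this holds also for $j=0$. (4) $q_i\nmid d_i$ for all $i>0$. (5) $q_j\mid d_i$ for all $i>j>0$. (6)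 $q_i\nmid q_j$ for all $i>j>0$. (7) Set $D_j:=\gcd(a_j,b_j,a_{j-1},b_{j-1})$. Then $d_j\mid D_j$ and $\Omega(D_j)\ge\Omega(d_j)\ge j-1$ for all $j>0$, where $\Omega(N)$ denotes the number of prime factors of $N\in\mathbb{N}$ counted with multiplicity. (8) If $(A_0,(\rho_0,\sigma_0))$ is of type II, then $q_0\nmid d_0$, and for all $i>0$ we have $q_0\mid d_i$, $q_i\nmid q_0$ and $\Omega(d_i)\ge i$.
   Context: $\mathbb{N}$ is the set of positive integers, $\mathbb{N}_0=\mathbb{N}\cup\{0\}$. $L^{(l)}=K[x^{1/l},x^{-1/l},y]$, $[P,Q]:=\partial_xP\,\partial_yQ-\partial_xQ\,\partial_yP$. $K[P,Q]$ is the subalgebra generated by $P,Q$. Directions: $\mathfrak{V}=\{(\rho,\sigma)\in\mathbb{Z}^2:\gcd(\rho,\sigma)=1\}$. Identify a direction with its unit vector in $S^1$; intervals of directions are arcs (not the whole circle) ordered counterclockwise. $I:=\,](1,-1),(1,0)]$ (directions counterclockwise from $(1,-1)$, excluded, to $(1,0)$, included). For $P=\sum a_{i/l,j}x^{i/l}y^j\ne0$: $\mathrm{Supp}(P)=\{(i/l,j):a_{i/l,j}\ne0\}$, $v_{\rho,\sigma}(i/l,j)=\rho i/l+\sigma j$, $v_{\rho,\sigma}(P)=\max v_{\rho,\sigma}$ on $\mathrm{Supp}(P)$, $\ell_{\rho,\sigma}(P)$ is the sum of the terms attaining the maximum ($\ell_{\rho,\sigma}(0)=0$); $P$ is $(\rho,\sigma)$-homogeneous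 if $P=\ell_{\rho,\sigma}(P)$; $\mathrm{Dir}(P)=\{(\rho,\sigma)\in\mathfrak{V}:\#\mathrm{Supp}(\ell_{\rho,\sigma}(P))>1\}$. With $(a_1,a_2)\times(b_1,b_2)=a_1b_2-a_2b_1$: if $\ell_{\rho,\sigma}(P)$ is a monomial, $\mathrm{st}_{\rho,\sigma}(P)=\mathrm{en}_{\rho,\sigma}(P)$ is its exponent; otherwise they are the endpoints of the segment spanned by $\mathrm{Supp}(\ell_{\rho,\sigma}(P))$, ordered so that $(\rho,\sigma)\times(\mathrm{en}_{\rho,\sigma}(P)-\mathrm{st}_{\rho,\sigma}(P))>0$. $(m,n)$-pair in $L^{(l)}$ ($m,n>1$ coprime): $P,Q\in L^{(l)}$ with $[P,Q]\in K^\times$, $\frac{v_{1,1}(P)}{v_{1,1}(Q)}=\frac{v_{1,0}(P)}{v_{1,0}(Q)}=\frac mn$ and $v_{1,-1}(\mathrm{en}_{1,0}(P))<0$. It is standard if moreover $P,Q\in L^{(1)}$ and $v_{1,-1}(\mathrm{st}_{1,0}(P))<0$. $A(P):=\{(\rho,\sigma)\in\mathrm{Dir}(P)\cap I: v_{0,-1}(\mathrm{st}_{\rho,\sigma}(P))<-1\text{ and }v_{1,-1}(\mathrm{st}_{\rho,\sigma}(P))<0\}$. A regular corner of an $(m,n)$-pair $(P,Q)$ in $L^{(l)}$ is a pair $(A,(\rho,\sigma))$ with $A=(a/l,b)\in\frac1l\mathbb{Z}\times\mathbb{N}_0$, $(\rho,\sigma)\in I$, such that $b\ge1$, $b>a/l$,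 $(\rho,\sigma)\in\mathrm{Dir}(P)$ and $(a/l,b)=\frac1m\mathrm{en}_{\rho,\sigma}(P)$. Write $\ell_{\rho,\sigma}(P)=x^{\kappa}\mathfrak{p}(z)$ with $z:=x^{-\sigma/\rho}y$, $\kappa\in\mathbb{Q}$, $\mathfrak{p}\in K[z]$. The regular corner is of type II if $[\ell_{\rho,\sigma}(P),\ell_{\rho,\sigma}(Q)]=0$ and $\mathfrak{p}$ has more than one distinct linear factor. Every $(m,n)$-pair has exactly one regular corner $(A_0,(\rho,\sigma))$ with $(\rho,\sigma)\notin A(P)$; for a standard $(m,n)$-pair its starting triple is $(A_0,A_0',(\rho,\sigma))$ with this corner and $A_0'=\frac1m\mathrm{st}_{\rho,\sigma}(P)$. The element $F_j$: for a regular corner one has $v_{\rho_j,\sigma_j}(P)>0$, and there exist $G_0\in K[P,Q]\setminus\{0\}$ and a $(\rho_j,\sigma_j)$-homogeneous $F_j\in L^{(l)}$ such that $v_{\rho_j,\sigma_j}(F_j)=\rho_j+\sigma_j$, $[F_j,\ell_{\rho_j,\sigma_j}(P)]=\ell_{\rho_j,\sigma_j}(P)$, $[\ell_{\rho_j,\sigma_j}(G_0),\ell_{\rho_j,\sigma_j}(P)]F_j=\ell_{\rho_j,\sigma_j}(G_0)\ell_{\rho_j,\sigma_j}(P)$, and $[\ell_{\rho_j,\sigma_j}(G_i),\ell_{\rho_j,\sigma_j}(P)]=0$ for $i\ge1$, where $G_i:=[G_{i-1},P]$. $F_j$ denotes such an element. *)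

(* Defs.v *)
From HB Require Import structures.
From mathcomp Require Import all_boot all_order all_algebra.
From mathcomp Require Import finmap.
From mathcomp.multinomials Require Import monalg.

Set Implicit Arguments.
Unset Strict Implicit.
Unset Printing Implicit Defensive.

Import Order.TTheory GRing.Theory Num.Theory.
Local Open Scope ring_scope.

(* All the algebras L^(l) = K[x^(1/l), x^(-1/l), y] are handled as subsets of  *)
(* one ring K[x^Q, y], whose elements are finitely supported families of       *)
(* coefficients indexed by exponents (r, j) : rat * nat; << c *g (r, j) >> is  *)
(* c x^r y^j.  The ring structure of monalg does not apply, because it wants   *)
(* a monoid of exponents without invertible elements.                          *)
Notation expo := (rat * nat)%type.

Definition qlaurent (K : fieldType) : Type := {malg K[expo]}.

Section Ring.
Variable K : fieldType.
Local Notation A := (qlaurent K).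

HB.instance Definition _ := GRing.Lmodule.on A.

Implicit Types f g h : A.

Definition addx (e1 e2 : expo) : expo := (e1.1 + e2.1, (e1.2 + e2.2)%N).
Definition expo0 : expo := (0, 0%N).

Lemma addxA : associative addx.
Proof. by move=> [? ?] [? ?] [? ?]; rewrite /addx /= addrA addnA. Qed.
Lemma addxC : commutative addx.
Proof. by move=> [? ?] [? ?]; rewrite /addx /= addrC addnC. Qed.
Lemma add0x : left_id expo0 addx.
Proof. by move=> [? ?]; rewrite /addx /= add0r add0n. Qed.

Definition qone : A := << 1 *g expo0 >>.

Definition qmul f g : A :=
  \sum_(e1 <- msupp f) \sum_(e2 <- msupp g) << f@_e1 * g@_e2 *g addx e1 e2 >>.

Lemma qmulw (d1 d2 : {fset expo}) f g :
  (msupp f `<=` d1)%fset -> (msupp g `<=` d2)%fset ->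
  qmul f g =
  \sum_(e1 <- d1) \sum_(e2 <- d2) << f@_e1 * g@_e2 *g addx e1 e2 >>.
Proof.
move=> le1 le2; rewrite /qmul (big_fset_incl _ le1) /=.
  apply/eq_bigr=> e1 _; apply/big_fset_incl => // e _ /mcoeff_outdom ->.
  by rewrite mulr0 monalgU0.
move=> e _ /mcoeff_outdom fe.
by rewrite big1 // => e' _; rewrite fe mul0r monalgU0.
Qed.

Lemma qmulC : commutative qmul.
Proof.
move=> f g; rewrite /qmul exchange_big; apply: eq_bigr => e1 _.
by apply: eq_bigr => e2 _; rewrite mulrC addxC.
Qed.

Lemma qmulUU c1 c2 e1 e2 :
  qmul << c1 *g e1 >> << c2 *g e2 >> = << c1 * c2 *g addx e1 e2 >>.
Proof. by rewrite (qmulw msuppU_le msuppU_le) !big_seq_fset1 !mcoeffUU. Qed.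

Lemma qmulUl c e g :
  qmul << c *g e >> g = \sum_(e' <- msupp g) << c * g@_e' *g addx e e' >>.
Proof.
rewrite (qmulw msuppU_le (fsubset_refl _)) big_seq_fset1.
by apply/eq_bigr => e' _; rewrite mcoeffUU.
Qed.

Lemma qmul1 : left_id qone qmul.
Proof.
move=> g; rewrite qmulUl [RHS]monalgE.
by apply/eq_bigr=> e _; rewrite mul1r add0x.
Qed.

Lemma qmulDl : left_distributive qmul +%R.
Proof.
move=> f1 f2 g.
rewrite (qmulw (msuppD_le f1 f2) (fsubset_refl (msupp g))).
rewrite (qmulw (fsubsetUl (msupp f1) (msupp f2)) (fsubset_refl (msupp g))).
rewrite (qmulw (fsubsetUr (msupp f1) (msupp f2)) (fsubset_refl (msupp g))).
rewrite -big_split /=; apply/eq_bigr=> e1 _.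
rewrite -big_split /=; apply/eq_bigr=> e2 _.
by rewrite mcoeffD mulrDl monalgUD.
Qed.

Lemma qmulDr f : {morph qmul f : g h / g + h}.
Proof. by move=> g h; rewrite ![qmul f _]qmulC qmulDl. Qed.

Lemma qmul0 : left_zero 0 qmul.
Proof. by move=> g; rewrite /qmul msupp0 big_seq_fset0. Qed.

Lemma qmul0r f : qmul f 0 = 0.
Proof. by rewrite qmulC qmul0. Qed.

Lemma qmulsl (I : Type) (s : seq I) (F : I -> A) g :
  qmul (\sum_(i <- s) F i) g = \sum_(i <- s) qmul (F i) g.
Proof.
exact: (big_morph (qmul^~ g) (fun _ _ => qmulDl _ _ _) (qmul0 g)).
Qed.

Lemma qmulsr (I : Type) (s : seq I) (F : I -> A) g :
  qmul g (\sum_(i <- s) F i) = \sum_(i <- s) qmul g (F i).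
Proof. exact: (big_morph (qmul g) (qmulDr g) (qmul0r g)). Qed.

Lemma qmulA : associative qmul.
Proof.
move: (@qmulsl) (@qmulsr) qmulUU; move: qmul => op opl opr opU f g h.
rewrite [f]monalgE !opl; apply: eq_bigr => e1 _.
rewrite [g]monalgE !(opl, opr); apply: eq_bigr => e2 _.
rewrite [h]monalgE !opr; apply: eq_bigr => e3 _.
by rewrite !opU mulrA addxA.
Qed.

Lemma qone_neq0 : qone != 0.
Proof. by rewrite monalgU_eq0 oner_eq0. Qed.

HB.instance Definition _ := GRing.Zmodule_isComNzRing.Build A
  qmulA qmulC qmul1 qmulDl qone_neq0.

Lemma qscaleAl (c : K) f g : c *: (f * g) = (c *: f) * g.
Proof.
have cE (u : A) : c *: u = (<< c *g expo0 >> : A) * u.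
  apply/malgP => e; rewrite mcoeffZ -[_ * u]/(qmul _ u) qmulUl.
  rewrite {1}[u]monalgE !raddf_sum mulr_sumr.
  by apply: eq_bigr => e' _; rewrite /= !mcoeffU add0x mulrnAr.
by rewrite !cE mulrA.
Qed.

HB.instance Definition _ := GRing.Lmodule_isLalgebra.Build K A qscaleAl.
HB.instance Definition _ := GRing.Lalgebra_isComAlgebra.Build K A.

End Ring.

Section Notions.
Variable K : closedFieldType.
Local Notation A := (qlaurent K).

Implicit Types P Q F G R : A.
Implicit Types d : int * int.

Definition in_L (l : nat) P : Prop :=
  forall e : expo, e \in msupp P -> exists i : int, e.1 = i%:~R / l%:R.

Definition partial_x P : A :=
  \sum_(e <- msupp P) << ratr e.1 * P@_e *g (e.1 - 1, e.2) >>.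

(* The junk exponent obtained for e.2 = 0 carries the coefficient 0. *)
Definition partial_y P : A :=
  \sum_(e <- msupp P) << e.2%:R * P@_e *g (e.1, e.2.-1) >>.

Definition bracket P Q : A :=
  partial_x P * partial_y Q - partial_x Q * partial_y P.

(* K[P, Q] is the set of values g(P, Q), for g a polynomial in two variables. *)
Definition in_subalg P Q G : Prop :=
  exists g : {poly {poly K}}, G = (map_poly (horner_alg P) g).[Q].

Definition cross (u v : rat * rat) : rat := u.1 * v.2 - u.2 * v.1.
Definition scale_pt (c : rat) (p : rat * rat) : rat * rat :=
  (c * p.1, c * p.2).

Definition is_direction d : bool := coprimez d.1 d.2.
Definition dvec d : rat * rat := (d.1%:~R, d.2%:~R).

(* The arc from (1, -1) to (1, 0) is shorter than a half turn, so a direction  *)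
(* of the arc lies counterclockwise of another one if and only if the cross    *)
(* product is positive; dir_lt is the order of the arc, for directions in it.  *)
Definition in_I d : Prop :=
  [/\ is_direction d, 0 < cross (dvec (1, -1)) (dvec d)
    & 0 <= cross (dvec d) (dvec (1, 0))].

Definition dir_lt d1 d2 : Prop := 0 < cross (dvec d1) (dvec d2).

Definition pt (e : expo) : rat * rat := (e.1, e.2%:R).
Definition supp P : seq (rat * rat) := [seq pt e | e <- msupp P].

Definition wt d (p : rat * rat) : rat := d.1%:~R * p.1 + d.2%:~R * p.2.

(* v_d(P), the maximum of wt d on the support; the value at P = 0 is junk. *)
Definition vdeg d P : rat :=
  let s := [seq wt d p | p <- supp P] in
  \big[Num.max/head 0 s]_(x <- s) x.

Definition ell d P : A :=
  \sum_(e <- msupp P | wt d (pt e) == vdeg d P) << P@_e *g e >>.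

Definition homogeneous d P : Prop := P = ell d P.

Definition Dir P d : Prop :=
  is_direction d /\ (1 < size (supp (ell d P)))%N.

(* The support of ell d P lies on a line directed by (- d.2, d.1), along which *)
(* cross (dvec d) is strictly increasing: en and st are its two extreme        *)
(* points, and they coincide for a monomial.                                   *)
Definition en d P : rat * rat :=
  let s := supp (ell d P) in
  head (0, 0)
    [seq p <- s | all (fun q => cross (dvec d) q <= cross (dvec d) p) s].

Definition st d P : rat * rat :=
  let s := supp (ell d P) in
  head (0, 0)
    [seq p <- s | all (fun q => cross (dvec d) p <= cross (dvec d) q) s].

Definition mn_pair (l m n : nat) P Q : Prop :=
  [/\ in_L l P /\ in_L l Q,
      exists2 c : K, c != 0 & bracket P Q = c%:A,
      vdeg (1, 1) P / vdeg (1, 1) Q = m%:R / n%:R,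
      vdeg (1, 0) P / vdeg (1, 0) Q = m%:R / n%:R
    & wt (1, -1) (en (1, 0) P) < 0].

Definition standard_mn_pair (l m n : nat) P Q : Prop :=
  [/\ mn_pair l m n P Q, in_L 1 P, in_L 1 Q & wt (1, -1) (st (1, 0) P) < 0].

Definition dirs_A P d : Prop :=
  [/\ Dir P d, in_I d, wt (0, -1) (st d P) < -1 & wt (1, -1) (st d P) < 0].

Definition corner_pt (l : nat) (a : int) (b : nat) : rat * rat :=
  (a%:~R / l%:R, b%:R).

Definition regular_corner (l m : nat) P (C : (rat * rat) * (int * int)) : Prop :=
  [/\ exists a b, [/\ C.1 = corner_pt l a b, (1 <= b)%N & a%:~R / l%:R < b%:R :> rat],
      in_I C.2,
      Dir P C.2
    & C.1 = scale_pt m%:R^-1 (en C.2 P)].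

Definition monom (e : expo) : A := << 1 *g e >>.

(* kappa and p are determined by d and P: the power of y in a term of          *)
(* x^kappa p(z), where z = x^(- sigma / rho) y, is the power of z.             *)
Definition type_II P Q d : Prop :=
  bracket (ell d P) (ell d Q) = 0 /\
  exists (kappa : rat) (p : {poly K}),
    ell d P =
      monom (kappa, 0%N) * horner_alg (monom (- d.2%:~R / d.1%:~R, 1%N)) p /\
    exists c1 c2 : K,
      [/\ c1 != c2, ('X - c1%:P) %| p & ('X - c2%:P) %| p].

Definition starting_triple (l m : nat) P A0 A0' d : Prop :=
  unique (fun C => regular_corner l m P C /\ ~ dirs_A P C.2) (A0, d) /\
  A0' = scale_pt m%:R^-1 (st d P).

Definition assoc_F (l : nat) P Q d F : Prop :=
  [/\ in_L l F, homogeneous d F, vdeg d F = (d.1 + d.2)%:~R,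
      bracket F (ell d P) = ell d P
    & exists G0 : A, [/\ in_subalg P Q G0, G0 != 0,
        bracket (ell d G0) (ell d P) * F = ell d G0 * ell d P
      & forall i : nat, (1 <= i)%N ->
          bracket (ell d (iter i (fun G => bracket G P) G0)) (ell d P) = 0]].

Definition is_power (l m : nat) P d (e : nat) : Prop :=
  exists R, [/\ in_L l R, homogeneous d R & ell d P = R ^+ (m * e)].

Definition max_power (l m : nat) P d (e : nat) : Prop :=
  [/\ (0 < e)%N, is_power l m P d e
    & forall e' : nat, (0 < e')%N -> is_power l m P d e' -> (e' <= e)%N].

End Notions.

Definition Omega (N : nat) : nat := (\sum_(p <- primes N) logn p N)%N.

(* Main.v *)
(* Read along a direction (rho, sigma) with rho > 0, with s = sigma / rho and    *)
(* z = x^(- s) y, a homogeneous element is x^w f(z), and                         *)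
(* [x^w f, x^v g] = x^(w + v - 1 - s) (w f g' - v f' g); if they commute, the    *)
(* multiplicities of the roots of f and g are in the ratio w : v.                *)
(* The relation n v(P) = m v(Q) spreads from (1, 0) downwards through all        *)
(* directions in which P and Q have commuting leading forms, hence through all   *)
(* edges of P whose lower end has ordinate > 1; this identifies A(P) with the    *)
(* corners above the first one. Cancelling leading terms of powers of Q and P    *)
(* gives an element of K[P, Q] whose leading form does not commute with l(P),    *)
(* and the last such iterated bracket with P is G_0. Above (rho_j, sigma_j) the  *)
(* leading forms of G_0 and P do commute, because (1 + t) / v_t(P) decreases in  *)
(* the slope t. At corner i > j the exponents x such that l(P)^x lies in L^(l)   *)
(* form a group which contains v(G_0)/v(P) - v([G_0,P])/v(P) + 1 = p_j/(q_j m),  *)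
(* whence q_j | d_i, while q_i | d_i would make F_i minus a multiple of a power  *)
(* of R_i a solution of the equation for F_i of too small degree.                *)
Require Import Defs.
From mathcomp Require Import all_boot all_order all_algebra.
From mathcomp Require Import finmap ring lra zify.
From mathcomp.multinomials Require Import monalg.
From Stdlib Require Import Classical.
Set Implicit Arguments.
Unset Strict Implicit.
Unset Printing Implicit Defensive.
Import Order.TTheory GRing.Theory Num.Theory.
Local Open Scope ring_scope.

(** * Univariate polynomials *)

(** For a slope s = sigma / rho a leading form is encoded by its weight [degs s] and a polynomial
    [lead s] in z, and the bracket becomes the weighted Wronskian [wr] ([brk_hmg]). Multiplicities
    of roots and degrees then turn bracket relations into arithmetic.

    Geometry. Since [P, Q] is constant, the leading forms of P and Q commute whenever z^2 divides
    [lead s P] ([pair_wrl0]). So the ratio m : n of v_{1,0} is carried down the Newton polygons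
    ([bal_down]), and as m and n are coprime, the ends of such edges are m times points of (1/l) Z x
    N ([pair_corner], [pair_corner_lo]). Hence every edge in I whose start has ordinate > 1 and lies
    above the diagonal is a corner ([lower_end_above_corner]). Convexity gives this property to the
    start of every corner but the lowest ([corner_lo]); the lowest corner lacks it, as otherwise
    there would be a corner below it ([exists_lower_edge], [corner0_not_lo]). This determines A(P).

    Powers. At a corner with commuting leading forms l(P) is an m-th power in L^(l)
    ([admissible_frac]), and its degree in z bounds the further exponent, so d_j exists
    ([exists_max_pow]).

    The element F. On K[P, Q] the operator [., P] is a multiple of the derivative in Q, hence
    nilpotent on each element; a descent then yields G_0 and F ([exists_G0], [exists_F]). As
    [lead s P] has two distinct roots, [F, l(P)] = l(P) forces the degrees in z of F and l(P) to be
    in the ratio of their weights ([eigen_size]), so p_j / q_j = m (1 + s) / v(P) ([assoc_en]).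

    Divisibility. If q_i divided d_i, a power of a root of l(P) could be subtracted from F_i and
    contradict that degree ([eigen_ndvd]). For i > j, the leading forms of G_0 and [G_0, P]
    belonging to corner j commute with that of P at corner i ([commuting_above]); this makes
    l(P)^(p_j / (q_j m)) a fractional power in L^(l), so q_j divides d_i ([frac_power_max]). Then
    q_i cannot divide q_j. Finally d_j divides the coordinates of both ends of its edge ([d_dvd_D]),
    and each new q_j enlarges the least common multiple of the earlier ones ([Omega_chain]). Type II
    supplies at corner 0 the commutation and the two roots that the other corners always have
    ([admissible_roots]). *)

Section ClosedPoly.
Variable K : closedFieldType.
Implicit Types (p q r f g h : {poly K}) (c : K).

Lemma poly_root_ind (Pr : {poly K} -> Prop) :
  (forall c, c != 0 -> Pr c%:P) ->
  (forall p c, p != 0 -> Pr p -> Pr (('X - c%:P) * p)) ->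
  forall p, p != 0 -> Pr p.
Proof.
move=> Pc PX p p0; have [s ps] := closed_field_poly_normal p.
rewrite ps -mul_polyC.
elim: s {ps} => [|c s IH]; first by rewrite big_nil mulr1; apply: Pc; rewrite lead_coef_eq0.
rewrite big_cons mulrCA; apply: PX => //.
rewrite mulf_neq0 ?polyC_eq0 ?lead_coef_eq0 //.
by rewrite monic_neq0 // monic_prod_XsubC.
Qed.

Lemma mupX c p (k : nat) : p != 0 -> mup c (p ^+ k) = (k * mup c p)%N.
Proof.
move=> p0; elim: k => [|k IH].
  by rewrite mul0n mupNroot // expr0 rootE hornerE oner_eq0.
by rewrite exprS mupM ?expf_neq0 // IH mulSn.
Qed.

Lemma mup_XsubC c : mup c ('X - c%:P) = 1%N.
Proof. by have := mup_XsubCX 1 c c; rewrite expr1 eqxx. Qed.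

(** [p] splits into linear factors, which are cancelled from [q] one at a time. *)
Lemma dvdp_mup p q : p != 0 -> q != 0 ->
  (forall c, mup c p <= mup c q)%N -> p %| q.
Proof.
move=> p0; move: p p0 q; apply: poly_root_ind => [c c0 q _ _ | p c p0 IH q q0 le_pq].
  by rewrite -[c%:P]mulr1 mul_polyC dvdpZl // dvd1p.
have X0 : 'X - c%:P != 0 by rewrite polyXsubC_eq0.
have /dvdpP [q1 Dq] : 'X - c%:P %| q.
  rewrite XsubC_dvd // (leq_trans _ (le_pq c)) // mupM //.
  by rewrite mup_XsubC.
have q10 : q1 != 0 by apply: contraNneq q0 => Dq1; rewrite Dq Dq1 mul0r.
rewrite Dq mulrC dvdp_mul2r // IH // => d.
by have := le_pq d; rewrite Dq !mupM // addnC leq_add2r.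
Qed.

Lemma eqp_mup p q : p != 0 -> q != 0 ->
  (forall c, mup c p = mup c q) -> exists2 k : K, k != 0 & p = k *: q.
Proof.
move=> p0 q0 e; have /eqpP [[a b] /= /andP [a0 b0] Dab] : p %= q.
  by rewrite /eqp !dvdp_mup // => c; rewrite e.
exists (a^-1 * b); first by rewrite mulf_neq0 ?invr_eq0.
by rewrite -scalerA -Dab scalerA mulVf // scale1r.
Qed.

Lemma exp_root_exists (k : nat) (c : K) : (0 < k)%N -> exists x, x ^+ k = c.
Proof.
move=> k0.
have [x] := @solve_monicpoly K k (fun i => if i == 0%N then c else 0) k0.
rewrite (bigD1 (Ordinal k0)) //= expr0 mulr1 big1 ?addr0; first by exists x.
by move=> i ni; case: eqP => [i0|]; rewrite ?mul0r //; case/eqP: ni; apply/val_inj.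
Qed.

(** A root is removed with its full multiplicity, a multiple of [k]; what remains at the end is a
    constant, which has a k-th root. *)
Lemma poly_root_exists (k : nat) p : (0 < k)%N -> p != 0 ->
  (forall c, k %| mup c p)%N -> exists r, p = r ^+ k.
Proof.
move=> k0; have [N] := ubnP (size p).
elim: N p => // N IH p szp p0 dv.
have [sz1|sz1] := leqP (size p) 1.
  have [x xk] := exp_root_exists p`_0 k0; exists x%:P.
  by rewrite -rmorphXn /= xk -size1_polyC.
have /closed_rootP [c cp] : size p != 1%N by rewrite neq_ltn sz1 orbT.
have := mup_geq c (mup c p) p0; rewrite leqnn => /esym/dvdpP [q Dp].
have q0 : q != 0 by apply: contraNneq p0 => q0; rewrite Dp q0 mul0r.
have XX0 e : ('X - c%:P) ^+ e != 0 by rewrite expf_neq0 // polyXsubC_eq0.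
have mc : (0 < mup c p)%N by rewrite -XsubC_dvd // dvdp_XsubCl.
have /dvdnP [e De] := dv c.
have szq : (size q < N)%N.
  rewrite ltnS in szp; apply: leq_trans szp.
  have := congr1 (fun u : {poly K} => size u) Dp.
  by rewrite /= size_mul // size_exp_XsubC addnS /= => ->; rewrite -addn1 leq_add2l.
have dvq d : (k %| mup d q)%N.
  have : (k %| mup d q + mup d (('X - c%:P) ^+ mup c p))%N.
    by rewrite -mupM // -Dp.
  by rewrite dvdn_addl // mup_XsubCX; case: eqP => // _; exact: dvdn0.
have [r Dr] := IH q szq q0 dvq.
exists (r * ('X - c%:P) ^+ e).
by rewrite exprMn -exprM -De -Dr.
Qed.

(** This is f g times the logarithmic derivative of g^a / f^b, so its vanishing expresses that g^a
    and f^b are proportional. *)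
Definition wronsk (a b : K) f g := a *: (f * g^`()) - b *: (f^`() * g).

(** The extra factor X - c makes up for the order lost by differentiating, which treats i = 0 and j
    = 0 uniformly. The number a j - b i decides whether the order drops by exactly one. *)
Lemma mul_XsubC_wronsk c (a b : K) f g i j :
  ('X - c%:P) * wronsk a b (('X - c%:P) ^+ i * f) (('X - c%:P) ^+ j * g) =
  ('X - c%:P) ^+ (i + j) *
    ((a * j%:R - b * i%:R) *: (f * g) + ('X - c%:P) * wronsk a b f g).
Proof.
have dX n p : ('X - c%:P) * (('X - c%:P) ^+ n * p)^`() =
    ('X - c%:P) ^+ n * (n%:R *: p + ('X - c%:P) * p^`()).
  rewrite derivM mulrDr mulrDr; congr (_ + _); last by rewrite mulrCA.
  rewrite deriv_exp derivXsubC mul1r.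
  case: n => [|n]; first by rewrite mulr0n scale0r mul0r !mulr0.
  by rewrite /= mulrA mulrnAr -exprS mulrnAl scaler_nat mulrnAr.
rewrite /wronsk mulrBr -!scalerAr.
rewrite [_ * (_ * (_)^`())]mulrCA dX [('X - _) * (_^`() * _)]mulrA dX.
rewrite exprD -!mul_polyC !rmorphB !rmorphM /=.
by ring.
Qed.

Lemma wronsk_mup c (a b : K) f g : f != 0 -> g != 0 ->
  a * (mup c g)%:R != b * (mup c f)%:R ->
  wronsk a b f g != 0 /\ (mup c (wronsk a b f g)).+1 = (mup c f + mup c g)%N.
Proof.
move=> f0 g0; have [i [f1]] := multiplicity_XsubC f c; rewrite f0 /= => f1c Df.
have [j [g1]] := multiplicity_XsubC g c; rewrite g0 /= => g1c Dg.
have Ei : mup c f = i by rewrite Df mupMr // mup_XsubCX eqxx.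
have Ej : mup c g = j by rewrite Dg mupMr // mup_XsubCX eqxx.
rewrite Ei Ej => ne.
have := mul_XsubC_wronsk c a b f1 g1 i j.
rewrite ![_ ^+ _ * _]mulrC -Df -Dg [RHS]mulrC.
set w := wronsk a b f g; set U := (_ *: _ + _) => E.
have Uc : ~~ root U c.
  rewrite rootE hornerD hornerZ !hornerM hornerXsubC subrr mul0r addr0.
  apply: mulf_neq0; first by rewrite subr_eq0.
  exact: mulf_neq0.
have X0 : 'X - c%:P != 0 by rewrite polyXsubC_eq0.
have w0 : w != 0.
  apply/eqP => w0; move/eqP: E; rewrite w0 mulr0 eq_sym mulf_eq0 expf_eq0 (negPf X0) andbF /=.
  by move=> /eqP U0; rewrite U0 root0 in Uc.
split=> //; have := congr1 (mup c) E.
rewrite mupM // mupMl // mup_XsubCX eqxx.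
by rewrite mup_XsubC.
Qed.

Lemma size_XderivB p : (size ('X * p^`() - ((size p).-1)%:R *: p)%R <= (size p).-1)%N.
Proof.
apply/leq_sizeP => j le_j; rewrite coefB coefZ coefXM coef_deriv.
case: j le_j => [|j] le_j /=.
  by move: le_j; rewrite leqn0 => /eqP ->; rewrite mul0r subr0.
move: le_j; rewrite leq_eqVlt => /orP [/eqP -> | lt_j].
  by rewrite mulr_natl subrr.
by rewrite nth_default ?mul0rn ?mulr0 ?subr0 //; case: (size p) lt_j.
Qed.

(** The same mechanism at infinity: X d/dX multiplies a top term by its degree, so the top
    coefficient of X times the Wronskian is a j - b i times those of f and g. *)
Lemma wronsk_size (a b : K) f g : f != 0 -> g != 0 ->
  a * (size g).-1%:R != b * (size f).-1%:R ->
  (size (wronsk a b f g)) = ((size f).-1 + (size g).-1)%N.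
Proof.
move=> f0 g0 ne.
set i := (size f).-1; set j := (size g).-1.
have si : size f = i.+1 by rewrite prednK // size_poly_gt0.
have sj : size g = j.+1 by rewrite prednK // size_poly_gt0.
have E : 'X * wronsk a b f g = (a * j%:R - b * i%:R) *: (f * g) +
   (a *: (f * ('X * g^`() - j%:R *: g)) - b *: (('X * f^`() - i%:R *: f) * g)).
  by rewrite /wronsk -!mul_polyC !rmorphB !rmorphM /=; ring.
have sfg : size ((a * j%:R - b * i%:R) *: (f * g)) = (i + j).+1.
  by rewrite size_scale ?subr_eq0 // size_mul // si sj; lia.
have le1 : (size (a *: (f * ('X * g^`() - j%:R *: g)))%R <= i + j)%N.
  apply: leq_trans (size_scale_leq _ _) _; apply: leq_trans (size_polyMleq _ _) _.
  by have := size_XderivB g; rewrite -/j si; lia.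
have le2 : (size (b *: (('X * f^`() - i%:R *: f) * g))%R <= i + j)%N.
  apply: leq_trans (size_scale_leq _ _) _; apply: leq_trans (size_polyMleq _ _) _.
  by have := size_XderivB f; rewrite -/i sj; lia.
have : size ('X * wronsk a b f g) = (i + j).+1.
  rewrite E size_polyDl sfg // ltnS (leq_trans (size_polyD _ _)) //.
  by rewrite geq_max le1 size_polyN.
have [->|w0] := eqVneq (wronsk a b f g) 0; first by rewrite mulr0 size_poly0.
by rewrite size_mul ?polyX_eq0 // size_polyX => -[].
Qed.

End ClosedPoly.

(** * Rational weights in characteristic zero, and the equation [F, P] = P *)

Section CharZero.
Variable K : closedFieldType.
Hypothesis charK : [pchar K] =i pred0.
Implicit Types (p q r f g h : {poly K}) (c : K) (w v : rat).

Local Notation rK := (@ratr K).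

Lemma char0_natr_eq0 (n : nat) : (n%:R == 0 :> K) = (n == 0%N).
Proof. by have /(pcharf0P K) -> := charK. Qed.

Lemma char0_intr_eq0 (z : int) : (z%:~R == 0 :> K) = (z == 0).
Proof.
case: z => n; first by rewrite -pmulrn char0_natr_eq0.
by rewrite NegzE rmorphN /= oppr_eq0 -pmulrn char0_natr_eq0.
Qed.

(** [ratr] is defined by the reduced fraction; in characteristic 0 any fraction gives the same
    value, which makes [ratr] an embedding of fields. *)
Lemma ratr_frac (x y : int) : y != 0 -> rK (x%:~R / y%:~R) = x%:~R / y%:~R.
Proof.
move=> y0; have y0K : y%:~R != 0 :> K by rewrite char0_intr_eq0.
set q := x%:~R / y%:~R.
have d0K : (denq q)%:~R != 0 :> K by rewrite char0_intr_eq0 denq_eq0.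
have E : numq q * y = x * denq q.
  apply: (@intr_inj rat); rewrite !rmorphM /= numqE mulrAC.
  by rewrite /q divfK // intr_eq0.
apply/eqP; rewrite /ratr eqr_div // -!rmorphM /=.
by rewrite E.
Qed.

Lemma char0_ratrD w v : rK (w + v) = rK w + rK v.
Proof.
have d0 u : (denq u)%:~R != 0 :> K by rewrite char0_intr_eq0 denq_eq0.
have -> : w + v = (numq w * denq v + numq v * denq w)%:~R / (denq w * denq v)%:~R.
  by rewrite -{1}[w]divq_num_den -{1}[v]divq_num_den addf_div ?intr_eq0 // rmorphD !rmorphM.
rewrite ratr_frac ?mulf_neq0 // /ratr addf_div //.
by rewrite rmorphD !rmorphM.
Qed.

Lemma char0_ratrM w v : rK (w * v) = rK w * rK v.
Proof.
have d0 u : (denq u)%:~R != 0 :> K by rewrite char0_intr_eq0 denq_eq0.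
have -> : w * v = (numq w * numq v)%:~R / (denq w * denq v)%:~R.
  by rewrite -{1}[w]divq_num_den -{1}[v]divq_num_den mulf_div !rmorphM.
by rewrite ratr_frac ?mulf_neq0 // /ratr mulf_div !rmorphM.
Qed.

Lemma char0_ratrN w : rK (- w) = - rK w.
Proof.
apply/eqP; rewrite -addr_eq0 -char0_ratrD addNr.
by apply/eqP; exact: (ratr_nat K 0).
Qed.

Lemma char0_ratr_eq0 w : (rK w == 0) = (w == 0).
Proof.
by rewrite /ratr mulf_eq0 invr_eq0 !char0_intr_eq0 denq_eq0 orbF numq_eq0.
Qed.

Lemma char0_ratr_inj : injective rK.
Proof.
move=> w v E; apply/eqP; rewrite -subr_eq0 -char0_ratr_eq0.
by rewrite char0_ratrD char0_ratrN E subrr.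
Qed.

Definition wr w v f g := wronsk (rK w) (rK v) f g.

Lemma wr_mup c w v f g : f != 0 -> g != 0 ->
  w * (mup c g)%:R != v * (mup c f)%:R ->
  wr w v f g != 0 /\ (mup c (wr w v f g)).+1 = (mup c f + mup c g)%N.
Proof.
move=> f0 g0 ne; apply: wronsk_mup => //; apply: contraNneq ne => E.
by apply/eqP/char0_ratr_inj; rewrite !char0_ratrM !ratr_nat.
Qed.

Lemma wr0_mup c w v f g : f != 0 -> g != 0 -> wr w v f g = 0 ->
  w * (mup c g)%:R = v * (mup c f)%:R.
Proof.
move=> f0 g0 w0; apply/eqP/negPn/negP => /(wr_mup f0 g0) [].
by rewrite w0 eqxx.
Qed.

Lemma wr_size w v f g : f != 0 -> g != 0 ->
  w * (size g).-1%:R != v * (size f).-1%:R ->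
  size (wr w v f g) = ((size f).-1 + (size g).-1)%N.
Proof.
move=> f0 g0 ne; apply: wronsk_size => //; apply: contraNneq ne => E.
by apply/eqP/char0_ratr_inj; rewrite !char0_ratrM !ratr_nat.
Qed.

Lemma wr0_size w v f g : f != 0 -> g != 0 -> wr w v f g = 0 ->
  w * (size g).-1%:R = v * (size f).-1%:R.
Proof.
move=> f0 g0 w0; apply/eqP/negPn/negP => ne.
(* Size 0 leaves only the case of two constants, where both sides of [ne] are 0. *)
have := wr_size f0 g0 ne; rewrite w0 size_poly0 => /esym/eqP.
rewrite addn_eq0 => /andP [/eqP sf /eqP sg].
by rewrite sf sg !mulr0 eqxx in ne.
Qed.

(** If z^2 divided f, both terms of the Wronskian would vanish at 0. *)
Lemma wr_const_mup0 c w v f g : c != 0 -> f != 0 -> wr w v f g = c%:P ->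
  (mup 0 f <= 1)%N.
Proof.
move=> c0 f0 E; rewrite leqNgt mup_geq //; apply: contra_neqN c0.
rewrite subr0 => /dvdpP [q Df].
have := congr1 (horner^~ 0) E; rewrite hornerC => <-.
by rewrite /wr /wronsk Df derivM derivXn expr2 /= mulr2n expr1
  !(hornerD, hornerN, hornerZ, hornerM, hornerX); ring.
Qed.

Section Eigen.
(* The relation [F, P] = P for homogeneous F and P, read on polynomials in z. *)
Variables (wf w : rat) (f p : {poly K}) (c1 c2 : K).
Hypotheses (wf0 : wf != 0) (p0 : p != 0) (c12 : c1 != c2).
Hypotheses (pc1 : root p c1) (pc2 : root p c2) (fp : wr wf w f p = p).

Lemma eigen_neq0 : f != 0.
Proof.
apply: contraNneq p0 => f0; rewrite -fp f0 /wr /wronsk deriv0.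
by rewrite !mul0r !scaler0 subrr.
Qed.

(** At a root of p where f does not vanish, the Wronskian would have multiplicity one less than p,
    but it equals p. *)
Lemma eigen_root c : root p c -> root f c.
Proof.
move=> pc; apply/negPn/negP => fc; have m0 := mupNroot fc.
have mp : (0 < mup c p)%N by rewrite -XsubC_dvd // dvdp_XsubCl.
have [|_] := @wr_mup c wf w f p eigen_neq0 p0.
- by rewrite m0 mulr0 mulf_neq0 // pnatr_eq0 -lt0n.
- by move=> /eqP; rewrite fp m0 add0n eqn_leq ltnn.
Qed.

(** Otherwise the Wronskian p has degree deg f + deg p - 1, so deg f = 1, although f vanishes at
    both [c1] and [c2]. *)
Lemma eigen_size : wf * (size p).-1%:R = w * (size f).-1%:R.
Proof.
apply/eqP/negPn/negP => ne.
have := wr_size eigen_neq0 p0 ne; rewrite fp.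
have : (1 < (size f).-1)%N.
  have : (size [:: c1; c2] < size f)%N.
    by rewrite max_poly_roots ?eigen_neq0 //= ?eigen_root // inE c12.
  by case: (size f) => [|[|[|]]].
rewrite -(ltn_add2r (size p).-1) => + E; rewrite -E add1n.
by rewrite prednK ?ltnn // size_poly_gt0.
Qed.

End Eigen.

Lemma wrDl w v f1 f2 g : wr w v (f1 + f2) g = wr w v f1 g + wr w v f2 g.
Proof. by rewrite /wr /wronsk derivD -!mul_polyC; ring. Qed.

Lemma wrZl w v (c : K) f g : wr w v (c *: f) g = c *: wr w v f g.
Proof. by rewrite /wr /wronsk derivZ -!mul_polyC; ring. Qed.

Lemma wr_pow (i j : nat) w r : wr (i%:R * w) (j%:R * w) (r ^+ i) (r ^+ j) = 0.
Proof.
rewrite /wr /wronsk !char0_ratrM !ratr_nat !deriv_exp.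
case: i => [|i]; case: j => [|j]; rewrite ?mulr0n ?expr0 ?mul0r ?mulr0 ?scale0r ?scaler0 ?subrr //.
rewrite /= -!mul_polyC !rmorphM !rmorph_nat !exprS -!(mulr_natl (_ * _)).
move: (i.+1%:R : {poly K}) (j.+1%:R : {poly K}) => x y.
by ring.
Qed.

(** r^u commutes with r^k, so subtracting from f the multiple of r^u that cancels its top
    coefficient preserves the equation; but it lowers the degree, which [eigen_size] prescribes. *)
Lemma eigen_not_power (u k : nat) w f r (c1 c2 : K) :
  (0 < k)%N -> 0 < w -> (0 < u)%N -> c1 != c2 -> root r c1 -> root r c2 -> r != 0 ->
  (size f).-1 = (u * (size r).-1)%N ->
  wr (u%:R * w) (k%:R * w) f (r ^+ k) != r ^+ k.
Proof.
move=> k0 w0 u0 c12 rc1 rc2 r0 szf; apply/eqP => E.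
have p0 : r ^+ k != 0 by rewrite expf_neq0.
have ru0 : r ^+ u != 0 by rewrite expf_neq0.
have rt c : root r c -> root (r ^+ k) c.
  by rewrite !rootE horner_exp expf_eq0 k0.
have uw0 : u%:R * w != 0 by rewrite mulf_neq0 ?pnatr_eq0 -?lt0n // gt_eqF.
have kw0 : k%:R * w != 0 by rewrite mulf_neq0 ?pnatr_eq0 -?lt0n // gt_eqF.
have f0 := eigen_neq0 p0 E.
have szu : size (r ^+ u) = size f.
  by rewrite -[LHS]prednK ?size_poly_gt0 // size_exp mulnC -szf prednK // size_poly_gt0.
pose f1 := f + (- (lead_coef f / lead_coef (r ^+ u))) *: r ^+ u.
have E1 : wr (u%:R * w) (k%:R * w) f1 (r ^+ k) = r ^+ k.
  by rewrite /f1 wrDl wrZl wr_pow scaler0 addr0.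
have f10 := eigen_neq0 p0 E1.
have := eigen_size uw0 p0 c12 (rt _ rc1) (rt _ rc2) E.
rewrite (eigen_size uw0 p0 c12 (rt _ rc1) (rt _ rc2) E1).
move=> /(mulfI kw0)/eqP; rewrite eqr_nat => /eqP szf1.
have sf : size f1 = size f.
  by rewrite -[size f]prednK ?size_poly_gt0 // -szf1 prednK // size_poly_gt0.
case/eqP: f10; apply/eqP; rewrite -lead_coef_eq0 lead_coefE sf coefD coefZ.
by rewrite -{2}szu -!lead_coefE mulNr divfK ?subrr // lead_coef_eq0.
Qed.

(* At a root where the multiplicities of g and p are in the ratio wg : w, the   *)
(* multiplicity of h is bounded because wh < wg + w.                            *)
Lemma wr_dvd (wg w wh : rat) g p h : p != 0 -> h != 0 -> 0 < w -> wh < wg + w ->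
  wr wg w g p = h -> wr wh w h p = 0 -> h %| g * p.
Proof.
move=> p0 h0 w0 lt_w gph hp.
have g0 : g != 0.
  by apply: contraNneq h0 => g0; rewrite -gph g0 /wr /wronsk deriv0 !mul0r !scaler0 subrr.
apply: dvdp_mup; rewrite ?mulf_neq0 // => c; rewrite mupM //.
have [E|ne] := eqVneq (wg * (mup c p)%:R) (w * (mup c g)%:R); last first.
  by have [_] := wr_mup g0 p0 ne; rewrite gph => <-.
have Eh := wr0_mup c h0 p0 hp.
rewrite -(ler_nat rat) -(ler_pM2l w0) -Eh natrD mulrDr -E -mulrDl.
by apply: ler_wpM2r => //; apply: ltW.
Qed.

(** The multiplicities of every root in f and g are in the ratio w : v. With v / w = b / a in lowest
    terms, f^b and g^a have the same roots with multiplicities. Comparing degrees gives v >= 0, as f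
    is not constant. *)
Lemma wr0_pow w v f g : f != 0 -> g != 0 -> 0 < w -> (1 < size f)%N ->
  wr w v f g = 0 ->
  0 <= v /\ exists a b : nat, exists2 k : K,
    [/\ (0 < a)%N, a%:R * v = b%:R * w & k != 0] & g ^+ a = k *: f ^+ b.
Proof.
move=> f0 g0 w0 sf wr0.
have v0 : 0 <= v.
  have := wr0_size f0 g0 wr0; case: (size f) sf => // -[|n] //= _ E.
  rewrite -(@pmulr_lge0 _ n.+1%:R) ?ltr0n // -E.
  by rewrite mulr_ge0 // ltW.
split=> //; have vw : 0 <= v / w by rewrite divr_ge0 // ltW.
have n0 : 0 <= numq (v / w) by rewrite numq_ge0.
have Ev : `|denq (v / w)|%:R * v = `|numq (v / w)|%:R * w.
  rewrite !pmulrn absz_denq gez0_abs // numqE; field.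
  by rewrite gt_eqF.
have E c : mup c (g ^+ `|denq (v / w)|) = mup c (f ^+ `|numq (v / w)|).
  rewrite !mupX //; apply/eqP; rewrite -(eqr_nat rat) !natrM.
  rewrite -(inj_eq (mulfI (lt0r_neq0 w0))) mulrCA (wr0_mup c f0 g0 wr0).
  by rewrite mulrA Ev; apply/eqP; ring.
have [k k0 Ek] := eqp_mup (expf_neq0 _ g0) (expf_neq0 _ f0) E.
exists `|denq (v / w)|%N, `|numq (v / w)|%N, k => //; split=> //.
by rewrite absz_gt0 denq_eq0.
Qed.

End CharZero.

(** * Exponents of x in (1/l) Z *)

Section Lattice.
Variable l : nat.
Implicit Types (x y : rat).

Definition lat x : Prop := l%:R * x \is a Num.int.

Lemma lat0 : lat 0.
Proof. by rewrite /lat mulr0 rpred0. Qed.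
Lemma latD x y : lat x -> lat y -> lat (x + y).
Proof. by rewrite /lat mulrDr; exact: rpredD. Qed.
Lemma latN x : lat x -> lat (- x).
Proof. by rewrite /lat mulrN rpredN. Qed.
Lemma latB x y : lat x -> lat y -> lat (x - y).
Proof. by move=> lx ly; apply/latD/latN. Qed.
Lemma latMint (z : int) x : lat x -> lat (z%:~R * x).
Proof. by rewrite /lat mulrCA => ?; rewrite rpredM // intr_int. Qed.
Lemma latMn (n : nat) x : lat x -> lat (n%:R * x).
Proof. by rewrite pmulrn; exact: latMint. Qed.
Lemma latKD x y : lat x -> ~ lat y -> ~ lat (x + y).
Proof. by move=> lx nly lxy; apply: nly; rewrite -(addKr x y) addrC; apply: latB. Qed.

Variable K : closedFieldType.
Hypothesis charK : [pchar K] =i pred0.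
Variable s : rat.
Implicit Types (f g r h : {poly K}) (w v : rat).

(** Membership of x^w f(x^(- s) y) in L^(l), read on the coefficients of f. *)
Definition sup_in w f := forall j, f`_j != 0 -> lat (w - s * j%:R).

Lemma sup_inM w v f g : sup_in w f -> sup_in v g -> sup_in (w + v) (f * g).
Proof.
move=> sf sg j; rewrite coefM => nz.
have [i nzi] : exists i : 'I_j.+1, f`_i * g`_(j - i) != 0.
  apply/existsP; apply: contraNT nz => /existsPn nz; apply/eqP/big1 => i _.
  by apply/eqP/negPn/nz.
have [fi gi] : f`_i != 0 /\ g`_(j - i) != 0.
  by apply/andP; rewrite -negb_or -mulf_eq0.
have le_ij : (i <= j)%N by rewrite -ltnS.
have -> : w + v - s * j%:R = (w - s * i%:R) + (v - s * (j - i)%:R).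
  by rewrite natrB //; ring.
by apply: latD; [exact: sf | exact: sg].
Qed.

Lemma sup_in1 : sup_in 0 1.
Proof.
move=> j; rewrite coef1; case: j => [|j] /=; last by rewrite eqxx.
by rewrite mulr0 subr0 => _; exact: lat0.
Qed.

Lemma sup_inX w f n : sup_in w f -> sup_in (n%:R * w) (f ^+ n).
Proof.
move=> sf; elim: n => [|n IH]; first by rewrite mul0r expr0; exact: sup_in1.
have -> : n.+1%:R * w = w + n%:R * w by rewrite -natr1; ring.
by rewrite exprS; exact: sup_inM.
Qed.

Lemma sup_in_split w f : exists f1 f2, [/\ f = f1 + f2, sup_in w f1 &
  forall j, f2`_j != 0 -> ~ lat (w - s * j%:R) /\ f`_j != 0].
Proof.
pose b j := (l%:R * (w - s * j%:R) \is a Num.int).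
exists (\poly_(j < size f) (if b j then f`_j else 0)).
exists (\poly_(j < size f) (if b j then 0 else f`_j)).
split=> [|j|j].
- apply/polyP => j; rewrite coefD !coef_poly; case: ltnP => [_|le].
    by case: (b j); rewrite ?addr0 ?add0r.
  by rewrite addr0 nth_default.
- rewrite coef_poly; case: ltnP => _; last by rewrite eqxx.
  by rewrite /lat -/(b j); case: (b j) => //; rewrite eqxx.
rewrite coef_poly /lat -/(b j); case: ltnP => _; last by rewrite eqxx.
by case: (b j) => //; rewrite eqxx.
Qed.

(** If the part [f2] of f off the lattice were nonzero, the top term of f2 g would lie off the
    lattice; but f2 g is the difference of f g and f1 g, both on it. *)
Lemma sup_in_quot w v f g : g != 0 -> sup_in v g -> sup_in (w + v) (f * g) ->
  sup_in w f.
Proof.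
move=> g0 sg sfg; have [f1 [f2 [Df s1 nl2]]] := sup_in_split w f.
have [f20|f20] := eqVneq f2 0; first by rewrite Df f20 addr0.
have l2 : f2`_(size f2).-1 != 0 by rewrite -lead_coefE lead_coef_eq0.
have lg : g`_(size g).-1 != 0 by rewrite -lead_coefE lead_coef_eq0.
have [nla _] := nl2 _ l2.
pose j := ((size f2).-1 + (size g).-1)%N.
have Ej : w + v - s * j%:R = (v - s * (size g).-1%:R) + (w - s * (size f2).-1%:R).
  by rewrite /j natrD; ring.
have nlj : ~ lat (w + v - s * j%:R) by rewrite Ej; apply: latKD => //; exact: sg.
have z f0 : sup_in (w + v) f0 -> f0`_j = 0.
  by move=> sf0; apply/eqP/negPn/negP => /sf0.
have := z _ sfg; rewrite Df mulrDl coefD (z (f1 * g)) ?add0r; last exact: sup_inM.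
have -> : j = (size (f2 * g)).-1.
  rewrite size_mul // /j; have : (0 < size g)%N by rewrite size_poly_gt0.
  have : (0 < size f2)%N by rewrite size_poly_gt0.
  by case: (size f2) => // x; case: (size g) => // y; rewrite addSn addnS.
move/eqP; rewrite -lead_coefE lead_coef_eq0 mulf_eq0.
by rewrite (negPf f20) (negPf g0).
Qed.

(* If r1 collects the terms of r with exponents in the lattice and r2 <> 0 the *)
(* others, then the top term of r^n - r1^n lies off the lattice.                *)
Lemma sup_in_root w r (n : nat) : (0 < n)%N -> r != 0 ->
  sup_in (n%:R * w) (r ^+ n) -> lat (w - s * (size r).-1%:R) -> sup_in w r.
Proof.
case: n => // n _ r0 srn ltop; have [r1 [r2 [Dr s1 nl2]]] := sup_in_split w r.
have [r20|r20] := eqVneq r2 0; first by rewrite Dr r20 addr0.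
have sr : ((size r).-1 < size r)%N by rewrite prednK ?leqnn ?size_poly_gt0.
have sz2 : (size r2 < size r)%N.
  rewrite -(prednK (leq_ltn_trans (leq0n _) sr)) ltnS; apply/leq_sizeP => j le_j.
  apply/eqP/negPn/negP => /nl2 [nla rj].
  have lt_j : (j < size r)%N by rewrite ltnNge; apply: contraNN rj => /(nth_default 0) ->.
  by apply: nla; have -> : j = (size r).-1 by lia.
have Dr1 : r1 = r - r2 by rewrite Dr addrK.
have sz1 : size r1 = size r by rewrite Dr1 size_polyDl // size_polyN.
have lc1 : lead_coef r1 = lead_coef r by rewrite Dr1 lead_coefDl // size_polyN.
have r10 : r1 != 0 by rewrite -size_poly_gt0 sz1 size_poly_gt0.
pose d := (size r).-1.
pose T := \sum_(i < n.+1) r ^+ (n - i) * r1 ^+ i.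
have E : r ^+ n.+1 = r1 ^+ n.+1 + r2 * T.
  by apply/eqP; rewrite addrC -subr_eq subrXX [X in _ == X * _](_ : _ = r - r1) // Dr1; ring.
have szt (i : 'I_n.+1) : (size (r ^+ (n - i) * r1 ^+ i)).-1 = (n * d)%N.
  rewrite size_mul ?expf_neq0 //.
  have := size_exp r (n - i); have := size_exp r1 i; rewrite sz1 -/d.
  have : (0 < size (r ^+ (n - i)))%N by rewrite size_poly_gt0 expf_neq0.
  have : (0 < size (r1 ^+ i))%N by rewrite size_poly_gt0 expf_neq0.
  have le_in : (i <= n)%N by rewrite -ltnS.
  move: (size (r ^+ (n - i))) (size (r1 ^+ i)) => [|x] [|y] // _ _ /= -> ->.
  by rewrite addnS /= -mulnDr subnK // mulnC.
have Td : T`_(n * d) = n.+1%:R * lead_coef r ^+ n.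
  rewrite coef_sum (eq_bigr (fun _ => lead_coef r ^+ n)) ?sumr_const ?card_ord ?mulr_natl //.
  move=> i _; rewrite -(szt i) -lead_coefE lead_coefM !lead_coef_exp lc1 -exprD subnK //.
  by rewrite -ltnS.
have Td0 : T`_(n * d) != 0.
  by rewrite Td mulf_neq0 ?expf_neq0 ?lead_coef_eq0 // (char0_natr_eq0 charK).
have T0 : T != 0 by apply: contraNneq Td0 => ->; rewrite coef0.
have szT : (size T).-1 = (n * d)%N.
  apply/eqP; rewrite eqn_leq; apply/andP; split; last first.
    rewrite -ltnS prednK ?size_poly_gt0 // ltnNge; apply: contraNN Td0.
    by move/(nth_default 0) ->.
  rewrite -ltnS prednK ?size_poly_gt0 //; apply: leq_trans (size_sum _ _ _) _.
  by apply/bigmax_leqP => i _; rewrite -(szt i) leqSpred.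
have l2 : r2`_(size r2).-1 != 0 by rewrite -lead_coefE lead_coef_eq0.
have [nla _] := nl2 _ l2.
pose j := ((size r2).-1 + (size T).-1)%N.
have Ej : n.+1%:R * w - s * j%:R = n%:R * (w - s * d%:R) + (w - s * (size r2).-1%:R).
  by rewrite /j szT natrD natrM -natr1; ring.
have nlj : ~ lat (n.+1%:R * w - s * j%:R).
  by rewrite Ej; apply: latKD => //; exact: latMn.
have z f0 : sup_in (n.+1%:R * w) f0 -> f0`_j = 0.
  by move=> sf0; apply/eqP/negPn/negP => /sf0.
have := z _ srn; rewrite E coefD z ?add0r; last exact: sup_inX.
have -> : j = (size (r2 * T)).-1.
  rewrite size_mul // /j; have : (0 < size r2)%N by rewrite size_poly_gt0.
  have : (0 < size T)%N by rewrite size_poly_gt0.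
  by case: (size T) => // x; case: (size r2) => // y; rewrite addSn addnS.
move/eqP; rewrite -lead_coefE lead_coef_eq0 mulf_eq0.
by rewrite (negPf r20) (negPf T0).
Qed.

End Lattice.

(** * Leading forms *)

(* The properties of K[x^Q, y] on which the argument relies.                  *)
Record puiseux_alg (K : closedFieldType) := PuiseuxAlg {
  palg :> comAlgType K;
  cf : palg -> expo -> K;
  psupp : palg -> seq expo;
  mono : expo -> palg;
  cfD : forall P Q e, cf (P + Q) e = cf P e + cf Q e;
  cfZ : forall c P e, cf (c *: P) e = c * cf P e;
  cf_ext : forall P Q, cf P =1 cf Q -> P = Q;
  cf_mono : forall e e', cf (mono e) e' = (e == e')%:R;
  monoM : forall e e', mono e * mono e' = mono (addx e e');
  mono1 : mono expo0 = 1;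
  mem_psupp : forall P e, (e \in psupp P) = (cf P e != 0);
  psuppE : forall P, P = \sum_(e <- psupp P) cf P e *: mono e;
  px : palg -> palg;
  py : palg -> palg;
  cf_px : forall P r j, cf (px P) (r, j) = ratr (r + 1) * cf P (r + 1, j);
  cf_py : forall P r j, cf (py P) (r, j) = j.+1%:R * cf P (r, j.+1)
}.

Section LeadingForms.
Variable K : closedFieldType.
Hypothesis charK : [pchar K] =i pred0.
Variable A : puiseux_alg K.
Implicit Types (P Q F G H : A) (f g : {poly K}) (e : expo) (s w v : rat).

Lemma palg_scaleAr (c : K) P Q : P * (c *: Q) = c *: (P * Q).
Proof. by rewrite mulrC -scalerAl mulrC. Qed.

Lemma palg_hornerZ (c : K) P f : horner_alg P (c *: f) = c *: horner_alg P f.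
Proof. by rewrite -mul_polyC rmorphM /= horner_algC mulr_algl. Qed.

Lemma cf0 e : cf (0 : A) e = 0.
Proof. by rewrite -(scale0r 0) cfZ mul0r. Qed.
Lemma cfN P e : cf (- P) e = - cf P e.
Proof. by rewrite -scaleN1r cfZ mulN1r. Qed.
Lemma cfB P Q e : cf (P - Q) e = cf P e - cf Q e.
Proof. by rewrite cfD cfN. Qed.
Lemma cf_sum (I : Type) (r : seq I) (F : I -> A) e :
  cf (\sum_(i <- r) F i) e = \sum_(i <- r) cf (F i) e.
Proof. by elim/big_rec2: _ => [|i x y _ <-]; rewrite ?cf0 ?cfD. Qed.

Lemma palg_ind (Pr : A -> Prop) : Pr 0 ->
  (forall P Q, Pr P -> Pr Q -> Pr (P + Q)) -> (forall c e, Pr (c *: mono A e)) ->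
  forall P, Pr P.
Proof.
move=> Pr0 PrD PrU P; rewrite [P]psuppE.
by apply: (big_ind Pr) => // e _; exact: PrU.
Qed.

Lemma pxD P Q : px (P + Q) = px P + px Q.
Proof. by apply: cf_ext => -[r j]; rewrite cfD !cf_px cfD mulrDr. Qed.
Lemma pyD P Q : py (P + Q) = py P + py Q.
Proof. by apply: cf_ext => -[r j]; rewrite cfD !cf_py cfD mulrDr. Qed.
Lemma px0 : px (0 : A) = 0.
Proof. by apply: cf_ext => -[r j]; rewrite cf_px !cf0 mulr0. Qed.
Lemma py0 : py (0 : A) = 0.
Proof. by apply: cf_ext => -[r j]; rewrite cf_py !cf0 mulr0. Qed.

Lemma pxU (c : K) e : px (c *: mono A e) = (ratr e.1 * c) *: mono A (e.1 - 1, e.2).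
Proof.
apply: cf_ext => -[r j]; rewrite cf_px !cfZ !cf_mono; case: e => x y /=.
rewrite !xpair_eqE subr_eq; case: eqP => [->|_] /=; last by rewrite !mulr0.
by rewrite mulrA.
Qed.

Lemma pyU (c : K) e : py (c *: mono A e) = (e.2%:R * c) *: mono A (e.1, e.2.-1).
Proof.
apply: cf_ext => -[r j]; rewrite cf_py !cfZ !cf_mono; case: e => x [|y] /=.
  by rewrite !xpair_eqE andbF !mulr0 !mul0r.
rewrite !xpair_eqE eqSS; case: (x == r) => /=; last by rewrite !mulr0.
by case: eqP => [->|_]; rewrite ?mulr0 // mulrA.
Qed.

Lemma monoZM (c1 c2 : K) e1 e2 :
  (c1 *: mono A e1) * (c2 *: mono A e2) = (c1 * c2) *: mono A (addx e1 e2).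
Proof. by rewrite -scalerAl palg_scaleAr scalerA monoM. Qed.

Lemma pxM P Q : px (P * Q) = px P * Q + P * px Q.
Proof.
elim/palg_ind: P => [|P1 P2 E1 E2|c e]; first by rewrite mul0r px0 !mul0r addr0.
  by rewrite mulrDl !pxD E1 E2; ring.
elim/palg_ind: Q => [|Q1 Q2 E1 E2|c' e']; first by rewrite mulr0 px0 !mulr0 addr0.
  by rewrite mulrDr !pxD E1 E2; ring.
rewrite !(monoZM, pxU) /addx /= (char0_ratrD charK).
have -> : (e.1 - 1 + e'.1, (e.2 + e'.2)%N) = (e.1 + e'.1 - 1, (e.2 + e'.2)%N).
  by congr pair; ring.
rewrite addrA -scalerDl; congr (_ *: _); ring.
Qed.

Lemma pyM P Q : py (P * Q) = py P * Q + P * py Q.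
Proof.
elim/palg_ind: P => [|P1 P2 E1 E2|c e]; first by rewrite mul0r py0 !mul0r addr0.
  by rewrite mulrDl !pyD E1 E2; ring.
elim/palg_ind: Q => [|Q1 Q2 E1 E2|c' e']; first by rewrite mulr0 py0 !mulr0 addr0.
  by rewrite mulrDr !pyD E1 E2; ring.
rewrite !(monoZM, pyU) /addx /=; case: e e' => [x [|y]] [x' [|y']] /=;
  rewrite ?addn0 ?add0n ?addnS ?addSn /= ?mul0r ?mulr0 ?scale0r ?addr0 ?add0r //;
  rewrite -?scalerDl; congr (_ *: _); rewrite -!natr1 ?natrD; ring.
Qed.

Lemma pxZ (c : K) P : px (c *: P) = c *: px P.
Proof. by apply: cf_ext => -[r j]; rewrite cfZ !cf_px cfZ mulrCA. Qed.
Lemma pyZ (c : K) P : py (c *: P) = c *: py P.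
Proof. by apply: cf_ext => -[r j]; rewrite cfZ !cf_py cfZ mulrCA. Qed.

Definition brk P Q := px P * py Q - px Q * py P.

Lemma brkC P Q : brk P Q = - brk Q P.
Proof. by rewrite /brk opprB. Qed.
Lemma brkDl P Q H : brk (P + Q) H = brk P H + brk Q H.
Proof. by rewrite /brk pxD pyD; ring. Qed.
Lemma brkDr P Q H : brk H (P + Q) = brk H P + brk H Q.
Proof. by rewrite /brk pxD pyD; ring. Qed.
Lemma brkMl P Q H : brk (P * Q) H = P * brk Q H + brk P H * Q.
Proof. by rewrite /brk pxM pyM; ring. Qed.
Lemma brkZl (c : K) P H : brk (c *: P) H = c *: brk P H.
Proof. by rewrite /brk pxZ pyZ palg_scaleAr -scalerAl scalerBr. Qed.
Lemma brkPP P : brk P P = 0.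
Proof. by rewrite /brk subrr. Qed.
Lemma brk0l P : brk 0 P = 0.
Proof. by rewrite /brk px0 py0 mul0r mulr0 subrr. Qed.
Lemma brk0r P : brk P 0 = 0.
Proof. by rewrite /brk px0 py0 mul0r mulr0 subrr. Qed.
Lemma brkNl P H : brk (- P) H = - brk P H.
Proof. by rewrite -scaleN1r brkZl scaleN1r. Qed.
Lemma brkBl P Q H : brk (P - Q) H = brk P H - brk Q H.
Proof. by rewrite brkDl brkNl. Qed.
(** The Leibniz rule for 1 = 1 * 1. *)
Lemma brk1l H : brk 1 H = 0.
Proof. by apply: (@addIr _ (brk 1 H)); rewrite add0r -[in RHS](mulr1 1) brkMl mulr1 mul1r. Qed.
Lemma brkXl P H n : brk (P ^+ n.+1) H = n.+1%:R *: (P ^+ n * brk P H).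
Proof.
elim: n => [|n IH]; first by rewrite expr1 expr0 mul1r scale1r.
rewrite exprS brkMl IH -[in RHS]natr1 scalerDl scale1r palg_scaleAr.
by rewrite mulrA -exprS [brk P H * _]mulrC.
Qed.

Section Slope.
Variable s : rat.

(* x^w f(z), where z = x^(- s) y.                                              *)
Definition hmg w f : A := mono A (w, 0%N) * horner_alg (mono A (- s, 1%N)) f.

Lemma monoX (x : rat) (y n : nat) : mono A (x, y) ^+ n = mono A (n%:R * x, (n * y)%N).
Proof.
elim: n => [|n IH]; first by rewrite mul0r mul0n expr0 -mono1.
by rewrite exprS IH monoM /addx /= -natr1 mulSn; congr mono; congr pair; ring.
Qed.

Lemma cf_hmg w f r j : cf (hmg w f) (r, j) = f`_j *+ (r == w - s * j%:R).
Proof.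
have -> : hmg w f = \sum_(i < size f) f`_i *: mono A (w - s * i%:R, i : nat).
  rewrite /hmg -[in LHS](coefK f) poly_def rmorph_sum mulr_sumr; apply: eq_bigr => i _.
  rewrite /= palg_hornerZ rmorphXn /= horner_algX monoX palg_scaleAr monoM /addx /=.
  by rewrite add0n muln1 mulrN mulrC.
rewrite cf_sum; have [lt_j|le_j] := ltnP j (size f).
  rewrite (bigD1 (Ordinal lt_j)) //= cfZ cf_mono xpair_eqE eqxx andbT eq_sym.
  rewrite big1 ?addr0 ?mulr_natr // => i ne.
  rewrite cfZ cf_mono xpair_eqE andbC; case: eqP => Eij; last by rewrite mulr0.
  by case/eqP: ne; apply: val_inj.
rewrite nth_default // mul0rn big1 // => i _; rewrite cfZ cf_mono xpair_eqE andbC.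
case: eqP => Eij; last by rewrite mulr0.
by move: (ltn_ord i); rewrite Eij ltnNge le_j.
Qed.

Lemma hmgD w f g : hmg w (f + g) = hmg w f + hmg w g.
Proof. by rewrite /hmg rmorphD mulrDr. Qed.
Lemma hmg0 w : hmg w 0 = 0.
Proof. by rewrite /hmg rmorph0 mulr0. Qed.
Lemma hmgZ w (c : K) f : hmg w (c *: f) = c *: hmg w f.
Proof. by rewrite /hmg palg_hornerZ palg_scaleAr. Qed.
Lemma hmgM w v f g : hmg w f * hmg v g = hmg (w + v) (f * g).
Proof.
rewrite /hmg rmorphM mulrACA; congr (_ * _).
by rewrite monoM.
Qed.
Lemma hmg1 : hmg 0 1 = 1.
Proof. by rewrite /hmg rmorph1 mulr1 -mono1. Qed.
Lemma hmgX w f n : hmg w f ^+ n = hmg (n%:R * w) (f ^+ n).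
Proof.
elim: n => [|n IH]; first by rewrite !expr0 mul0r hmg1.
by rewrite !exprS IH hmgM; congr hmg; rewrite -natr1; ring.
Qed.
Lemma hmg_eq0 w f : hmg w f = 0 -> f = 0.
Proof.
move=> E; apply/polyP => j; have := cf_hmg w f (w - s * j%:R) j.
by rewrite eqxx mulr1n E cf0 coef0.
Qed.
Lemma hmg_inj w f g : hmg w f = hmg w g -> f = g.
Proof.
move=> E; apply/polyP => j; have := cf_hmg w f (w - s * j%:R) j.
by rewrite E cf_hmg eqxx.
Qed.

Lemma px_hmg w f :
  px (hmg w f) = hmg (w - 1) (ratr w *: f - ratr s *: ('X * f^`())).
Proof.
apply: cf_ext => -[r j]; rewrite cf_px !cf_hmg coefB !coefZ coefXM.
have -> : (r + 1 == w - s * j%:R) = (r == w - 1 - s * j%:R).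
  by rewrite -subr_eq0 -[RHS]subr_eq0; congr (_ == _); ring.
case: eqP => [->|_]; last by rewrite mulr0n mulr0.
rewrite !mulr1n; have -> : w - 1 - s * j%:R + 1 = w - s * j%:R by ring.
rewrite (char0_ratrD charK) (char0_ratrN charK) (char0_ratrM charK) ratr_nat.
case: j => [|j] /=; first by rewrite mulr0 !subr0.
by rewrite coef_deriv -mulr_natl; ring.
Qed.

Lemma py_hmg w f : py (hmg w f) = hmg (w - s) (f^`()).
Proof.
apply: cf_ext => -[r j]; rewrite cf_py !cf_hmg coef_deriv.
have -> : w - s * j.+1%:R = w - s - s * j%:R by rewrite -natr1; ring.
by rewrite mulr_natl -!mulrnA mulnC.
Qed.

Lemma brk_hmg w v f g :
  brk (hmg w f) (hmg v g) = hmg (w + v - 1 - s) (wr w v f g).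
Proof.
rewrite /brk !px_hmg !py_hmg !hmgM.
have -> : v - 1 + (w - s) = w + v - 1 - s by ring.
have -> : w - 1 + (v - s) = w + v - 1 - s by ring.
rewrite -[- hmg _ _]scaleN1r -hmgZ -hmgD; congr hmg.
by rewrite /wr /wronsk -!mul_polyC; ring.
Qed.

Definition wq e : rat := e.1 + s * e.2%:R.

Definition le_wt w P := forall e, cf P e != 0 -> wq e <= w.

Lemma le_wtW w v P : w <= v -> le_wt w P -> le_wt v P.
Proof. by move=> le_wv lP e /lP h; apply: le_trans le_wv. Qed.
Lemma le_wt0 w : le_wt w 0.
Proof. by move=> e; rewrite cf0 eqxx. Qed.
Lemma le_wtD w P Q : le_wt w P -> le_wt w Q -> le_wt w (P + Q).
Proof.
move=> lP lQ e; rewrite cfD; have [->|nz _] := eqVneq (cf P e) 0; last exact: lP.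
by rewrite add0r; exact: lQ.
Qed.
Lemma le_wtN w P : le_wt w P -> le_wt w (- P).
Proof. by move=> lP e; rewrite cfN oppr_eq0; exact: lP. Qed.
Lemma le_wtU (c : K) e : le_wt (wq e) (c *: mono A e).
Proof.
by move=> e'; rewrite cfZ cf_mono; have [->|_] := eqVneq e e'; rewrite // mulr0 eqxx.
Qed.
Lemma wq_addx e e' : wq (addx e e') = wq e + wq e'.
Proof. by rewrite /wq /addx /= natrD; ring. Qed.
Lemma le_wtM w v P Q : le_wt w P -> le_wt v Q -> le_wt (w + v) (P * Q).
Proof.
move=> lP lQ; rewrite [P]psuppE mulr_suml big_seq.
apply: (big_ind (le_wt _)); [exact: le_wt0 | by move=> ? ?; exact: le_wtD |].
move=> e1 e1P; rewrite [Q]psuppE mulr_sumr big_seq.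
apply: (big_ind (le_wt _)); [exact: le_wt0 | by move=> ? ?; exact: le_wtD |].
move=> e2 e2Q; rewrite monoZM; apply: (le_wtW _ (@le_wtU _ _)); rewrite wq_addx.
by apply: lerD; [apply: lP | apply: lQ]; rewrite -mem_psupp.
Qed.
Lemma le_wt_px w P : le_wt w P -> le_wt (w - 1) (px P).
Proof.
move=> lP [r j]; rewrite cf_px mulf_eq0 negb_or => /andP [_ /lP].
by rewrite /wq /=; lra.
Qed.
Lemma le_wt_py w P : le_wt w P -> le_wt (w - s) (py P).
Proof.
move=> lP [r j]; rewrite cf_py mulf_eq0 negb_or => /andP [_ /lP].
by rewrite /wq /= -natr1; lra.
Qed.
Lemma le_wt_bracket w v P Q : le_wt w P -> le_wt v Q ->
  le_wt (w + v - 1 - s) (brk P Q).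
Proof.
move=> lP lQ; apply/le_wtD/le_wtN.
  by apply: (le_wtW _ (le_wtM (le_wt_px lP) (le_wt_py lQ))); lra.
by apply: (le_wtW _ (le_wtM (le_wt_px lQ) (le_wt_py lP))); lra.
Qed.
Lemma le_wt_hmg w f : le_wt w (hmg w f).
Proof.
move=> [r j]; rewrite cf_hmg.
have [->|_] := eqVneq r (w - s * j%:R); last by rewrite mulr0n eqxx.
by rewrite /wq /= subrK.
Qed.

(** P equals x^w f(z) up to terms of weight bounded strictly below w. The value f = 0 is allowed, so
    that sums, products and brackets follow one rule whether or not leading terms cancel. *)
Definition lform w f P := exists2 v, v < w & le_wt v (P - hmg w f).

Lemma lform_le w f P : lform w f P -> le_wt w P.
Proof.
move=> [v lt_vw lP]; rewrite -(subrK (hmg w f) P); apply: le_wtD; last exact: le_wt_hmg.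
by apply: le_wtW lP; exact: ltW.
Qed.

Lemma lform_cf w f P j : lform w f P -> cf P (w - s * j%:R, j) = f`_j.
Proof.
move=> [v lt_vw lP]; apply/eqP; rewrite -subr_eq0 -[f`_j]mulr1n.
have := cf_hmg w f (w - s * j%:R) j; rewrite eqxx => <-; rewrite -cfB.
by apply/negPn/negP => /lP; rewrite /wq /= subrK leNgt lt_vw.
Qed.

Lemma lform_hmg w f : lform w f (hmg w f).
Proof. by exists (w - 1); rewrite ?subrr; [lra | exact: le_wt0]. Qed.

Lemma lformD w f g P Q : lform w f P -> lform w g Q -> lform w (f + g) (P + Q).
Proof.
move=> [v lt_v lP] [v' lt_v' lQ]; exists (Num.max v v'); first by rewrite gt_max lt_v.
rewrite hmgD opprD addrACA; apply: le_wtD; [apply: le_wtW lP | apply: le_wtW lQ].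
  by rewrite le_max lexx.
by rewrite le_max lexx orbT.
Qed.

Lemma lformZ w f P (c : K) : lform w f P -> lform w (c *: f) (c *: P).
Proof.
move=> [v lt_v lP]; exists v => //; rewrite hmgZ -scalerBr => e.
by rewrite cfZ mulf_eq0 negb_or => /andP [_ /lP].
Qed.

Lemma lformM w v f g P Q : lform w f P -> lform v g Q -> lform (w + v) (f * g) (P * Q).
Proof.
move=> lP lQ; have lQ' := lform_le lQ; move: lP lQ => [v1 lt1 lP] [v2 lt2 lQ].
exists (Num.max (v1 + v) (w + v2)); first by rewrite gt_max ltrD2r ltrD2l lt1.
have -> : P * Q - hmg (w + v) (f * g) = (P - hmg w f) * Q + hmg w f * (Q - hmg v g).
  by rewrite -hmgM; ring.
apply: le_wtD.
  by apply: le_wtW (le_wtM lP lQ'); rewrite le_max lexx.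
by apply: le_wtW (le_wtM (@le_wt_hmg w f) lQ); rewrite le_max lexx orbT.
Qed.

Lemma lform_bracket w v f g P Q : lform w f P -> lform v g Q ->
  lform (w + v - 1 - s) (wr w v f g) (brk P Q).
Proof.
move=> lP lQ; have lQ' := lform_le lQ; move: lP lQ => [v1 lt1 lP] [v2 lt2 lQ].
exists (Num.max (v1 + v - 1 - s) (w + v2 - 1 - s)); first by rewrite gt_max; lra.
have -> : brk P Q - hmg (w + v - 1 - s) (wr w v f g) =
    brk (P - hmg w f) Q + brk (hmg w f) (Q - hmg v g).
  rewrite -brk_hmg brkBl brkDr brkC -[- hmg v g]scaleN1r.
  by rewrite [brk _ (_ *: _)]brkC brkZl scaleN1r -brkC opprK -brkC; ring.
apply: le_wtD.
  by apply: le_wtW (le_wt_bracket lP lQ'); rewrite le_max lexx.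
by apply: le_wtW (le_wt_bracket (@le_wt_hmg w f) lQ); rewrite le_max lexx orbT.
Qed.

Lemma lform1 : lform 0 1 1.
Proof. by rewrite -hmg1; exact: lform_hmg. Qed.

Lemma lformX w f P n : lform w f P -> lform (n%:R * w) (f ^+ n) (P ^+ n).
Proof.
move=> lP; elim: n => [|n IH]; first by rewrite mul0r; exact: lform1.
have -> : n.+1%:R * w = w + n%:R * w by rewrite -natr1; ring.
by rewrite !exprS; exact: lformM.
Qed.

Lemma lform_lt w f P v : lform w f P -> w < v -> lform v 0 P.
Proof. by move=> lP lt_wv; exists w => //; rewrite hmg0 subr0; exact: lform_le lP. Qed.

Lemma lform_neq0 w f P : lform w f P -> f != 0 -> P != 0.
Proof.
move=> lP; apply: contraNneq => P0; apply/eqP/polyP => j.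
by rewrite -(lform_cf j lP) P0 cf0 coef0.
Qed.

Lemma lform_uniq w v f g P : lform w f P -> lform v g P -> f != 0 -> g != 0 ->
  w = v /\ f = g.
Proof.
move=> lP lP' f0 g0; have E : w = v.
  apply/eqP; rewrite eq_le; apply/andP; split; rewrite leNgt; apply/negP => lt_.
    have := lform_lt lP' lt_; move/lform_cf => z; case/eqP: f0; apply/polyP => j.
    by rewrite -(lform_cf j lP) z.
  have := lform_lt lP lt_; move/lform_cf => z; case/eqP: g0; apply/polyP => j.
  by rewrite -(lform_cf j lP') z.
split=> //; apply/polyP => j.
by rewrite -(lform_cf j lP) E (lform_cf j lP').
Qed.

Definition degs P : rat :=
  let S := [seq wq e | e <- psupp P] in \big[Num.max/head 0 S]_(x <- S) x.

(** The size bound exceeds every ordinate of the support, so no leading coefficient is cut off. *)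
Definition lead P : {poly K} :=
  \poly_(j < (\max_(e <- psupp P) e.2).+1) cf P (degs P - s * j%:R, j).

Lemma lform_lead P : lform (degs P) (lead P) P.
Proof.
have cfl j : (lead P)`_j = cf P (degs P - s * j%:R, j).
  rewrite coef_poly; case: ltnP => // lt_j; apply/esym/eqP.
  apply: contraTT lt_j; rewrite -mem_psupp => jP; rewrite -ltnNge ltnS.
  by have := @leq_bigmax_seq _ (psupp P) predT (fun e => e.2) _ jP isT.
have le_deg e : cf P e != 0 -> wq e <= degs P.
  rewrite -mem_psupp => eP; rewrite /degs.
  by apply: le_bigmax_seq => //; exact: map_f.
pose S := [seq wq e | e <- psupp P & wq e < degs P].
(* The starting value [degs P - 1] keeps this maximum below [degs P] even when no term has lower
   weight. *)
have ltS : \big[Num.max/degs P - 1]_(x <- S) x < degs P.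
  rewrite big_seq; elim/big_ind: _ => [|x y|x /mapP [e]]; first by lra.
    by rewrite gt_max => -> ->.
  by rewrite mem_filter => /andP [lt_e _] ->.
exists (\big[Num.max/degs P - 1]_(x <- S) x) => // e nz.
have [lt_e|ge_e] := ltP (wq e) (degs P).
  apply: le_bigmax_seq => //; apply: map_f; rewrite mem_filter lt_e mem_psupp.
  move: nz; rewrite cfB; case: e lt_e => r j lt_e; rewrite cf_hmg.
  have [Er|_] := eqVneq r (degs P - s * j%:R); last by rewrite mulr0n subr0.
  by move: lt_e; rewrite Er /wq /= subrK ltxx.
case: e nz ge_e => r j; rewrite cfB cf_hmg => nz ge_e.
have [Er|ne] := eqVneq r (degs P - s * j%:R).
  by move: nz; rewrite Er eqxx cfl subrr eqxx.
move: nz; rewrite (negPf ne) mulr0n subr0 => /le_deg le_e.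
case/eqP: ne; apply/eqP; rewrite -subr_eq0 opprB addrA subr_eq0 -/(wq (r, j)).
by rewrite eq_le le_e.
Qed.

Lemma degs_wq P : P != 0 -> exists2 e, cf P e != 0 & wq e = degs P.
Proof.
move=> P0; have : psupp P != [::].
  apply: contraNneq P0 => E; apply/eqP/cf_ext => e; rewrite cf0; apply/eqP.
  by rewrite -[_ == _]negbK -mem_psupp E.
rewrite /degs; case E: (psupp P) => [//|e0 S] _ /=.
have : \big[Num.max/wq e0]_(x <- wq e0 :: [seq wq e | e <- S]) x
    \in [seq wq e | e <- e0 :: S].
  rewrite big_seq; elim/big_ind: _ => [|x y xS yS|x xS] //; first exact: mem_head.
  by rewrite /Num.max; case: ifP.
by case/mapP => e eS ->; exists e => //; rewrite -mem_psupp E.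
Qed.

Lemma lead_eq0 P : (lead P == 0) = (P == 0).
Proof.
apply/idP/idP => [/eqP l0|/eqP ->]; last first.
  by apply/eqP/polyP => j; rewrite coef0 -(lform_cf j (lform_lead 0)) cf0.
apply/negPn/negP => P0; have [[r j] nz E] := degs_wq P0.
have := lform_cf j (lform_lead P); rewrite l0 coef0 => z.
by move: nz; rewrite -{1}(addrK (s * j%:R) r) -/(wq (r, j)) E z eqxx.
Qed.

Lemma leadE w f P : lform w f P -> f != 0 -> degs P = w /\ lead P = f.
Proof.
move=> lP f0; apply: (lform_uniq (lform_lead P) lP) => //.
by rewrite lead_eq0; exact: lform_neq0 lP f0.
Qed.

Lemma palg_mulf_neq0 P Q : P != 0 -> Q != 0 -> P * Q != 0.
Proof.
rewrite -!lead_eq0 => P0 Q0.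
have [_ ->] := leadE (lformM (lform_lead P) (lform_lead Q)) (mulf_neq0 P0 Q0).
exact: mulf_neq0.
Qed.

Lemma palg_mulI P Q F : P != 0 -> P * Q = P * F -> Q = F.
Proof.
move=> P0 E; apply/eqP; rewrite -subr_eq0; apply/negPn/negP => ne.
by have := palg_mulf_neq0 P0 ne; rewrite mulrBr E subrr eqxx.
Qed.

Lemma degsM P Q : P != 0 -> Q != 0 -> degs (P * Q) = degs P + degs Q.
Proof.
rewrite -!lead_eq0 => P0 Q0.
by have [] := leadE (lformM (lform_lead P) (lform_lead Q)) (mulf_neq0 P0 Q0).
Qed.

Lemma degsX P n : P != 0 -> degs (P ^+ n) = n%:R * degs P.
Proof.
rewrite -lead_eq0 => P0.
by have [] := leadE (lformX n (lform_lead P)) (expf_neq0 n P0).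
Qed.

Definition wrl P Q := wr (degs P) (degs Q) (lead P) (lead Q).

Lemma degs_brk P Q : wrl P Q != 0 -> degs (brk P Q) = degs P + degs Q - 1 - s
  /\ lead (brk P Q) = wrl P Q.
Proof. by move=> nz; apply: leadE nz; apply: lform_bracket; exact: lform_lead. Qed.

Lemma degs_le w P : P != 0 -> le_wt w P -> degs P <= w.
Proof. by move=> P0 lP; have [e nz <-] := degs_wq P0; exact: lP. Qed.

Lemma degs_brk_le P Q : brk P Q != 0 -> degs (brk P Q) <= degs P + degs Q - 1 - s.
Proof.
move=> nz; apply: degs_le nz _.
exact: le_wt_bracket (lform_le (lform_lead _)) (lform_le (lform_lead _)).
Qed.

End Slope.
End LeadingForms.

(** * Propagation of a ratio of support functions *)

Section Propagation.
Implicit Types (p q : rat * rat) (S T : seq (rat * rat)) (t b : rat).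

Definition wpt t p : rat := p.1 + t * p.2.
Definition is_max t S p := p \in S /\ forall q, q \in S -> wpt t q <= wpt t p.
Definition lowest t S p :=
  is_max t S p /\ forall q, q \in S -> wpt t q = wpt t p -> p.2 <= q.2.
Definition highest t S p :=
  is_max t S p /\ forall q, q \in S -> wpt t q = wpt t p -> q.2 <= p.2.

(** The support functions of S and T in the direction (1, t) are in a fixed ratio; this is stated
    through points that attain the maxima. *)
Definition balanced (alpha beta : rat) S T t :=
  forall p q, is_max t S p -> is_max t T q -> alpha * wpt t p = beta * wpt t q.

Lemma max_seq (C : seq rat) x : x \in C ->
  exists2 y, y \in C & forall z, z \in C -> z <= y.
Proof.
case: C => // x0 C _; elim: C x0 => [|x1 C IH] x0.
  by exists x0; [exact: mem_head | move=> z; rewrite inE => /eqP ->].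
have [y yC max_y] := IH x1; have [le_y|lt_y] := leP x0 y.
  exists y; first by rewrite inE yC orbT.
  by move=> z; rewrite inE => /orP [/eqP ->|/max_y].
exists x0; first exact: mem_head.
move=> z; rewrite inE => /orP [/eqP -> //|/max_y le_z].
exact: ltW (le_lt_trans le_z lt_y).
Qed.

(** The slope t at which [wpt t] takes the same value at p and q; junk 0 if the ordinates agree. *)
Definition crossing p q : rat := - (p.1 - q.1) / (p.2 - q.2).

(** As the slope decreases, only a point of smaller ordinate can overtake p. Such a point is
    strictly behind p at b, because p is the lowest maximizer, so it would cross strictly between b'
    and b. *)
Lemma lowest_persists b b' S p : lowest b S p -> b' < b ->
  (forall q, q \in S -> ~ (b' < crossing q p < b)) -> is_max b' S p.
Proof.
move=> [[pS max_p] low_p] lt_b nc; split=> // q qS; rewrite leNgt; apply/negP => gt_q.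
have le_q := max_p q qS; move: gt_q le_q (low_p q qS) (nc q qS); rewrite /wpt /crossing.
move: q.1 q.2 p.1 p.2 => x y x0 y0 gt_q le_q low nc'.
have lt_y : y < y0 by nra.
have ny : y - y0 < 0 by lra.
have lo : b' < - (x - x0) / (y - y0) by rewrite ltr_ndivlMr //; lra.
apply: nc'; rewrite lo ltr_ndivrMr //=.
have ne : x + b * y != x0 + b * y0 by apply: contraTneq lt_y => /low; rewrite leNgt.
have : x + b * y < x0 + b * y0 by rewrite lt_neqAle ne.
by lra.
Qed.

Lemma count_lt (T : eqType) (a1 a2 : pred T) x (r : seq T) :
  (forall y, a1 y -> a2 y) -> ~~ a1 x -> a2 x -> x \in r ->
  (count a1 r < count a2 r)%N.
Proof.
move=> sub na1 ax; elim: r => //= y r IH; rewrite inE => /orP [/eqP <-|/IH lt_r].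
  by rewrite (negPf na1) ax ltnS; exact: sub_count.
rewrite -addnS; apply: leq_add => //.
by have := sub y; case: (a1 y) => // ->.
Qed.

(** Both support functions are piecewise affine with finitely many breaks. Down to the next break
    the lowest maximizers p and q remain maximal, and the proportionality of p and q carries the
    ratio there; the induction is on the number of breaks left. *)
Lemma balanced_down (alpha beta : rat) S T s0 s1 : s1 <= s0 ->
  (forall t, s1 < t <= s0 -> balanced alpha beta S T t ->
    exists p q, [/\ lowest t S p, lowest t T q, alpha * p.1 = beta * q.1
      & alpha * p.2 = beta * q.2]) ->
  balanced alpha beta S T s0 -> balanced alpha beta S T s1.
Proof.
(* [s1] is included so that there is always a next break in [s1, s0[. *)
pose B := s1 :: [seq crossing p q | p <- S ++ T, q <- S ++ T].
have [N] := ubnP (size [seq b <- B | s1 <= b < s0]).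
elim: N s0 => // N IH s0 szB le_s H bal; move: le_s.
rewrite le_eqVlt => /orP [/eqP -> //|lt_s].
have /max_seq [b] : s1 \in [seq b <- B | s1 <= b < s0].
  by rewrite mem_filter lexx lt_s mem_head.
rewrite mem_filter => /andP [/andP [le_b lt_b] bB] max_b.
have [|p [q [lp lq e1 e2]]] := H s0 _ bal; first by rewrite lt_s lexx.
have noc u v : u \in S ++ T -> v \in S ++ T -> ~ (b < crossing u v < s0).
  move=> uS vS /andP [lt1 lt2]; move: (lt1); rewrite ltNge max_b // mem_filter lt2.
  apply/andP; split; last by rewrite inE; apply/orP; right; apply/allpairsP; exists (u, v).
  by rewrite (le_trans le_b (ltW lt1)).
have mp : is_max b S p.
  apply: (lowest_persists lp lt_b) => u uS; apply: noc; first by rewrite mem_cat uS.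
  by rewrite mem_cat (proj1 (proj1 lp)).
have mq : is_max b T q.
  apply: (lowest_persists lq lt_b) => u uS; apply: noc; first by rewrite mem_cat uS orbT.
  by rewrite mem_cat (proj1 (proj1 lq)) orbT.
have bal_b : balanced alpha beta S T b.
  move=> p' q' [p'S mp'] [q'T mq'].
  have -> : wpt b p' = wpt b p by apply/eqP; rewrite eq_le (proj2 mp) // mp' // (proj1 mp).
  have -> : wpt b q' = wpt b q by apply/eqP; rewrite eq_le (proj2 mq) // mq' // (proj1 mq).
  by rewrite /wpt !mulrDr e1 mulrCA e2 mulrCA.
apply: (IH b) => //; last first.
  by move=> t /andP [lt1 le2]; apply: H; rewrite lt1 (le_trans le2 (ltW lt_b)).
rewrite ltnS in szB; apply: leq_trans szB.
rewrite !size_filter; apply: (@count_lt _ _ _ b) => //.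
- by move=> x /andP [-> lt_x]; exact: lt_trans lt_x lt_b.
- by rewrite ltxx andbF.
by rewrite le_b.
Qed.

(** This reflection replaces the slope t by - t and exchanges lowest and highest points, so
    propagation upwards follows from propagation downwards. *)
Definition reflect_pt p : rat * rat := (p.1, - p.2).

Lemma reflect_ptK : involutive reflect_pt.
Proof. by move=> [x y]; rewrite /reflect_pt /= opprK. Qed.

Lemma wpt_reflect t p : wpt (- t) (reflect_pt p) = wpt t p.
Proof. by rewrite /wpt /= mulrNN. Qed.

Lemma is_max_reflect t S p :
  is_max (- t) [seq reflect_pt q | q <- S] (reflect_pt p) <-> is_max t S p.
Proof.
rewrite /is_max mem_map; last exact: (inv_inj reflect_ptK).
split=> -[pS max_p]; split=> // q.
  by move=> qS; rewrite -!(wpt_reflect t); apply: max_p; exact: map_f.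
by move=> /mapP [q' q'S ->]; rewrite !wpt_reflect; exact: max_p.
Qed.

Lemma balanced_reflect (alpha beta : rat) S T t :
  balanced alpha beta [seq reflect_pt q | q <- S] [seq reflect_pt q | q <- T] (- t)
  <-> balanced alpha beta S T t.
Proof.
split=> bal p q mp mq.
  by rewrite -!(wpt_reflect t); apply: bal; apply/is_max_reflect.
rewrite -[p]reflect_ptK -[q]reflect_ptK !wpt_reflect.
by apply: bal; apply/is_max_reflect; rewrite reflect_ptK.
Qed.

Lemma lowest_reflect t S p : highest t S p ->
  lowest (- t) [seq reflect_pt q | q <- S] (reflect_pt p).
Proof.
move=> [mp hp]; split; first exact/is_max_reflect.
by move=> q /mapP [q' q'S ->]; rewrite !wpt_reflect lerN2; exact: hp.
Qed.

Lemma balanced_up (alpha beta : rat) S T s0 s1 : s0 <= s1 ->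
  (forall t, s0 <= t < s1 -> balanced alpha beta S T t ->
    exists p q, [/\ highest t S p, highest t T q, alpha * p.1 = beta * q.1
      & alpha * p.2 = beta * q.2]) ->
  balanced alpha beta S T s0 -> balanced alpha beta S T s1.
Proof.
move=> le_s H /balanced_reflect bal; apply/balanced_reflect.
apply: balanced_down bal; first by rewrite lerN2.
move=> t lt_t; rewrite -[t]opprK => /balanced_reflect bal.
have [|p [q [hp hq e1 e2]]] := H (- t) _ bal; first by lra.
exists (reflect_pt p), (reflect_pt q).
by split=> //; [exact: lowest_reflect | exact: lowest_reflect | rewrite /= !mulrN e2].
Qed.

End Propagation.

(** * Vertices of the Newton polygon *)

Section Vertices.
Variable K : closedFieldType.
Hypothesis charK : [pchar K] =i pred0.
Variable A : puiseux_alg K.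
Implicit Types (P Q F G H : A) (f g : {poly K}) (e : expo) (s t w v : rat).

Lemma mup0_coef f : f != 0 ->
  f`_(mup 0 f) != 0 /\ forall j, f`_j != 0 -> (mup 0 f <= j)%N.
Proof.
move=> f0; have [i [g]] := multiplicity_XsubC f 0; rewrite f0 subr0 /= => g0 Df.
have Ei : mup 0 f = i by rewrite Df mupMr // -['X]subr0 mup_XsubCX eqxx.
rewrite Ei Df; split.
  by rewrite coefMXn ltnn subnn -horner_coef0.
by move=> j; rewrite coefMXn; case: ltnP; rewrite ?eqxx.
Qed.

(** The degree of the leading polynomial and its order at z = 0 are the ordinates of en and st;
    [vtx] is the exponent of the term in z^y. *)
Definition hi_y s P : nat := (size (lead s P)).-1.
Definition lo_y s P : nat := mup 0 (lead s P).
Definition vtx s P (y : nat) : rat * rat := (degs s P - s * y%:R, y%:R).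
Definition pts P : seq (rat * rat) := [seq pt e | e <- psupp P].

Lemma mem_pts P e : cf P e != 0 -> pt e \in pts P.
Proof. by rewrite -mem_psupp => eP; exact: map_f. Qed.

Lemma vtx_pts s P y : (lead s P)`_y != 0 -> vtx s P y \in pts P.
Proof.
rewrite -(lform_cf y (lform_lead s P)) => nz.
exact: (mem_pts nz).
Qed.

Lemma wpt_vtx s t P y : wpt t (vtx s P y) = degs s P + (t - s) * y%:R.
Proof. by rewrite /wpt /=; ring. Qed.

Lemma pts_le s P p : p \in pts P -> wpt s p <= degs s P.
Proof.
case/mapP => e; rewrite mem_psupp => eP ->.
exact: (lform_le (lform_lead s P)) eP.
Qed.

Lemma vtx_max s P y : (lead s P)`_y != 0 -> is_max s (pts P) (vtx s P y).
Proof.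
move=> nz; split; first exact: vtx_pts.
by move=> q /(pts_le s); rewrite wpt_vtx subrr mul0r addr0.
Qed.

Lemma max_vtx s P p : p \in pts P -> wpt s p = degs s P ->
  exists2 y : nat, (lead s P)`_y != 0 & p = vtx s P y.
Proof.
case/mapP => -[r j]; rewrite mem_psupp => eP -> E; exists j.
  rewrite -(lform_cf j (lform_lead s P)) -E /wpt /=.
  by have -> : r + s * j%:R - s * j%:R = r by ring.
by rewrite /vtx -E /wpt /pt /=; congr pair; ring.
Qed.

Lemma lead_hi s P : P != 0 -> (lead s P)`_(hi_y s P) != 0.
Proof. by move=> P0; rewrite -lead_coefE lead_coef_eq0 lead_eq0. Qed.
Lemma lead_lo s P : P != 0 -> (lead s P)`_(lo_y s P) != 0.
Proof. by move=> P0; have := @mup0_coef (lead s P); rewrite lead_eq0 => /(_ P0) []. Qed.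

Lemma lead_le_hi s P y : (lead s P)`_y != 0 -> (y <= hi_y s P)%N.
Proof.
move=> nz; rewrite -ltnS /hi_y; apply: leq_trans (leqSpred _).
by rewrite ltnNge; apply: contraNN nz => /(nth_default 0) ->.
Qed.
Lemma lead_ge_lo s P y : P != 0 -> (lead s P)`_y != 0 -> (lo_y s P <= y)%N.
Proof. by move=> P0; have := @mup0_coef (lead s P); rewrite lead_eq0 => /(_ P0) [_]; apply. Qed.
Lemma lo_le_hi s P : P != 0 -> (lo_y s P <= hi_y s P)%N.
Proof. by move=> P0; apply/lead_le_hi/lead_lo. Qed.

Lemma is_max_degs s P p : P != 0 -> is_max s (pts P) p -> wpt s p = degs s P.
Proof.
move=> P0 [pP max_p]; apply/eqP; rewrite eq_le pts_le //=.
have [vP _] := vtx_max (lead_hi s P0).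
by have := max_p _ vP; rewrite wpt_vtx subrr mul0r addr0.
Qed.

Lemma lowest_lo s P : P != 0 -> lowest s (pts P) (vtx s P (lo_y s P)).
Proof.
move=> P0; split; first by apply/vtx_max/lead_lo.
move=> q qP; rewrite wpt_vtx subrr mul0r addr0 => /(max_vtx qP) [y nz ->] /=.
by rewrite ler_nat lead_ge_lo.
Qed.
Lemma highest_hi s P : P != 0 -> highest s (pts P) (vtx s P (hi_y s P)).
Proof.
move=> P0; split; first by apply/vtx_max/lead_hi.
move=> q qP; rewrite wpt_vtx subrr mul0r addr0 => /(max_vtx qP) [y nz ->] /=.
by rewrite ler_nat lead_le_hi.
Qed.

Lemma balanced_degs (alpha beta : rat) P Q s : P != 0 -> Q != 0 ->
  balanced alpha beta (pts P) (pts Q) s <-> alpha * degs s P = beta * degs s Q.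
Proof.
move=> P0 Q0; split=> [bal|E p q mp mq]; last first.
  by rewrite (is_max_degs P0 mp) (is_max_degs Q0 mq).
have := bal _ _ (vtx_max (lead_hi s P0)) (vtx_max (lead_hi s Q0)).
by rewrite !wpt_vtx subrr !mul0r !addr0.
Qed.

Lemma degs_down (alpha beta : rat) P Q s0 s1 : P != 0 -> Q != 0 -> s1 <= s0 ->
  (forall t, s1 < t <= s0 -> alpha * degs t P = beta * degs t Q ->
    alpha * (lo_y t P)%:R = beta * (lo_y t Q)%:R) ->
  alpha * degs s0 P = beta * degs s0 Q -> alpha * degs s1 P = beta * degs s1 Q.
Proof.
move=> P0 Q0 le_s H /balanced_degs bal; apply/balanced_degs => //.
apply: balanced_down le_s _ (bal P0 Q0) => t lt_t /balanced_degs E.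
exists (vtx t P (lo_y t P)), (vtx t Q (lo_y t Q)).
split; [exact: lowest_lo | exact: lowest_lo | | exact/H/E].
by rewrite /= !mulrBr E // !(mulrCA _ t) H // E.
Qed.

Lemma degs_up (alpha beta : rat) P Q s0 s1 : P != 0 -> Q != 0 -> s0 <= s1 ->
  (forall t, s0 <= t < s1 -> alpha * degs t P = beta * degs t Q ->
    alpha * (hi_y t P)%:R = beta * (hi_y t Q)%:R) ->
  alpha * degs s0 P = beta * degs s0 Q -> alpha * degs s1 P = beta * degs s1 Q.
Proof.
move=> P0 Q0 le_s H /balanced_degs bal; apply/balanced_degs => //.
apply: balanced_up le_s _ (bal P0 Q0) => t lt_t /balanced_degs E.
exists (vtx t P (hi_y t P)), (vtx t Q (hi_y t Q)).
split; [exact: highest_hi | exact: highest_hi | | exact/H/E].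
by rewrite /= !mulrBr E // !(mulrCA _ t) H // E.
Qed.

Lemma degs_ge s t P y : (lead s P)`_y != 0 -> degs s P + (t - s) * y%:R <= degs t P.
Proof. by move=> /vtx_pts/(pts_le t); rewrite wpt_vtx. Qed.

(** Convexity: the vertex of either direction bounds the weight in the other, and the two
    inequalities combine to (t - s) (lo - hi) >= 0. *)
Lemma hi_le_lo s t P : P != 0 -> s < t -> (hi_y s P <= lo_y t P)%N.
Proof.
move=> P0 lt_st; have := degs_ge t (lead_hi s P0); have := degs_ge s (lead_lo t P0).
by rewrite -(ler_nat rat); nra.
Qed.

(** Both sides are values of y - x at vertices; for slopes >= -1 this quantity does not decrease on
    the way up the polygon. *)
Lemma diag_hi_lo s t P : P != 0 -> -1 <= s -> s < t ->
  (1 + s) * (hi_y s P)%:R - degs s P <= (1 + t) * (lo_y t P)%:R - degs t P.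
Proof.
move=> P0 le_s lt_st; have := degs_ge s (lead_lo t P0).
have := hi_le_lo P0 lt_st; rewrite -(ler_nat rat); nra.
Qed.

(** The point en = (x, y) satisfies y > 1 and y > x. For en = m A with m > 1 this follows from the
    conditions b >= 1, b > a / l on a corner. *)
Definition above s P := (1 < hi_y s P)%N && (degs s P < (1 + s) * (hi_y s P)%:R).

End Vertices.

(** * (m, n)-pairs *)

Section Pair.
Variable K : closedFieldType.
Hypothesis charK : [pchar K] =i pred0.
Variable A : puiseux_alg K.
Implicit Types (F G H : A) (f g : {poly K}) (e : expo) (s t w v : rat).

Lemma lform_const s (c : K) : lform s 0 c%:P (c%:A : A).
Proof.
have -> : (c%:A : A) = hmg A s 0 c%:P; last exact: lform_hmg.
by rewrite /hmg horner_algC -[mono A _]/(mono A expo0) mono1 mul1r.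
Qed.

Lemma wrC w v f g : wr w v f g = - wr v w g f.
Proof. by rewrite /wr /wronsk opprB mulrC [g * _]mulrC. Qed.

Definition inL (l : nat) G := forall e, cf G e != 0 -> lat l e.1.

Lemma inL_sup l s G : inL l G -> sup_in l s (degs s G) (lead s G).
Proof. by move=> LG j; rewrite -(lform_cf j (lform_lead s G)) => /LG. Qed.

Lemma inLD l G H : inL l G -> inL l H -> inL l (G + H).
Proof.
move=> LG LH e; rewrite cfD; have [->|nz _] := eqVneq (cf G e) 0; last exact: LG.
by rewrite add0r; exact: LH.
Qed.
Lemma inL0 l : inL l (0 : A).
Proof. by move=> e; rewrite cf0 eqxx. Qed.
Lemma inLU l (c : K) e : lat l e.1 -> inL l (c *: mono A e).
Proof.
move=> le e'; rewrite cfZ cf_mono; have [<-|_] := eqVneq e e' => //.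
by rewrite mulr0 eqxx.
Qed.
Lemma inLM l G H : inL l G -> inL l H -> inL l (G * H).
Proof.
move=> LG LH; rewrite [G]psuppE mulr_suml big_seq.
apply: (big_ind (inL l)); [exact: inL0 | by move=> ? ?; exact: inLD |].
move=> e1; rewrite mem_psupp => /LG l1; rewrite [H]psuppE mulr_sumr big_seq.
apply: (big_ind (inL l)); [exact: inL0 | by move=> ? ?; exact: inLD |].
by move=> e2; rewrite mem_psupp => /LH l2; rewrite monoZM; apply/inLU/latD.
Qed.
Lemma inL_const l (c : K) : inL l (c%:A : A).
Proof. by rewrite -mono1; apply/inLU/lat0. Qed.

Variables (m n l : nat) (P Q : A) (c : K).
Hypotheses (m_gt0 : (0 < m)%N) (n_gt0 : (0 < n)%N) (co_mn : coprime m n).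
Hypotheses (l_gt0 : (0 < l)%N) (LP : inL l P) (LQ : inL l Q).
Hypotheses (c0 : c != 0) (PQc : brk P Q = c%:A).
Hypothesis bal0 : n%:R * degs 0 P = m%:R * degs 0 Q.

Lemma pair_neq0 : P != 0 /\ Q != 0.
Proof.
have nz : (c%:A : A) != 0 by rewrite (lform_neq0 (lform_const 0 c)) // polyC_eq0.
split; apply: contraNneq nz => E; rewrite -PQc E.
  by rewrite brk0l.
by rewrite brk0r.
Qed.

Let P0 : P != 0 := proj1 pair_neq0.
Let Q0 : Q != 0 := proj2 pair_neq0.

Lemma degs_brk_pair s : degs s (brk P Q) = 0.
Proof. by rewrite PQc; have [] := leadE (lform_const s c); rewrite ?polyC_eq0. Qed.

(** The constant [P, Q] has weight 0, and a bracket has weight at most v(P) + v(Q) - 1 - s. *)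
Lemma pair_sum s : 1 + s <= degs s P + degs s Q.
Proof.
have nz : brk P Q != 0.
  by rewrite PQc (lform_neq0 (lform_const 0 c)) // polyC_eq0.
by have := @degs_brk_le K A s P Q nz; rewrite degs_brk_pair; lra.
Qed.

Definition bal s := n%:R * degs s P = m%:R * degs s Q.

Lemma bal_pos s : bal s -> -1 < s -> 0 < degs s P /\ 0 < degs s Q.
Proof.
move=> b s_gt; have := pair_sum s; have := b; rewrite /bal.
have : 0 < m%:R :> rat by rewrite ltr0n.
have : 0 < n%:R :> rat by rewrite ltr0n.
move: (n%:R : rat) (m%:R : rat) (degs s P) (degs s Q) => x y u v x0 y0 E le_uv.
have u0 : 0 < u.
  by rewrite ltNge; apply/negP => u0; have : y * v <= 0; [rewrite -E; nra | nra].
by split=> //; rewrite ltNge; apply/negP => v0; nra.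
Qed.

(** If the leading forms did not commute, their Wronskian would be the constant [c], which is
    impossible when z^2 divides [lead s P]. *)
Lemma pair_wrl0 s : (1 < lo_y s P)%N -> wrl s P Q = 0.
Proof.
move=> lo1; apply/eqP/negPn/negP => nz; move: lo1; rewrite ltnNge.
have [_ El] := degs_brk charK nz; case/negP.
apply: (@wr_const_mup0 K c (degs s P) (degs s Q) (lead s P) (lead s Q)) => //.
  by rewrite lead_eq0.
rewrite -[LHS]El PQc.
by have [] := leadE (lform_const s c); rewrite ?polyC_eq0.
Qed.

Lemma pair_mup s (x : K) : bal s -> -1 < s -> wrl s P Q = 0 ->
  (n * mup x (lead s P) = m * mup x (lead s Q))%N.
Proof.
move=> b s_gt w0; have [pP pQ] := bal_pos b s_gt.
have E := wr0_mup charK x _ _ w0; move: E; rewrite !lead_eq0 => /(_ P0 Q0) E.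
apply/eqP; rewrite -(eqr_nat rat) !natrM; apply/eqP.
move: b; rewrite /bal => b.
by apply: (mulfI (lt0r_neq0 pQ)); rewrite mulrCA -E mulrA b; ring.
Qed.

Lemma pair_hi s : bal s -> -1 < s -> wrl s P Q = 0 -> (n * hi_y s P = m * hi_y s Q)%N.
Proof.
move=> b s_gt w0; have [pP pQ] := bal_pos b s_gt.
have E := wr0_size charK _ _ w0; move: E; rewrite !lead_eq0 => /(_ P0 Q0) E.
apply/eqP; rewrite -(eqr_nat rat) !natrM; apply/eqP.
move: b; rewrite /bal => b.
by apply: (mulfI (lt0r_neq0 pQ)); rewrite mulrCA -E mulrA b; ring.
Qed.

(** As long as the lower end of P has ordinate > 1, the leading forms commute; the orders at z = 0
    are then in the ratio m : n, which is what [degs_down] needs to continue. *)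
Lemma bal_down s : -1 <= s -> s <= 0 ->
  (forall t, s < t <= 0 -> (1 < lo_y t P)%N) -> bal s.
Proof.
move=> s_ge s_le lo1; apply: degs_down s_le _ bal0 => // t lt_t b.
rewrite -!natrM; congr (_%:R); apply: pair_mup => //; first by lra.
exact/pair_wrl0/lo1.
Qed.

Lemma bal_above s t : above s P -> -1 < s -> s <= t -> t <= 0 -> bal t.
Proof.
move=> /andP [hi1 _] s_gt le_st t_le; apply: bal_down => //; first by lra.
by move=> u lt_u; apply: leq_trans hi1 _; apply: hi_le_lo => //; lra.
Qed.

(** In integers, n i = m j with m and n coprime makes m divide i. *)
Lemma lat_div x y : lat l x -> lat l y -> n%:R * x = m%:R * y -> lat l (m%:R^-1 * x).
Proof.
rewrite /lat => /intrP [i Ei] /intrP [j Ej] E.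
have EZ : n%:Z * i = m%:Z * j.
  apply: (@intr_inj rat); rewrite !rmorphM /= -!pmulrn -Ei -Ej.
  by rewrite mulrCA E; ring.
have /dvdzP [k Ek] : (m %| i)%Z.
  rewrite -(@Gauss_dvdzr m n); last by rewrite /coprimez /=.
  by rewrite EZ dvdz_mulr.
rewrite mulrCA Ei Ek intrM mulrC -mulrA divff ?mulr1 ?intr_int //.
by rewrite pnatr_eq0 -lt0n.
Qed.

(* The point A = en(P) / m is in (1/l) Z x N.                                  *)
Lemma pair_corner s : bal s -> -1 < s -> wrl s P Q = 0 ->
  (m %| hi_y s P)%N /\ lat l (m%:R^-1 * (degs s P - s * (hi_y s P)%:R)).
Proof.
move=> b s_gt w0; have E := pair_hi b s_gt w0; split.
  by rewrite -(@Gauss_dvdr m n) // E dvdn_mulr.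
apply: (@lat_div _ (degs s Q - s * (hi_y s Q)%:R)).
- exact: (inL_sup LP (lead_hi s P0)).
- exact: (inL_sup LQ (lead_hi s Q0)).
by rewrite !mulrBr b !(mulrCA _ s) -!natrM E.
Qed.

Lemma pair_corner_lo s : bal s -> -1 < s -> wrl s P Q = 0 ->
  (m %| lo_y s P)%N /\ lat l (m%:R^-1 * (degs s P - s * (lo_y s P)%:R)).
Proof.
move=> b s_gt w0; have E := pair_mup 0 b s_gt w0; split.
  by rewrite -(@Gauss_dvdr m n) // E dvdn_mulr.
apply: (@lat_div _ (degs s Q - s * (lo_y s Q)%:R)).
- exact: (inL_sup LP (lead_lo s P0)).
- exact: (inL_sup LQ (lead_lo s Q0)).
by rewrite !mulrBr b !(mulrCA _ s) -!natrM E.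
Qed.

Lemma lform_mono s e : lform s (wq s e) 'X^(e.2) (mono A e).
Proof.
have -> : mono A e = hmg A s (wq s e) 'X^(e.2); last exact: lform_hmg.
rewrite /hmg rmorphXn /= horner_algX monoX monoM /addx /wq /= muln1 add0n.
by case: e => x y; congr (mono A (_, _)); rewrite /=; ring.
Qed.

Lemma degs_mono s e : degs s (mono A e) = wq s e /\ lo_y s (mono A e) = e.2.
Proof.
have [-> El] := leadE (lform_mono s e) (monic_neq0 (monicXn _ _)).
by rewrite /lo_y El; split=> //; rewrite -['X]subr0 mup_XsubCX eqxx.
Qed.

(* Otherwise v_{1,-1} would be negative on P and Q, whose bracket is constant. *)
Lemma exists_lower_edge s : -1 < s -> s <= 0 -> (1 < lo_y s P)%N ->
  degs s P < (1 + s) * (lo_y s P)%:R ->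
  ~ (forall t, -1 < t -> t < s -> hi_y t P = lo_y s P ->
       degs t P = degs s P + (t - s) * (lo_y s P)%:R -> lo_y t P = hi_y t P).
Proof.
move=> s_gt s_le lo1 lt_d H.
pose e : expo := (degs s P - s * (lo_y s P)%:R, lo_y s P).
have wqe t : wq t e = degs s P + (t - s) * (lo_y s P)%:R by rewrite /wq /=; ring.
have eP : cf P e != 0 by rewrite (lform_cf _ (lform_lead s P)) (lead_lo s P0).
have e0 : mono A e != 0.
  apply/eqP => E; have := cf_mono A e e; rewrite E cf0 eqxx => /esym/eqP.
  by rewrite oner_eq0.
have lo_t t : -1 < t -> t <= s -> degs t P = wq t e -> lo_y t P = lo_y s P.
  move=> t_gt; rewrite le_eqVlt => /orP [/eqP -> //|lt_t] E.
  have hi_t : hi_y t P = lo_y s P.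
    apply/eqP; rewrite eqn_leq (hi_le_lo P0 lt_t); apply: lead_le_hi.
    rewrite -(lform_cf _ (lform_lead t P)) E wqe.
    by have -> : degs s P + (t - s) * (lo_y s P)%:R - t * (lo_y s P)%:R
      = degs s P - s * (lo_y s P)%:R by ring.
  by rewrite H // E wqe.
(* P is compared with the monomial of exponent [e], in the ratio 1 : 1: the propagation then says
   that [e] stays maximal down to slope -1. *)
have deg_t t : -1 <= t -> t <= s -> degs t P = wq t e.
  move=> t_ge t_le; have := @degs_down K A 1 1 P (mono A e) s t P0 e0 t_le.
  rewrite !mul1r !(proj1 (degs_mono _ _)); apply.
    move=> u /andP [lt_u le_u]; rewrite !mul1r !(proj1 (degs_mono _ _)) => E.
    by rewrite (proj2 (degs_mono u e)) lo_t //; lra.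
  by rewrite wqe; ring.
have d_neg : degs (-1) P < 0 by rewrite deg_t ?wqe; nra.
have b : bal (-1).
  apply: bal_down => // t /andP [t_gt t_le]; have [le_t|lt_t] := leP t s.
    by rewrite lo_t // deg_t // ltW.
  apply: leq_trans lo1 _; apply: leq_trans (lo_le_hi s P0) _.
  exact: hi_le_lo.
have := pair_sum (-1); move: b; rewrite /bal.
have : 0 < m%:R :> rat by rewrite ltr0n.
have : 0 < n%:R :> rat by rewrite ltr0n.
by nra.
Qed.

End Pair.

(** * The elements G_0 and F *)

Section Existence.
Variable K : closedFieldType.
Hypothesis charK : [pchar K] =i pred0.
Variable A : puiseux_alg K.
Implicit Types (F G H : A) (e : expo) (s t w v : rat).
Variables (P Q : A) (c : K).
Hypotheses (c0 : c != 0) (PQc : brk P Q = c%:A).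

(** The outer variable is sent to Q and the inner one to P, so that [., P] acts as a derivative in
    the outer variable. *)
Definition peval (g : {poly {poly K}}) : A := (map_poly (horner_alg P) g).[Q].
Definition inPQ G := exists g, G = peval g.

Lemma pevalD g1 g2 : peval (g1 + g2) = peval g1 + peval g2.
Proof. by rewrite /peval rmorphD hornerD. Qed.
Lemma pevalM g1 g2 : peval (g1 * g2) = peval g1 * peval g2.
Proof. by rewrite /peval rmorphM hornerM. Qed.
Lemma pevalC (g : {poly K}) : peval g%:P = horner_alg P g.
Proof. by rewrite /peval map_polyC hornerC. Qed.
Lemma pevalX : peval 'X = Q.
Proof. by rewrite /peval map_polyX hornerX. Qed.

Lemma inPQD G H : inPQ G -> inPQ H -> inPQ (G + H).
Proof. by move=> [g ->] [h ->]; exists (g + h); rewrite pevalD. Qed.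
Lemma inPQM G H : inPQ G -> inPQ H -> inPQ (G * H).
Proof. by move=> [g ->] [h ->]; exists (g * h); rewrite pevalM. Qed.
Lemma inPQP : inPQ P.
Proof. by exists 'X%:P; rewrite pevalC horner_algX. Qed.
Lemma inPQQ : inPQ Q.
Proof. by exists 'X; rewrite pevalX. Qed.
Lemma inPQC (k : K) : inPQ k%:A.
Proof. by exists k%:P%:P; rewrite pevalC horner_algC. Qed.
Lemma inPQZ (k : K) G : inPQ G -> inPQ (k *: G).
Proof. by move=> iG; rewrite -mulr_algl; apply: inPQM iG; exact: inPQC. Qed.
Lemma inPQX G n : inPQ G -> inPQ (G ^+ n).
Proof.
move=> iG; elim: n => [|n IH]; last by rewrite exprS; exact: inPQM.
by rewrite expr0 -(scale1r 1); exact: inPQC.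
Qed.

Lemma brk_const (k : K) H : brk (k%:A) H = 0.
Proof. by rewrite brkZl (brk1l charK) scaler0. Qed.

Lemma brk_horner_alg (g : {poly K}) : brk (horner_alg P g) P = 0.
Proof.
elim/poly_ind: g => [|g k IH]; first by rewrite rmorph0 brk0l.
rewrite rmorphD rmorphM /= horner_algX horner_algC brkDl brkMl // brk_const.
by rewrite brkPP IH mulr0 mul0r !addr0.
Qed.

(** [., P] is a derivation that kills P and sends Q to - c. *)
Lemma brk_peval g : brk (peval g) P = - c *: peval g^`().
Proof.
elim/poly_ind: g => [|g k IH].
  by rewrite /peval rmorph0 horner0 brk0l deriv0 rmorph0 horner0 scaler0.
rewrite derivMXaddC !pevalD !pevalM pevalX pevalC brkDl brkMl // brk_horner_alg IH.
by rewrite brkC PQc addr0 mulrN palg_scaleAr mulr1 scalerDr -scalerAl !scaleNr.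
Qed.

Definition adP G := brk G P.

Lemma inPQ_ad G : inPQ G -> inPQ (adP G).
Proof. by move=> [g ->]; rewrite /adP brk_peval; apply: inPQZ; exists g^`(). Qed.

Lemma inPQ_iter i G : inPQ G -> inPQ (iter i adP G).
Proof. by move=> iG; elim: i => // i IH; exact: inPQ_ad. Qed.

Lemma iter_adP_peval i g : iter i adP (peval g) = (- c) ^+ i *: peval g^`(i).
Proof.
elim: i => [|i IH]; first by rewrite expr0 scale1r derivn0.
by rewrite iterS IH /adP brkZl brk_peval scalerA -exprSr -derivnS.
Qed.

Lemma adP_nilpotent G : inPQ G -> exists N, iter N adP G = 0.
Proof.
move=> [g ->]; exists (size g).
by rewrite iter_adP_peval derivn_poly0 // /peval rmorph0 horner0 scaler0.
Qed.

Lemma inPQ_inL l G : inL l P -> inL l Q -> inPQ G -> inL l G.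
Proof.
move=> LP LQ [g ->]; elim/poly_ind: g => [|g k IH].
  by rewrite /peval rmorph0 horner0; exact: inL0.
rewrite pevalD pevalM pevalX pevalC; apply: inLD; first exact: inLM.
elim/poly_ind: k => [|k a IHk]; first by rewrite rmorph0; exact: inL0.
rewrite rmorphD rmorphM /= horner_algX horner_algC.
by apply: inLD; [exact: inLM | exact: inL_const].
Qed.

Variables (l : nat) (s : rat).
Hypotheses (l_gt0 : (0 < l)%N) (LP : inL l P) (LQ : inL l Q).
Hypotheses (s_gt : -1 < s) (dP : 0 < degs s P) (hP : (0 < hi_y s P)%N).

Let P0 : P != 0.
Proof.
by move: hP; rewrite /hi_y -(lead_eq0 s) -size_poly_gt0; case: (size _).
Qed.

(** A common denominator of all weights i / l + s j. *)
Let rden := (l * `|denq s|)%N.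

Lemma lat_rden_s : lat rden s.
Proof.
rewrite /lat /rden natrM -mulrA rpredM // ?rpred_nat // pmulrn absz_denq mulrC.
by rewrite -numqE intr_int.
Qed.

Lemma lat_rden x : lat l x -> lat rden x.
Proof. by rewrite /lat /rden natrM mulrAC => lx; rewrite rpredM // rpred_nat. Qed.

Lemma degs_lat G : inL l G -> G != 0 -> lat rden (degs s G).
Proof.
move=> LG G0; have [e nz <-] := degs_wq s G0; apply: latD; first exact/lat_rden/LG.
by rewrite mulrC; apply/latMn/lat_rden_s.
Qed.

Lemma lat1 : lat rden 1.
Proof. by rewrite /lat mulr1 rpred_nat. Qed.

(** The gap between the weight of [H, P] and its upper bound; it is 0 when the leading forms of H
    and P do not commute. *)
Definition defect H := degs s H + degs s P - 1 - s - degs s (adP H).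

Lemma defect_ge0 H : adP H != 0 -> 0 <= defect H.
Proof. by move=> aH; rewrite subr_ge0; exact: degs_brk_le. Qed.

Lemma adP_neq0 H : adP H != 0 -> H != 0.
Proof. by apply: contraNneq => ->; rewrite /adP brk0l. Qed.

Lemma defect_lat H : inPQ H -> adP H != 0 -> lat rden (defect H).
Proof.
move=> iH aH; apply: latB; last by apply: degs_lat => //; apply/(inPQ_inL LP LQ)/inPQ_ad.
apply: latB lat_rden_s; apply: latB lat1; apply: latD; apply: degs_lat => //.
  exact: inPQ_inL.
exact: adP_neq0.
Qed.

(* G^a - k P^b cancels the leading term of G^a.                                *)
Lemma defect_decreases G : inPQ G -> adP G != 0 -> wrl s G P = 0 ->
  exists G', [/\ inPQ G', adP G' != 0 & defect G' < defect G].
Proof.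
move=> iG aG w0; have G0 := adP_neq0 aG.
have sP : (1 < size (lead s P))%N by move: hP; rewrite /hi_y; case: (size _) => [|[]].
have w0' : wr (degs s P) (degs s G) (lead s P) (lead s G) = 0.
  by rewrite wrC -[wr _ _ _ _]/(wrl s G P) w0 oppr0.
have lP0 : lead s P != 0 by rewrite lead_eq0.
have lG0 : lead s G != 0 by rewrite lead_eq0.
have [dG [a [b [k [a0 Eab k0] Ek]]]] := wr0_pow charK lP0 lG0 dP sP w0'.
case: a a0 Eab Ek => // a _ Eab Ek.
pose G' := G ^+ a.+1 - k *: P ^+ b.
have iG' : inPQ G'.
  by rewrite /G' -scaleNr; apply: inPQD; [exact: inPQX | exact/inPQZ/inPQX/inPQP].
(* P^b disappears in the bracket with P, so [G', P] has the weight of [G^a, P] while G' itself has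
   lost weight; this lowers the defect. *)
have aG' : adP G' = a.+1%:R *: (G ^+ a * adP G).
  rewrite /adP /G' brkBl brkXl // brkZl; case: (b) => [|b'].
    by rewrite expr0 (brk1l charK) scaler0 subr0.
  by rewrite brkXl // brkPP mulr0 !scaler0 subr0.
have X0 H j : H != 0 -> H ^+ j != 0.
  move=> H0; elim: j => [|j IH]; last by rewrite exprS; exact: (palg_mulf_neq0 s).
  by rewrite expr0 oner_neq0.
have M0 : G ^+ a * adP G != 0 by rewrite (palg_mulf_neq0 s) // X0.
have a0 : a.+1%:R != 0 :> K by rewrite (char0_natr_eq0 charK).
have Z0 : adP G' != 0 /\ degs s (adP G') = degs s (G ^+ a * adP G).
  have l0 : a.+1%:R *: lead s (G ^+ a * adP G) != 0.
    by rewrite scaler_eq0 negb_or a0 lead_eq0.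
  have lZ := lformZ a.+1%:R (lform_lead s (G ^+ a * adP G)).
  by rewrite aG' (lform_neq0 lZ l0); have [] := leadE lZ l0.
exists G'; split=> //; first by case: Z0.
have dG' : degs s G' < a.+1%:R * degs s G.
  have lG := lformX a.+1 (lform_lead s G).
  have := lformZ (- k) (lformX b (lform_lead s P)); rewrite -Eab => lPb.
  have := lformD lG lPb; rewrite Ek -scalerDl subrr scale0r scaleNr -/G'.
  move=> [v lt_v]; rewrite hmg0 subr0 => le_v.
  exact: le_lt_trans (degs_le (adP_neq0 (proj1 Z0)) le_v) lt_v.
rewrite /defect (proj2 Z0) degsM ?X0 // degsX // -natr1 in dG' *.
by move: dG'; lra.
Qed.

(** Defects are nonnegative and lie in (1 / rden) Z, so the descent of [defect_decreases] stops. *)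
Lemma exists_noncommuting G : inPQ G -> adP G != 0 ->
  exists2 G', inPQ G' & wrl s G' P != 0.
Proof.
move=> iG aG; have [N] : exists N : nat, rden%:R * defect G < N%:R.
  exists (Num.bound (rden%:R * defect G)); apply: archi_boundP.
  by rewrite mulr_ge0 // defect_ge0.
elim: N G iG aG => [|N IH] G iG aG ltN.
  by move: ltN; rewrite ltNge mulr_ge0 // defect_ge0.
have [w0|] := eqVneq (wrl s G P) 0; last by exists G.
have [G' [iG' aG' lt_d]] := defect_decreases iG aG w0.
apply: (IH G' iG' aG'); move: ltN (defect_lat iG aG) (defect_lat iG' aG').
rewrite /lat => ltN /intrP [i Ei] /intrP [j Ej].
have r0 : 0 < rden%:R :> rat by rewrite ltr0n muln_gt0 l_gt0 absz_gt0 denq_eq0.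
have : rden%:R * defect G' < rden%:R * defect G by rewrite ltr_pM2l.
by move: ltN; rewrite Ei Ej !pmulrn !ltr_int; lia.
Qed.

(** The descent starts from Q, for which [Q, P] = - c is nonzero. Among the iterated brackets of its
    outcome with P, which vanish eventually, the last one whose leading form does not commute with
    that of P is G0. *)
Lemma exists_G0 : exists G0, [/\ inPQ G0, wrl s G0 P != 0 &
  forall i, (0 < i)%N -> wrl s (iter i adP G0) P = 0].
Proof.
have aQ : adP Q != 0.
  rewrite /adP brkC PQc -scaleNr (lform_neq0 (lform_const A 0 (- c))) //.
  by rewrite polyC_eq0 oppr_eq0.
have [G iG nz] := exists_noncommuting inPQQ aQ.
have [N iN0] := adP_nilpotent iG.
have wrl0 : wrl s 0 P = 0.
  have /eqP l0 : lead s (0 : A) == 0 by rewrite lead_eq0.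
  by rewrite /wrl l0 /wr /wronsk deriv0 !mul0r !scaler0 subrr.
have itN j : (N <= j)%N -> wrl s (iter j adP G) P = 0.
  move=> le_j; rewrite -(subnK le_j) iterD iN0; elim: (j - N)%N => // i IH.
  suff -> : iter i.+1 adP (0 : A) = 0 by [].
  by elim: {IH}i => [|i IH]; rewrite iterS ?IH /adP brk0l.
have exP : exists i, wrl s (iter i adP G) P != 0 by exists 0%N.
have ubP i : wrl s (iter i adP G) P != 0 -> (i <= N)%N.
  by apply: contraNT; rewrite -ltnNge => /ltnW /itN ->.
case: (ex_maxnP exP ubP) => i nz_i max_i.
exists (iter i adP G); split=> //; first exact: inPQ_iter.
move=> j j0; apply/eqP/negPn/negP; rewrite -iterD => /max_i.
by rewrite -{2}[i]add0n leq_add2r leqNgt j0.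
Qed.

(* F = l(G0) l(P) / l([G0, P]) as a polynomial in z.                           *)
Lemma exists_F : exists G0 f, [/\ inPQ G0, wrl s G0 P != 0,
  forall i, (0 < i)%N -> wrl s (iter i adP G0) P = 0,
  lead s G0 * lead s P = f * wrl s G0 P &
  wr (1 + s) (degs s P) f (lead s P) = lead s P /\ sup_in l s (1 + s) f].
Proof.
have [G0 [iG nz it0]] := exists_G0.
have [dE lE] := degs_brk charK nz.
have lP0 : lead s P != 0 by rewrite lead_eq0.
have w10 : wr (degs s G0 + degs s P - 1 - s) (degs s P) (wrl s G0 P) (lead s P) = 0.
  by rewrite -dE -lE; exact: (it0 1%N isT).
(* The weight condition of [wr_dvd], v([G0, P]) < v(G0) + v(P), amounts to 1 + s > 0. *)
have : wrl s G0 P %| lead s G0 * lead s P.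
  apply: (wr_dvd charK lP0 nz dP _ _ w10); last by [].
  by move: s_gt; lra.
case/dvdpP => f Ef; exists G0, f; split => //; split; last first.
  apply: (@sup_in_quot l K s (1 + s) (degs s (adP G0)) f (wrl s G0 P) nz).
    by rewrite -lE; apply: inL_sup; apply/(inPQ_inL LP LQ)/inPQ_ad.
  have -> : 1 + s + degs s (adP G0) = degs s G0 + degs s P by rewrite dE; ring.
  rewrite -Ef.
  by apply: sup_inM; apply: inL_sup => //; exact: inPQ_inL.
pose h := hmg A s.
set v := degs s G0 + degs s P - 1 - s in w10 dE.
(* With W the leading form of [G0, P], the Leibniz rule applied to W F = l(G0) l(P) gives W
   [F, l(P)] = W l(P), because W commutes with l(P); then W is cancelled. *)
have E : h v (wrl s G0 P) * (brk (h (1 + s) f) (h (degs s P) (lead s P))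
    - h (degs s P) (lead s P)) = 0.
  have bW : brk (h v (wrl s G0 P)) (h (degs s P) (lead s P)) = 0.
    by rewrite brk_hmg // w10 hmg0.
  have : brk (h v (wrl s G0 P) * h (1 + s) f) (h (degs s P) (lead s P)) =
     h v (wrl s G0 P) * h (degs s P) (lead s P).
    have -> : h v (wrl s G0 P) * h (1 + s) f = h (degs s G0) (lead s G0) * h (degs s P) (lead s P).
      by rewrite !hmgM Ef mulrC; congr hmg; rewrite /v; ring.
    by rewrite brkMl // brkPP mulr0 add0r brk_hmg.
  by rewrite brkMl // bW mul0r addr0 => Eh; rewrite mulrBr Eh subrr.
have hv0 : h v (wrl s G0 P) != 0 by apply: contraNneq nz => /hmg_eq0 ->.
have /eqP := palg_mulI s hv0 (etrans E (esym (mulr0 _))).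
rewrite subr_eq0 => /eqP; rewrite brk_hmg // => Ebr.
apply: (@hmg_inj K A s (degs s P)); rewrite -[RHS]Ebr; congr hmg; ring.
Qed.

End Existence.

(** The inequality behind [commuting_above]: [gs], [ps], [g1] are the weights of G, P, [G, P] at s,
    and [gt], [pt] those of G, P at t. Attaining the bound at t would give (1 + t) / pt >= (1 + s) /
    ps. *)
Lemma defect_slope (s t gt pt ps gs g1 : rat) : ps * gt = gs * pt -> 0 < pt ->
  ps * (gt + pt - 1 - t) = g1 * pt -> (1 + t) * ps < (1 + s) * pt ->
  g1 <= gs + ps - 1 - s -> False.
Proof.
move=> e1 pt0 e2 lt1 le1.
have h : 0 <= pt * (gs + ps - 1 - s - g1) by apply: mulr_ge0; [exact: ltW | lra].
by lra.
Qed.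

(** * Commutation with the leading form of P at larger slopes *)

Section ChainUp.
Variable K : closedFieldType.
Hypothesis charK : [pchar K] =i pred0.
Variable A : puiseux_alg K.
Implicit Types (G : A) (s t u w v : rat).
Variables (P : A) (s : rat).
Hypotheses (P0 : P != 0) (dP : 0 < degs s P).
Hypothesis s_gt : -1 < s.
Hypothesis above_s : degs s P < (1 + s) * (hi_y s P)%:R.

Lemma degs_up_gt0 t : s <= t -> 0 < degs t P.
Proof.
move=> le_st; apply: lt_le_trans (degs_ge t (lead_hi s P0)).
by rewrite ltr_wpDr // mulr_ge0 // subr_ge0.
Qed.

(** The upper end of slope s forces v_t(P) >= v_s(P) + (t - s) y, where y > v_s(P) / (1 + s); so
    v_t(P) grows faster in proportion than 1 + t. *)
Lemma degs_slope t : s < t -> (1 + t) * degs s P < (1 + s) * degs t P.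
Proof.
move=> lt_st; have := degs_ge t (lead_hi s P0); move: above_s.
move: ((hi_y s P)%:R : rat) (degs t P) (degs s P) s_gt lt_st => y x d s0 st h1 h2.
have h3 : 0 <= (1 + s) * (x - (d + (t - s) * y)) by rewrite mulr_ge0; lra.
have h4 : 0 < (t - s) * ((1 + s) * y - d) by rewrite mulr_gt0; lra.
by lra.
Qed.

(* Beyond s the bound v([G, P]) <= v(G) + v(P) - (1 + t) cannot be attained,   *)
(* since (1 + t) / v_t(P) is strictly decreasing.                               *)
Lemma commuting_above N G : iter N (fun H => brk H P) G = 0 ->
  (forall i, iter i (fun H => brk H P) G != 0 ->
     degs s (iter i (fun H => brk H P) G) * (hi_y s P)%:R =
     degs s P * (hi_y s (iter i (fun H => brk H P) G))%:R) ->
  G != 0 -> forall t, s <= t ->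
  degs s P * degs t G = degs s G * degs t P /\ (s < t -> wrl t G P = 0).
Proof.
elim: N G => [|N IH] G iN al G0; first by rewrite -iN /= eqxx in G0.
have w0 t : s < t -> degs s P * degs t G = degs s G * degs t P -> wrl t G P = 0.
  move=> lt_st Et; apply/eqP/negPn/negP => nz; have [dE lE] := degs_brk charK nz.
  have G10 : brk G P != 0 by rewrite -(lead_eq0 t) lE.
  have iN1 : iter N (fun H => brk H P) (brk G P) = 0 by rewrite -iterSr.
  have al1 i : iter i (fun H => brk H P) (brk G P) != 0 ->
     degs s (iter i (fun H => brk H P) (brk G P)) * (hi_y s P)%:R =
     degs s P * (hi_y s (iter i (fun H => brk H P) (brk G P)))%:R.
    by rewrite -iterSr; exact: al.
  have [E1 _] := IH (brk G P) iN1 al1 G10 t (ltW lt_st).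
  have := degs_brk_le s G10; have := degs_slope lt_st; move: E1; rewrite dE.
  have := degs_up_gt0 (ltW lt_st); move: Et.
  exact: defect_slope.
move=> t le_st; have Et : degs s P * degs t G = degs s G * degs t P; last first.
  by split=> // lt_st; exact: w0.
(* At s itself the upper ends are aligned by hypothesis; beyond s this follows from the commutation
   [w0]. *)
apply: (degs_up G0 P0 le_st); last by rewrite mulrC.
move=> u /andP [le_u lt_u] Eu; move: le_u; rewrite le_eqVlt => /orP [/eqP <-|lt_su].
  by have := al 0%N G0 => /= ->.
have pu := degs_up_gt0 (ltW lt_su).
have := wr0_size charK _ _ (w0 u lt_su Eu); rewrite !lead_eq0 => /(_ G0 P0) E.
apply: (mulfI (lt0r_neq0 pu)); rewrite mulrCA -E !mulrA Eu.
by rewrite [degs u P * _]mulrC.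
Qed.
End ChainUp.

(** * Fractional powers of a leading form *)

Section Powers.
Variable K : closedFieldType.
Hypothesis charK : [pchar K] =i pred0.
Variable A : puiseux_alg K.
Implicit Types (G : A) (f r : {poly K}) (w v x y : rat).
Variables (P : A) (s : rat) (m l : nat).
Hypotheses (P0 : P != 0) (dP : 0 < degs s P) (hP : (0 < hi_y s P)%N).
Hypotheses (m_gt0 : (0 < m)%N) (l_gt0 : (0 < l)%N) (LP : inL l P).

Definition hi_x G : rat := degs s G - s * (hi_y s G)%:R.

(* l(P)^x lies in L^(l), up to the sign of its exponents.                      *)
Definition frac_power x : Prop :=
  (forall c : K, x * (mup c (lead s P))%:R \is a Num.int) /\ lat l (x * hi_x P).

Lemma frac_powerD x y : frac_power x -> frac_power y -> frac_power (x + y).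
Proof.
move=> [mx lx] [my ly]; split=> [c|]; last by rewrite mulrDl; exact: latD.
by rewrite mulrDl rpredD.
Qed.
Lemma frac_powerMint (z : int) x : frac_power x -> frac_power (z%:~R * x).
Proof.
move=> [mx lx]; split=> [c|]; last by rewrite -mulrA; exact: latMint.
by rewrite -mulrA rpredM // intr_int.
Qed.
Lemma frac_powerB x y : frac_power x -> frac_power y -> frac_power (x - y).
Proof. by move=> fx fy; rewrite -mulN1r; apply/frac_powerD/(frac_powerMint (-1)). Qed.

Lemma frac_power1 : frac_power 1.
Proof.
split=> [c|]; first by rewrite mul1r intr_nat.
by rewrite mul1r; apply: (inL_sup LP (lead_hi s P0)).
Qed.

(** Up to a constant, l(G) is l(P) to the power v(G) / v(P), and it has honest multiplicities and
    exponents in (1/l) Z. *)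
Lemma commuting_frac_power G : G != 0 -> inL l G -> wrl s G P = 0 ->
  frac_power (degs s G / degs s P).
Proof.
move=> G0 LG w0; have lP0 : lead s P != 0 by rewrite lead_eq0.
have lG0 : lead s G != 0 by rewrite lead_eq0.
have dP0 := lt0r_neq0 dP.
split=> [c|].
  rewrite mulrAC (wr0_mup charK c lG0 lP0 w0) mulrAC divff // mul1r.
  by rewrite intr_nat.
have -> : degs s G / degs s P * hi_x P = hi_x G.
  rewrite /hi_x mulrBr divfK // mulrCA; congr (_ - s * _).
  by rewrite mulrAC (wr0_size charK lG0 lP0 w0) mulrAC divff // mul1r.
exact: (inL_sup LG (lead_hi s G0)).
Qed.

Definition pow e : Prop := exists r, lead s P = r ^+ (m * e) /\
  sup_in l s (degs s P / (m * e)%:R) r.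

(** Divisibility of all multiplicities yields a polynomial root, and the exponent of its top term
    decides, by [sup_in_root], whether the root lies in L^(l). *)
Lemma frac_power_pow e : (0 < e)%N -> frac_power ((m * e)%:R^-1) <-> pow e.
Proof.
move=> e0; have me0 : (0 < m * e)%N by rewrite muln_gt0 m_gt0.
have me_neq0 : (m * e)%:R != 0 :> rat by rewrite pnatr_eq0 -lt0n.
have lP0 : lead s P != 0 by rewrite lead_eq0.
have hx r : lead s P = r ^+ (m * e) ->
    (m * e)%:R^-1 * hi_x P = degs s P / (m * e)%:R - s * (size r).-1%:R.
  move=> Er; rewrite /hi_x /hi_y Er size_exp [(_.-1 * _)%:R]natrM.
  by move: ((m * e)%:R : rat) me_neq0 => x x0; field.
split=> [[mx lx]|[r [Er sr]]].
  have dv c : (m * e %| mup c (lead s P))%N.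
    have /intrP [z Ez] := mx c.
    have : (mup c (lead s P))%:Z = (m * e)%N%:Z * z.
      apply: (@intr_inj rat); rewrite rmorphM /= -!pmulrn.
      by have := congr1 (fun x => (m * e)%:R * x) Ez; rewrite /= mulVKf.
    by move=> E; rewrite -[(_ %| _)%N]/((m * e)%N%:Z %| (mup c (lead s P))%:Z)%Z E dvdz_mulr.
  have [r Er] := poly_root_exists me0 lP0 dv; exists r; split=> //.
  have r0 : r != 0 by apply: contraNneq lP0 => r0; rewrite Er r0 expr0n gtn_eqF.
  apply: (sup_in_root charK me0 r0).
    by rewrite mulrCA divff // mulr1 -Er; exact: inL_sup.
  by rewrite -hx.
have r0 : r != 0 by apply: contraNneq lP0 => r0; rewrite Er r0 expr0n gtn_eqF.
split=> [c|]; first by rewrite Er mupX // [(_ * mup _ _)%:R]natrM mulKf // intr_nat.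
by rewrite (hx r) //; apply: sr; rewrite -lead_coefE lead_coef_eq0.
Qed.

Lemma pow_le e : pow e -> (e <= hi_y s P)%N.
Proof.
move=> [r [Er _]]; move: hP; rewrite /hi_y Er size_exp.
case: (size r).-1 => [|k]; first by rewrite mul0n.
move=> _; apply: leq_trans (leq_pmull _ m_gt0) _.
by rewrite mulSn leq_addr.
Qed.

(** The admissible exponents form a group. From p / (q m) and 1 / m it contains 1 / (m q), and with
    1 / (m e) also 1 / (m lcm(q, e)); maximality of e gives lcm(q, e) = e. *)
Lemma frac_power_max e (p q : nat) : (0 < e)%N -> (0 < q)%N -> coprime p q ->
  pow e -> (forall e', (0 < e')%N -> pow e' -> (e' <= e)%N) ->
  frac_power (p%:R / q%:R / m%:R) -> (q %| e)%N.
Proof.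
move=> e0 q0 co pe max_e fpq.
have mR : m%:R != 0 :> rat by rewrite pnatr_eq0 -lt0n.
have qR : q%:R != 0 :> rat by rewrite pnatr_eq0 -lt0n.
have eR : e%:R != 0 :> rat by rewrite pnatr_eq0 -lt0n.
have fe : frac_power (m * e)%:R^-1 by apply/frac_power_pow.
have f1 : frac_power (m%:R^-1).
  by have := frac_powerMint e fe; rewrite -pmulrn natrM invfM mulrCA divff // mulr1.
have bez (i j : nat) : (0 < i)%N -> exists u v : int, (gcdn i j)%:R = u%:~R * i%:R + v%:~R * j%:R :> rat.
  move=> i0; have [u v /= Euv _] := egcdnP j i0; exists u%:Z, (- v%:Z).
  have : (u * i)%:R = (v * j + gcdn i j)%:R :> rat by rewrite Euv.
  by rewrite natrD !natrM rmorphN /= -!pmulrn; lra.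
have fq : frac_power (m * q)%:R^-1.
  have [u [v]] := bez q p q0; rewrite gcdnC (eqP co) => Euv.
  have -> : (m * q)%:R^-1 = u%:~R * m%:R^-1 + v%:~R * (p%:R / q%:R / m%:R) :> rat.
    have -> : (m * q)%:R^-1 = (u%:~R * q%:R + v%:~R * p%:R) / (m * q)%:R :> rat.
      by rewrite -Euv mul1r.
    by rewrite natrM; field; rewrite mR qR.
  by apply: frac_powerD; exact: frac_powerMint.
have L0 : (0 < lcmn q e)%N by rewrite lcmn_gt0 q0.
have fL : frac_power (m * lcmn q e)%:R^-1.
  (* 1 / lcm(q, e) = gcd(q, e) / (q e), and Bezout splits the numerator. *)
  have [u [v Euv]] := bez q e q0.
  have E : (gcdn q e)%:R * (lcmn q e)%:R = q%:R * e%:R :> rat.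
    by rewrite -!natrM mulnC muln_lcm_gcd.
  have LR : (lcmn q e)%:R != 0 :> rat by rewrite pnatr_eq0 -lt0n.
  have -> : (m * lcmn q e)%:R^-1 = v%:~R * (m * q)%:R^-1 + u%:~R * (m * e)%:R^-1 :> rat.
    rewrite !natrM; apply: (mulIf (mulf_neq0 (mulf_neq0 qR eR) LR)).
    rewrite -{1}E Euv; move: (lcmn q e)%:R LR => L LR'.
    by field; rewrite mR qR eR.
  by apply: frac_powerD; exact: frac_powerMint.
have := max_e _ L0 (proj1 (frac_power_pow L0) fL).
move=> le_L; have : lcmn q e = e.
  by apply/eqP; rewrite eqn_leq le_L dvdn_leq // dvdn_lcmr.
by move=> <-; exact: dvdn_lcml.
Qed.

Lemma exists_max_pow : frac_power m%:R^-1 ->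
  exists d, [/\ (0 < d)%N, pow d & forall e, (0 < e)%N -> pow e -> (e <= d)%N].
Proof.
move=> f1; have p1 : pow 1 by apply/frac_power_pow; rewrite ?muln1.
have : forall N, exists d, [/\ (0 < d)%N, pow d &
   forall e, (0 < e <= N)%N -> pow e -> (e <= d)%N].
  elim=> [|N [d [d0 pd max_d]]]; first by exists 1%N; split=> // e; case: e.
  have [pN|npN] := classic (pow N.+1).
    by exists N.+1; split=> // e /andP [].
  exists d; split=> // e /andP [e0]; rewrite leq_eqVlt => /orP [/eqP -> //|lt_e].
  by apply: max_d; rewrite e0.
move=> /(_ (hi_y s P)) [d [d0 pd max_d]]; exists d; split=> // e e0 pe.
by apply: max_d => //; rewrite e0 pow_le.
Qed.

(* If q | d then R^(p d / q), where l(P) = R^(m d), has the weight of F and     *)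
(* commutes with P; subtracting a multiple of it from F would lower deg F.      *)
Lemma eigen_ndvd (f : {poly K}) (c1 c2 : K) (p q d : nat) :
  (0 < d)%N -> (0 < p)%N -> (0 < q)%N ->
  (p%:R / q%:R : rat) = m%:R * (1 + s) / degs s P ->
  c1 != c2 -> root (lead s P) c1 -> root (lead s P) c2 ->
  wr (1 + s) (degs s P) f (lead s P) = lead s P -> 0 < 1 + s ->
  pow d -> ~~ (q %| d)%N.
Proof.
move=> d0 p0 q0 Epq c12 r1 r2 fP s0 [r [Er _]]; apply/negP => /dvdnP [k Ek].
have k0 : (0 < k)%N by move: d0; rewrite Ek muln_gt0 => /andP [].
have md0 : (0 < m * d)%N by rewrite muln_gt0 m_gt0.
have lP0 : lead s P != 0 by rewrite lead_eq0.
have rr c : root (lead s P) c -> root r c.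
  by rewrite Er !rootE horner_exp expf_eq0 => /andP [].
have r0 : r != 0 by apply: contraNneq lP0 => r0; rewrite Er r0 expr0n gtn_eqF.
pose w := degs s P / (m * d)%:R.
have w0 : 0 < w by rewrite divr_gt0 // ltr0n.
have mdR : (m * d)%:R != 0 :> rat by rewrite pnatr_eq0 -lt0n.
have qR : q%:R != 0 :> rat by rewrite pnatr_eq0 -lt0n.
have mR : m%:R != 0 :> rat by rewrite pnatr_eq0 -lt0n.
have kR : k%:R != 0 :> rat by rewrite pnatr_eq0 -lt0n.
have dPR := lt0r_neq0 dP.
have Es : 1 + s = (p * k)%:R * w.
  have -> : 1 + s = p%:R / q%:R * degs s P / m%:R by rewrite Epq; field; rewrite dPR mR.
  rewrite /w Ek !natrM; move: dPR => _; field; rewrite mR.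
  by rewrite kR qR.
have Ed : degs s P = (m * d)%:R * w by rewrite /w mulrCA divff // mulr1.
have f0 := eigen_neq0 lP0 fP.
have sf : (size f).-1 = (p * k * (size r).-1)%N.
  have := eigen_size charK (lt0r_neq0 s0) lP0 c12 r1 r2 fP.
  rewrite Er size_exp {1}Es {1}Ed natrM => E; apply/eqP; rewrite -(eqr_nat rat).
  have mw0 : (m * d)%:R * w != 0 by rewrite mulf_neq0 // gt_eqF.
  rewrite -(inj_eq (mulfI mw0)) -E natrM; apply/eqP; ring.
have pk0 : (0 < p * k)%N by rewrite muln_gt0 p0.
have := eigen_not_power charK md0 w0 pk0 c12 (rr _ r1) (rr _ r2) r0 sf.
by rewrite -Er -Es -Ed fP eqxx.
Qed.

End Powers.

(** * The ring K[x^Q, y] *)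

Section Model.
Variable K : closedFieldType.
Local Notation A0 := (qlaurent K).
Implicit Types (P Q : A0).

Lemma qmulU (c1 c2 : K) e1 e2 :
  (<< c1 *g e1 >> : A0) * << c2 *g e2 >> = << c1 * c2 *g addx e1 e2 >>.
Proof. exact: qmulUU. Qed.

(** [phi] need not be injective: other preimages of [k] only need coefficient 0, as happens for y^0
    under the derivative in y. *)
Lemma mcoeff_sum_supp P (c : expo -> K) (phi : expo -> expo) k e0 : phi e0 = k ->
  (forall e, phi e = k -> e != e0 -> c e = 0) ->
  (\sum_(e <- msupp P) << c e * P@_e *g phi e >> : A0)@_k = c e0 * P@_e0.
Proof.
move=> phi0 phi1; rewrite raddf_sum /=.
have z e : e != e0 -> (<< c e * P@_e *g phi e >> : A0)@_k = 0.
  move=> ne; rewrite mcoeffU; case: eqP => [Ek|_]; last by rewrite mulr0n.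
  by rewrite phi1 // mul0r.
have [e0P|e0P] := boolP (e0 \in msupp P).
  rewrite (bigD1_seq e0 e0P (fset_uniq _)) /= big1_seq ?addr0.
    by rewrite mcoeffU phi0 eqxx mulr1n.
  by move=> e /andP [ne _]; exact: z.
rewrite (mcoeff_outdom e0P) mulr0 big1_seq // => e /andP [_ eP]; apply: z.
by apply: contraNneq e0P => <-.
Qed.

Lemma mcoeff_px P r j : (partial_x P)@_(r, j) = ratr (r + 1) * P@_(r + 1, j).
Proof.
apply: (@mcoeff_sum_supp P (fun e => ratr e.1) (fun e => (e.1 - 1, e.2)) _ (r + 1, j)).
  by rewrite /= addrK.
by move=> [x y] /= [<- <-]; rewrite subrK eqxx.
Qed.

Lemma mcoeff_py P r j : (partial_y P)@_(r, j) = j.+1%:R * P@_(r, j.+1).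
Proof.
apply: (@mcoeff_sum_supp P (fun e => e.2%:R) (fun e => (e.1, e.2.-1)) _ (r, j.+1)) => //.
by move=> [x [|y]] /= [<- <-] //; rewrite eqxx.
Qed.

Lemma qcfD P Q e : (P + Q)@_e = P@_e + Q@_e.
Proof. exact: mcoeffD. Qed.
Lemma qcfZ (c : K) P e : (c *: P)@_e = c * P@_e.
Proof. exact: mcoeffZ. Qed.
Lemma qcf_ext P Q : (fun e => P@_e) =1 (fun e => Q@_e) -> P = Q.
Proof. by move=> E; apply/malgP. Qed.
Lemma qcf_mono e e' : (monom K e)@_e' = (e == e')%:R.
Proof. by rewrite mcoeffU. Qed.
Lemma qmonoM e e' : monom K e * monom K e' = monom K (addx e e').
Proof. by rewrite /monom qmulU mulr1. Qed.
Lemma qmono1 : monom K expo0 = 1.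
Proof. by []. Qed.
Lemma qmem_supp P e : (e \in (msupp P : seq expo)) = (P@_e != 0).
Proof. by rewrite mcoeff_neq0. Qed.
Lemma qsuppE P : P = \sum_(e <- msupp P) P@_e *: monom K e.
Proof.
rewrite {1}[P]monalgE; apply: eq_bigr => e _; apply: qcf_ext => e'.
by rewrite qcfZ qcf_mono mcoeffU mulr_natr.
Qed.

Definition qpuiseux : puiseux_alg K :=
  @PuiseuxAlg K (qlaurent K) (fun P e => P@_e) (fun P => msupp P) (@monom K)
    qcfD qcfZ qcf_ext qcf_mono qmonoM qmono1 qmem_supp qsuppE
    (@partial_x K) (@partial_y K) mcoeff_px mcoeff_py.

End Model.

(** * From directions to slopes *)

Section Translation.
Variable K : closedFieldType.
Hypothesis charK : [pchar K] =i pred0.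
Local Notation A := (qpuiseux K).
Implicit Types (P Q F G : qlaurent K) (d : int * int).
Local Notation dg := (@degs K A).
Local Notation ld := (@lead K A).
Local Notation hy := (@hi_y K A).
Local Notation ly := (@lo_y K A).
Local Notation vx := (@vtx K A).

Definition slope d : rat := d.2%:~R / d.1%:~R.

(** On the arc rho is positive, so slopes in ]-1, 0] parametrize it. *)
Lemma in_IP d : in_I d <->
  [/\ is_direction d, 0 < d.1, -1 < slope d & slope d <= 0].
Proof.
rewrite /in_I /cross /dvec /slope /=; split=> [[dd c1 c2]|[dd d1 s1 s2]].
  have d2 : d.2%:~R <= 0 :> rat by lra.
  have d1 : 0 < d.1%:~R :> rat by lra.
  split=> //; first by rewrite -(ltr0z rat).
    by rewrite ltr_pdivlMr //; lra.
  by rewrite ler_pdivrMr // mul0r.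
have d1' : 0 < d.1%:~R :> rat by rewrite ltr0z.
move: s1 s2; rewrite ltr_pdivlMr // ler_pdivrMr // mul0r => s1 s2.
by split=> //; lra.
Qed.

Lemma slope_dir (t : rat) : is_direction (denq t, numq t) /\ slope (denq t, numq t) = t.
Proof.
split; last by rewrite /slope /= divq_num_den.
by rewrite /is_direction coprimezE coprime_sym; exact: coprime_num_den.
Qed.

Lemma slope_in_I (t : rat) : -1 < t -> t <= 0 -> in_I (denq t, numq t).
Proof.
move=> t1 t2; have [dd st] := slope_dir t; apply/in_IP; rewrite st.
by split=> //=; rewrite denq_gt0.
Qed.

Lemma dir_ltP d1 d2 : in_I d1 -> in_I d2 -> dir_lt d1 d2 <-> slope d1 < slope d2.
Proof.
move=> /in_IP [_ p1 _ _] /in_IP [_ p2 _ _]; rewrite /dir_lt /cross /dvec /slope /=.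
have q1 : 0 < d1.1%:~R :> rat by rewrite ltr0z.
have q2 : 0 < d2.1%:~R :> rat by rewrite ltr0z.
by rewrite ltr_pdivrMr // mulrAC ltr_pdivlMr // mulrC subr_gt0 [X in X < _]mulrC.
Qed.

Section Direction.
Variable d : int * int.
Hypothesis d1_gt0 : 0 < d.1.
Local Notation s := (slope d).
Local Notation rho := (d.1%:~R : rat).

Lemma rho_gt0 : 0 < rho. Proof. by rewrite ltr0z. Qed.
Lemma rho_neq0 : rho != 0. Proof. exact: lt0r_neq0 rho_gt0. Qed.
Lemma rho_slope : rho * s = d.2%:~R.
Proof. by rewrite /slope mulrC divfK // rho_neq0. Qed.

Lemma wtE e : wt d (pt e) = rho * wq s e.
Proof. by rewrite /wt /wq /= mulrDr mulrA rho_slope. Qed.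

Lemma vdegE P : vdeg d P = rho * dg s P.
Proof.
rewrite /vdeg /degs /supp.
have -> : [seq wt d p | p <- [seq pt e | e <- msupp P]] =
    [seq rho * x | x <- [seq wq s e | e <- @psupp K A P]].
  by rewrite -!map_comp; apply: eq_map => e /=; rewrite wtE.
move: [seq wq s e | e <- @psupp K A P] => S.
have -> : head 0 [seq rho * x | x <- S] = rho * head 0 S by case: S; rewrite /= ?mulr0.
elim: {2 4}S => [|x S' IH]; first by rewrite !big_nil.
by rewrite /= !big_cons IH maxr_pMr // ltW // rho_gt0.
Qed.

Lemma mcoeff_ell P e : (ell d P)@_e = P@_e *+ (wt d (pt e) == vdeg d P).
Proof.
rewrite /ell raddf_sum /=.
have [eP|eP] := boolP (e \in msupp P).
  rewrite big_mkcond (bigD1_seq e eP (fset_uniq _)) /= big1_seq ?addr0.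
    by case: eqP => _; rewrite ?mcoeffUU.
  move=> e' /andP [ne _]; case: ifP => // _.
  by rewrite mcoeffU (negPf ne).
rewrite (mcoeff_outdom eP) mul0rn big_mkcond big1_seq // => e' /andP [_ eP'].
case: ifP => // _; rewrite mcoeffU; case: eqP => // E.
by rewrite -E eP' in eP.
Qed.

Lemma wt_vdeg P r j : (wt d (pt (r, j)) == vdeg d P) = (r == dg s P - s * j%:R).
Proof.
rewrite wtE vdegE (inj_eq (mulfI rho_neq0)) /wq /=.
by rewrite -subr_eq0 -[RHS]subr_eq0; congr (_ == _); ring.
Qed.

Lemma ellE P : ell d P = hmg A s (dg s P) (ld s P).
Proof.
apply: qcf_ext => -[r j].
have -> : (hmg A s (dg s P) (ld s P) : qlaurent K)@_(r, j) = (ld s P)`_j *+ (r == dg s P - s * j%:R).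
  exact: (@cf_hmg K A s (dg s P) (ld s P) r j).
have -> : (ld s P)`_j = P@_(dg s P - s * j%:R, j).
  exact: (esym (@lform_cf K A s _ _ P j (lform_lead s _))).
rewrite mcoeff_ell wt_vdeg.
by have [->|_] := eqVneq r (dg s P - s * j%:R).
Qed.

Lemma mem_supp_ell P p :
  p \in supp (ell d P) <-> exists2 y, (ld s P)`_y != 0 & p = vx s P y.
Proof.
have cfl j : (ld s P)`_j = P@_(dg s P - s * j%:R, j).
  exact: (esym (@lform_cf K A s _ _ P j (lform_lead s _))).
split=> [/mapP [[r j]]|[y nz ->]].
  rewrite -mcoeff_neq0 mcoeff_ell wt_vdeg; have [->|_] := eqVneq r _; last first.
    by rewrite mulr0n eqxx.
  by rewrite mulr1n -cfl => nz ->; exists j.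
apply/mapP; exists (dg s P - s * y%:R, y) => //.
by rewrite -mcoeff_neq0 mcoeff_ell wt_vdeg eqxx mulr1n -cfl.
Qed.

(** Along an edge this cross product is an increasing affine function of the ordinate, so en is the
    upper end and st the lower one. *)
Lemma cross_vtx P y : cross (dvec d) (vx s P y) =
  y%:R * (rho * (1 + s ^+ 2)) - rho * s * dg s P.
Proof. by rewrite /cross /vtx /= -rho_slope; ring. Qed.

Lemma cross_vtx_le P y z :
  (cross (dvec d) (vx s P y) <= cross (dvec d) (vx s P z)) = (y <= z)%N.
Proof.
rewrite !cross_vtx lerD2r ler_pM2r ?ler_nat // mulr_gt0 ?rho_gt0 //.
by have := sqr_ge0 s; lra.
Qed.

Lemma head_filter (T : eqType) (a : pred T) (S : seq T) x p :
  p \in S -> a p -> (forall q, q \in S -> a q -> q = p) -> head x [seq q <- S | a q] = p.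
Proof.
move=> pS ap uni; have : p \in [seq q <- S | a q] by rewrite mem_filter ap.
case E: [seq q <- S | a q] => [//|q S'] _ /=.
have : q \in [seq q <- S | a q] by rewrite E mem_head.
by rewrite mem_filter => /andP [aq qS]; exact: uni.
Qed.

Lemma enE P : P != 0 -> en d P = vx s P (hy s P).
Proof.
move=> P0; have hP : (ld s P)`_(hy s P) != 0 by exact: (@lead_hi K A).
apply: head_filter; first by apply/mem_supp_ell; exists (hy s P).
  apply/allP => q /mem_supp_ell [y nz ->]; rewrite cross_vtx_le.
  exact: (@lead_le_hi K A).
move=> q /mem_supp_ell [y nz ->] /allP /(_ (vx s P (hy s P))).
have -> : vx s P (hy s P) \in supp (ell d P) by apply/mem_supp_ell; exists (hy s P).
move=> /(_ isT); rewrite cross_vtx_le => le1; congr (vx s P _).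
by apply/eqP; rewrite eqn_leq le1 andbT; exact: (@lead_le_hi K A).
Qed.

Lemma stE P : P != 0 -> st d P = vx s P (ly s P).
Proof.
move=> P0; have hP : (ld s P)`_(ly s P) != 0 by exact: (@lead_lo K A).
apply: head_filter; first by apply/mem_supp_ell; exists (ly s P).
  apply/allP => q /mem_supp_ell [y nz ->]; rewrite cross_vtx_le.
  exact: (@lead_ge_lo K A).
move=> q /mem_supp_ell [y nz ->] /allP /(_ (vx s P (ly s P))).
have -> : vx s P (ly s P) \in supp (ell d P) by apply/mem_supp_ell; exists (ly s P).
move=> /(_ isT); rewrite cross_vtx_le => le1; congr (vx s P _).
by apply/eqP; rewrite eqn_leq le1; exact: (@lead_ge_lo K A).
Qed.

Lemma vtx_inj P : injective (vx s P).
Proof. by move=> y z [_] /eqP; rewrite eqr_nat => /eqP. Qed.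

Lemma DirE P : P != 0 -> Dir P d <-> is_direction d /\ (ly s P < hy s P)%N.
Proof.
move=> P0; have hP : (ld s P)`_(hy s P) != 0 by exact: (@lead_hi K A).
have lP : (ld s P)`_(ly s P) != 0 by exact: (@lead_lo K A).
have hS : vx s P (hy s P) \in supp (ell d P) by apply/mem_supp_ell; exists (hy s P).
have lS : vx s P (ly s P) \in supp (ell d P) by apply/mem_supp_ell; exists (ly s P).
have uS : uniq (supp (ell d P)).
  rewrite map_inj_uniq ?fset_uniq //; move=> [r j] [r' j'] [-> /eqP].
  by rewrite eqr_nat => /eqP ->.
rewrite /Dir; split=> -[dd sz]; split=> //.
  rewrite ltnNge; apply/negP => le_hl; move: sz; rewrite ltnNge; case/negP.
  have : {subset supp (ell d P) <= [:: vx s P (hy s P)]}.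
    move=> q /mem_supp_ell [y nz ->]; rewrite inE; apply/eqP; congr (vx s P _).
    apply/eqP; rewrite eqn_leq; apply/andP; split; first exact: (@lead_le_hi K A).
    by apply: leq_trans le_hl _; exact: (@lead_ge_lo K A).
  by move/(uniq_leq_size uS).
have : {subset [:: vx s P (ly s P); vx s P (hy s P)] <= supp (ell d P)}.
  by move=> q; rewrite !inE => /orP [] /eqP ->.
apply: uniq_leq_size; rewrite /= inE andbT; apply/eqP => /vtx_inj E.
by rewrite E ltnn in sz.
Qed.

Lemma bracket_ell P Q : bracket (ell d P) (ell d Q) =
  hmg A s (dg s P + dg s Q - 1 - s) (@wrl K A s P Q).
Proof. by rewrite !ellE; exact: (@brk_hmg K charK A s (dg s P) (dg s Q) (ld s P) (ld s Q)). Qed.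

Lemma bracket_ell0 P Q : bracket (ell d P) (ell d Q) = 0 <-> @wrl K A s P Q = 0.
Proof.
rewrite bracket_ell; split=> [|->]; first exact: (@hmg_eq0 K A).
exact: (@hmg0 K A).
Qed.

Lemma in_LE l P : (0 < l)%N -> in_L l P <-> @inL K A l P.
Proof.
move=> l0; have l0' : l%:R != 0 :> rat by rewrite pnatr_eq0 -lt0n.
split=> LP e; [move=> nz | rewrite -mcoeff_neq0 => nz].
  have [|i ->] := LP e; first by rewrite -mcoeff_neq0.
  by rewrite /lat mulrC divfK // intr_int.
have /intrP [i Ei] := LP e nz; exists i.
by rewrite -Ei mulrC mulKf.
Qed.

Lemma hmg_form w (f : {poly K}) : f != 0 -> let F : qlaurent K := hmg A s w f in
  [/\ dg s F = w, ld s F = f & F != 0].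
Proof.
move=> f0 /=; have [E1 E2] := leadE (@lform_hmg K A s w f) f0; split=> //.
exact: (lform_neq0 (@lform_hmg K A s w f) f0).
Qed.

Lemma homogeneousE F : homogeneous d F <-> F = hmg A s (dg s F) (ld s F).
Proof. by rewrite /homogeneous ellE. Qed.

Lemma homogeneous_hmg w (f : {poly K}) : homogeneous d (hmg A s w f).
Proof.
apply/homogeneousE; have [->|f0] := eqVneq f 0.
  rewrite !(@hmg0 K A); suff -> : ld s 0 = 0 by rewrite (@hmg0 K A).
  by apply/eqP; rewrite (@lead_eq0 K A).
by have [-> ->] := hmg_form w f0.
Qed.

Lemma inL_hmg l w (f : {poly K}) : @inL K A l (hmg A s w f) <-> sup_in l s w f.
Proof.
split=> [Lf j fj|sf [r j]].
  by apply: (Lf (w - s * j%:R, j)); rewrite cf_hmg eqxx.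
rewrite cf_hmg; have [->|_] := eqVneq r (w - s * j%:R); last by rewrite mulr0n eqxx.
exact: sf.
Qed.

Lemma ell_neq0 P : P != 0 -> ell d P != 0.
Proof.
move=> P0; rewrite ellE; have l0 : ld s P != 0 by rewrite (@lead_eq0 K A).
by have [] := hmg_form (dg s P) l0.
Qed.

Lemma type_IIE P Q : P != 0 -> type_II P Q d -> @wrl K A s P Q = 0 /\
  exists c1 c2 : K, [/\ c1 != c2, root (ld s P) c1 & root (ld s P) c2].
Proof.
move=> P0 [/bracket_ell0 w0 [kap [p [Ep [c1 [c2 [c12 d1 d2]]]]]]]; split=> //.
have Eh : ell d P = hmg A s kap p.
  have Es : - d.2%:~R / d.1%:~R = - s :> rat by rewrite /slope mulNr.
  by rewrite Ep Es.
have p0 : p != 0.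
  by have := ell_neq0 P0; rewrite Eh; apply: contraNneq => ->; rewrite (@hmg0 K A).
have l0 : ld s P != 0 by rewrite (@lead_eq0 K A).
have [_ E1 _] := hmg_form (dg s P) l0; have [_ E2 _] := hmg_form kap p0.
have {E1 E2} <- : p = ld s P by rewrite -E1 -ellE Eh E2.
by exists c1, c2; rewrite -!dvdp_XsubCl.
Qed.

Lemma is_powerE l m P e : (0 < l)%N -> (0 < m)%N -> (0 < e)%N -> P != 0 ->
  is_power l m P d e <-> @pow K A P s m l e.
Proof.
move=> l0 m0 e0 P0; have me0 : (m * e)%:R != 0 :> rat.
  by rewrite pnatr_eq0 -lt0n muln_gt0 m0.
split=> [[R [/in_LE-/(_ l0) LR hR ER]]|[r [Er sr]]].
  have lR0 : ld s R != 0.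
    rewrite (@lead_eq0 K A); apply: contraTneq (ell_neq0 P0) => R0.
    by rewrite ER R0 expr0n muln_eq0 !gtn_eqF // eqxx.
  have E : ell d P = hmg A s ((m * e)%:R * dg s R) (ld s R ^+ (m * e)).
    by rewrite ER {1}(proj1 (homogeneousE R) hR); exact: (@hmgX K A).
  have l0' : ld s P != 0 by rewrite (@lead_eq0 K A).
  have [F1 E1 _] := hmg_form (dg s P) l0'.
  have [F2 E2 _] := hmg_form ((m * e)%:R * dg s R) (expf_neq0 (m * e) lR0).
  exists (ld s R); split; first by rewrite -E1 -ellE E E2.
  have -> : dg s P / (m * e)%:R = dg s R by rewrite -F1 -ellE E F2 mulrC mulKf.
  exact: (@inL_sup K A).
exists (hmg A s (dg s P / (m * e)%:R) r); split.
- by apply/in_LE => //; apply/inL_hmg.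
- exact: homogeneous_hmg.
rewrite ellE Er; symmetry; rewrite [LHS](@hmgX K A); congr (hmg A s _ _).
by rewrite mulrC divfK.
Qed.

End Direction.
End Translation.

(** * Prime factors counted with multiplicity *)

Section Omega.

(** An index range common to several numbers lets additivity be checked prime by prime. *)
Lemma Omega_sum N B : (0 < N)%N -> (N < B)%N ->
  Omega N = (\sum_(0 <= p < B | prime p) logn p N)%N.
Proof.
move=> N0 ltB; rewrite /Omega.
have -> : primes N = [seq p <- index_iota 0 B | p \in primes N].
  apply: (irr_sorted_eq ltn_trans ltnn).
  - exact: sorted_primes.
  - by apply: sorted_filter; [exact: ltn_trans | exact: iota_ltn_sorted].
  move=> p; rewrite mem_filter mem_index_iota; case: (boolP (p \in primes N)) => //=.
  rewrite mem_primes => /and3P [_ _ /dvdn_leq -/(_ N0) le_p].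
  by rewrite (leq_ltn_trans le_p ltB).
rewrite big_filter [LHS]big_mkcond [RHS]big_mkcond; apply: eq_bigr => p _.
rewrite mem_primes N0 /=; case: (boolP (prime p)) => //= pp.
by case: (boolP (p %| N)%N) => // ndiv; rewrite lognE pp N0 (negPf ndiv).
Qed.

Lemma OmegaM a b : (0 < a)%N -> (0 < b)%N -> Omega (a * b) = (Omega a + Omega b)%N.
Proof.
move=> a0 b0; have ab0 : (0 < a * b)%N by rewrite muln_gt0 a0.
rewrite !(@Omega_sum _ (a * b).+1) //; last 2 first.
- by rewrite ltnS leq_pmull.
- by rewrite ltnS leq_pmulr.
by rewrite -big_split /=; apply: eq_bigr => p _; rewrite lognM.
Qed.

Lemma Omega_gt0 a : (1 < a)%N -> (0 < Omega a)%N.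
Proof.
move=> a1; have a0 := ltnW a1; rewrite /Omega.
have pa : pdiv a \in primes a by rewrite mem_primes pdiv_prime // a0 pdiv_dvd.
rewrite (bigD1_seq _ pa (primes_uniq _)) /= addn_gt0.
by rewrite logn_gt0 pa.
Qed.

Lemma Omega_dvd a b : (0 < b)%N -> (a %| b)%N -> (Omega a <= Omega b)%N.
Proof.
move=> b0 /dvdnP [k Eb]; move: b0; rewrite Eb muln_gt0 => /andP [k0 a0].
by rewrite OmegaM // leq_addl.
Qed.

(** Let L be the least common multiple of the q_j with j0 <= j < i. Each new q_j enlarges it
    strictly, since the earlier ones divide d_j and q_j does not; so L has at least i - j0 prime
    factors, and it divides d_i. *)
Lemma Omega_chain (q d : nat -> nat) j0 k :
  (forall j, (j0 <= j <= k)%N -> (0 < q j)%N /\ (0 < d j)%N) ->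
  (forall i, (j0 <= i <= k)%N -> ~~ (q i %| d i)%N) ->
  (forall i j, (j0 <= j)%N -> (j < i)%N -> (i <= k)%N -> (q j %| d i)%N) ->
  forall i, (j0 <= i <= k)%N -> (i - j0 <= Omega (d i))%N.
Proof.
move=> pos nd dv i /andP [le_i le_k].
suff : forall e, (j0 + e <= k)%N -> exists L, [/\ (0 < L)%N, (e <= Omega L)%N
    & forall x, (forall j, (j0 <= j < j0 + e)%N -> (q j %| x)%N) -> (L %| x)%N].
  move=> /(_ (i - j0)%N); rewrite subnKC // => /(_ le_k) [L [L0 le_L dvL]].
  apply: leq_trans le_L _; apply: Omega_dvd; first by have [] := pos i; rewrite ?le_i.
  by apply: dvL => j /andP [le_j lt_j]; exact: dv.
elim=> [|e IH] le_e; first by exists 1%N; split=> // x _; exact: dvd1n.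
have [|L [L0 le_L dvL]] := IH; first by apply: leq_trans le_e; rewrite leq_add2l.
have le_e' : (j0 <= j0 + e <= k)%N by rewrite leq_addr (leq_trans _ le_e) // leq_add2l.
have [q0 d0] := pos _ le_e'.
have lc0 : (0 < lcmn L (q (j0 + e)))%N by rewrite lcmn_gt0 L0.
exists (lcmn L (q (j0 + e))); split=> // [|x dx]; last first.
  rewrite dvdn_lcm dvL ?dx //; first by rewrite leq_addr addnS ltnSn.
  by move=> j /andP [le_j lt_j]; apply: dx; rewrite le_j addnS ltnS ltnW.
have /dvdnP [u Eu] := dvdn_lcml L (q (j0 + e)).
have u0 : (0 < u)%N by move: lc0; rewrite Eu muln_gt0 => /andP [].
rewrite Eu OmegaM // -add1n; apply: leq_add le_L; apply: Omega_gt0.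
rewrite ltn_neqAle u0 andbT; apply/eqP => u1; move: Eu; rewrite -u1 mul1n => Eu.
have /negP := nd _ le_e'; apply; apply: dvdn_trans (dvdn_lcmr L _) _; rewrite Eu.
by apply: dvL => j /andP [le_j lt_j]; apply: dv => //; case/andP: le_e'.
Qed.

End Omega.

(** * Regular corners *)

Section Corners.
Variable K : closedFieldType.
Hypothesis charK : [pchar K] =i pred0.
Variables (m n l : nat).
Hypotheses (m_gt1 : (1 < m)%N) (n_gt1 : (1 < n)%N) (co_mn : coprime m n).
Hypothesis l_gt0 : (0 < l)%N.
Variables (P Q : qlaurent K).
Hypothesis pairPQ : mn_pair l m n P Q.
Variables (k : nat) (a : nat -> int) (b : nat -> nat) (dir : nat -> int * int).
Hypothesis corners : forall C : (rat * rat) * (int * int),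
  regular_corner l m P C <->
  exists2 j : nat, (j <= k)%N & C = (corner_pt l (a j) (b j), dir j).
Hypothesis increasing : forall i : nat, (i < k)%N -> dir_lt (dir i) (dir i.+1).

Local Notation A := (qpuiseux K).
Local Notation dg := (@degs K A).
Local Notation ld := (@lead K A).
Local Notation hy := (@hi_y K A).
Local Notation ly := (@lo_y K A).
Local Notation vx := (@vtx K A).
Local Notation sl j := (slope (dir j)).

Let m_gt0 : (0 < m)%N := ltnW m_gt1.
Let n_gt0 : (0 < n)%N := ltnW n_gt1.
Let mR : m%:R != 0 :> rat.
Proof. by rewrite pnatr_eq0 -lt0n. Qed.
Let lR : l%:R != 0 :> rat.
Proof. by rewrite pnatr_eq0 -lt0n. Qed.

Lemma pair_data : [/\ @inL K A l P, @inL K A l Q,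
  exists2 c : K, c != 0 & @brk K A P Q = c%:A & n%:R * dg 0 P = m%:R * dg 0 Q].
Proof.
have [[LP LQ] br _ v10 _] := pairPQ; split=> //; try exact/in_LE.
have s10 : slope (1, 0) = 0 by rewrite /slope /= mul0r.
have vE (G : qlaurent K) : vdeg (1, 0) G = dg 0 G.
  by rewrite vdegE // s10 /= mul1r.
move: v10; rewrite !vE => E.
have nR : n%:R != 0 :> rat by rewrite pnatr_eq0 -lt0n.
have Q0 : dg 0 Q != 0.
  apply: contra_eq_neq E => ->; rewrite invr0 mulr0 eq_sym.
  by rewrite mulf_neq0 ?invr_eq0.
move: E => /eqP; rewrite eqr_div // => /eqP E; rewrite mulrC E; ring.
Qed.

Let LP : @inL K A l P. Proof. by have [] := pair_data. Qed.
Let LQ : @inL K A l Q. Proof. by have [] := pair_data. Qed.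

Lemma mn_pair_neq0 : P != 0 /\ Q != 0.
Proof.
have [_ _ [c c0 PQc] _] := pair_data.
exact: (@pair_neq0 K A P Q c c0 PQc).
Qed.
Let P0 : P != 0 := proj1 mn_pair_neq0.

Local Notation balP := (@bal K A m n P Q).
Local Notation wP s := (@wrl K A s P Q = 0).

Lemma pair_above_bal s t : @above K A s P -> -1 < s -> s <= t -> t <= 0 -> balP t.
Proof.
have [_ _ [c c0 PQc] b0] := pair_data.
exact: (@bal_above K charK A m n P Q c m_gt0 n_gt0 c0 PQc b0).
Qed.
Lemma pair_lo_wrl0 s : (1 < ly s P)%N -> wP s.
Proof.
have [_ _ [c c0 PQc] b0] := pair_data.
exact: (@pair_wrl0 K charK A P Q c c0 PQc).
Qed.
Lemma pair_pos s : balP s -> -1 < s -> 0 < dg s P.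
Proof.
have [_ _ [c c0 PQc] b0] := pair_data.
by move=> bs s_gt; have [] := @bal_pos K A m n P Q c m_gt0 n_gt0 c0 PQc s bs s_gt.
Qed.

Lemma above_corner d : Dir P d -> in_I d -> @above K A (slope d) P ->
  (m %| hy (slope d) P)%N ->
  lat l (m%:R^-1 * (dg (slope d) P - slope d * (hy (slope d) P)%:R)) ->
  exists2 j, (j <= k)%N & d = dir j.
Proof.
move=> Dd Id /andP [hi1 ab] /dvdnP [y Ey] /intrP [i Ei].
have [_ d1 _ _] := proj1 (in_IP d) Id.
have : regular_corner l m P (scale_pt m%:R^-1 (en d P), d).
  split=> //=; exists i, y; rewrite enE // /scale_pt /corner_pt /vtx /=.
  have Ex : i%:~R / l%:R = m%:R^-1 * (dg (slope d) P - slope d * (hy (slope d) P)%:R).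
    by rewrite -Ei mulrC mulKf.
  split; first by rewrite Ex Ey natrM; congr (_, _); field.
    by move: hi1; rewrite Ey; case: (y).
  rewrite Ex -(ltr_pM2l (_ : 0 < m%:R)) ?ltr0n // mulVKf //.
  by move: ab; rewrite Ey natrM; lra.
by case/corners => j le_j E; exists j => //; exact: (congr1 snd E).
Qed.

Lemma corner_data j : (j <= k)%N -> [/\ in_I (dir j), Dir P (dir j),
  @above K A (sl j) P, hy (sl j) P = (m * b j)%N &
  (0 < b j)%N /\
  dg (sl j) P - sl j * (hy (sl j) P)%:R = m%:R * ((a j)%:~R / l%:R)].
Proof.
move=> le_j; have : regular_corner l m P (corner_pt l (a j) (b j), dir j).
  by apply/corners; exists j.
case=> /= -[i [y [E y0 lt_xy]]] Id Dd Een.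
have [_ d1 s1 s2] := proj1 (in_IP _) Id.
have [Ea Eb] : (a j)%:~R / l%:R = i%:~R / l%:R :> rat /\ b j = y.
  by move: E => [-> /eqP]; rewrite eqr_nat => /eqP.
move: Een; rewrite enE // /scale_pt /corner_pt /vtx /= => -[Ex Ey].
have Eh : hy (sl j) P = (m * b j)%N.
  apply/eqP; rewrite -(eqr_nat rat) natrM; apply/eqP.
  by rewrite Ey mulVKf.
have Ed : dg (sl j) P - sl j * (hy (sl j) P)%:R = m%:R * ((a j)%:~R / l%:R).
  by rewrite Ex mulVKf.
have b0 : (0 < b j)%N by rewrite Eb.
split=> //; apply/andP; split.
  by rewrite Eh; apply: leq_trans m_gt1 _; rewrite leq_pmulr.
have lt' : m%:R * ((a j)%:~R / l%:R) < m%:R * (b j)%:R :> rat.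
  by rewrite ltr_pM2l ?ltr0n // Ea Eb.
by move: lt' Ed; rewrite Eh natrM; lra.
Qed.

Lemma slope_bounds j : (j <= k)%N -> -1 < sl j /\ sl j <= 0.
Proof.
by move=> le_j; have [Id _ _ _ _] := corner_data le_j; have [_ _ s1 s2] := proj1 (in_IP _) Id.
Qed.

Lemma slope_lt i j : (i < j)%N -> (j <= k)%N -> sl i < sl j.
Proof.
elim: j => // j IH; rewrite ltnS leq_eqVlt => le_ij le_j.
have [Ij _ _ _ _] := corner_data (ltnW le_j); have [Ij1 _ _ _ _] := corner_data le_j.
have lt_j : sl j < sl j.+1 by apply/dir_ltP => //; exact: increasing.
case/orP: le_ij => [/eqP -> //|lt_ij].
exact: lt_trans (IH lt_ij (ltnW le_j)) lt_j.
Qed.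

Lemma corner_bal j t : (j <= k)%N -> sl j <= t -> t <= 0 -> balP t.
Proof.
move=> le_j; have [_ _ ab _ _] := corner_data le_j.
by have [s1 _] := slope_bounds le_j; exact: pair_above_bal.
Qed.

Lemma corner_pos j : (j <= k)%N -> 0 < dg (sl j) P.
Proof.
move=> le_j; have [s1 s2] := slope_bounds le_j.
exact: pair_pos (corner_bal le_j (lexx _) s2) s1.
Qed.

Lemma pair_lattice s : balP s -> -1 < s -> wP s ->
  [/\ (m %| hy s P)%N, lat l (m%:R^-1 * (dg s P - s * (hy s P)%:R)),
      (m %| ly s P)%N & lat l (m%:R^-1 * (dg s P - s * (ly s P)%:R))].
Proof.
have [_ _ [c c0 PQc] _] := pair_data => bs s_gt w0.
have [h1 h2] := @pair_corner K charK A m n l P Q c m_gt0 n_gt0 co_mn LP LQ c0 PQc s bs s_gt w0.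
by have [h3 h4] := @pair_corner_lo K charK A m n l P Q c m_gt0 n_gt0 co_mn LP LQ c0 PQc s bs s_gt w0.
Qed.

Lemma pair_lo_le_hi s : (ly s P <= hy s P)%N.
Proof. exact: (@lo_le_hi K A). Qed.

(** A lower end of ordinate > 1 makes the leading forms commute, so the upper end is m times a
    lattice point; it is above the diagonal because the lower end is. *)
Lemma lower_end_above_corner d : Dir P d -> in_I d -> (1 < ly (slope d) P)%N ->
  dg (slope d) P < (1 + slope d) * (ly (slope d) P)%:R ->
  exists2 j, (j <= k)%N & d = dir j.
Proof.
move=> Dd Id lo1 lo_d; have [_ _ s1 s2] := proj1 (in_IP d) Id.
have le_lh : (ly (slope d) P)%:R <= (hy (slope d) P)%:R :> rat by rewrite ler_nat pair_lo_le_hi.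
have ab : @above K A (slope d) P.
  apply/andP; split; first exact: leq_trans lo1 (pair_lo_le_hi _).
  apply: lt_le_trans lo_d _; rewrite ler_pM2l //; lra.
have w0 := pair_lo_wrl0 lo1; have bs := pair_above_bal ab s1 (lexx _) s2.
have [h1 h2 _ _] := pair_lattice bs s1 w0.
exact: above_corner.
Qed.

(** By convexity the start of edge j is at least as high, and as far above the diagonal, as the end
    of edge j - 1, which is a corner. *)
Lemma corner_lo j : (0 < j)%N -> (j <= k)%N -> (1 < ly (sl j) P)%N /\
  dg (sl j) P < (1 + sl j) * (ly (sl j) P)%:R.
Proof.
move=> j0 le_j; have lt_j : (j.-1 < j)%N by rewrite prednK.
have le_j1 := leq_trans (ltnW lt_j) le_j.
have [_ _ /andP [hi1 ab] _ _] := corner_data le_j1.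
have lt_s := slope_lt lt_j le_j; have [s1 _] := slope_bounds le_j1.
split; first exact: leq_trans hi1 (@hi_le_lo K A _ _ P P0 lt_s).
have := @diag_hi_lo K A _ _ P P0 (ltW s1) lt_s; lra.
Qed.

(** [exists_lower_edge] would provide an edge of smaller slope whose upper end is the start of edge
    0. That point is m times a lattice point, so this edge would be a corner below corner 0. *)
Lemma corner0_not_lo : (1 < ly (sl 0) P)%N ->
  dg (sl 0) P < (1 + sl 0) * (ly (sl 0) P)%:R -> False.
Proof.
have [s1 s2] := slope_bounds (leq0n k).
have [_ _ [c c0 PQc] b0] := pair_data => lo1 lo_d.
apply: (@exists_lower_edge K charK A m n P Q c m_gt0 n_gt0 c0 PQc b0 (sl 0) s1 s2 lo1 lo_d).
move=> t t1 lt_t Eh Ed; apply/eqP; rewrite eqn_leq pair_lo_le_hi /= leqNgt; apply/negP => lt_lh.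
have bs : balP (sl 0) := corner_bal (leq0n k) (lexx _) s2.
have [_ _ dv la] := pair_lattice bs s1 (pair_lo_wrl0 lo1).
have t2 : t <= 0 by lra.
have [j le_j Ej] : exists2 j, (j <= k)%N & (denq t, numq t) = dir j.
  have [dd st] := slope_dir t; have It := slope_in_I t1 t2.
  have [_ d1 _ _] := proj1 (in_IP _) It.
  apply: above_corner => //.
  - by apply/DirE => //; rewrite st.
  - rewrite st /above Eh lo1 Ed; apply/andP; split=> //.
    by move: lo_d; lra.
  - by rewrite st Eh.
  rewrite st Eh Ed; move: la; congr (lat l (_ * _)); ring.
have St : sl j = t by rewrite -Ej; have [_] := slope_dir t.
case: j Ej le_j St => [|j] _ le_j St; first by move: lt_t; rewrite -St ltxx.
by have := slope_lt (ltn0Sn j) le_j; rewrite St ltNge (ltW lt_t).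
Qed.

Lemma dirs_AE d : dirs_A P d <-> [/\ Dir P d, in_I d, (1 < ly (slope d) P)%N &
  dg (slope d) P < (1 + slope d) * (ly (slope d) P)%:R].
Proof.
rewrite /dirs_A; split=> [[Dd Id]|[Dd Id lo1 lo_d]];
  have [_ d1 _ _] := proj1 (in_IP d) Id; rewrite stE // /wt /vtx /=.
  rewrite mul0r add0r mulN1r ltrN2 mul1r ltr1n => lo1 lo_d.
  by split=> //; lra.
by split=> //; [rewrite mul0r add0r mulN1r ltrN2 ltr1n | lra].
Qed.

Lemma dirs_A_corners d : dirs_A P d <-> exists2 j, (0 < j <= k)%N & d = dir j.
Proof.
rewrite dirs_AE; split=> [[Dd Id lo1 lo_d]|[j /andP [j0 le_j] ->]]; last first.
  have [Id Dd _ _ _] := corner_data le_j.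
  by have [lo1 lo_d] := corner_lo j0 le_j.
have [j le_j E] := lower_end_above_corner Dd Id lo1 lo_d.
exists j => //; rewrite le_j andbT lt0n; apply/eqP => j0; rewrite E j0 in lo1 lo_d.
exact: corner0_not_lo lo1 lo_d.
Qed.

Lemma corner0_unique C : regular_corner l m P C /\ ~ dirs_A P C.2 ->
  (corner_pt l (a 0) (b 0), dir 0) = C.
Proof.
case=> /corners [[|j] le_j ->] // nA; case: nA.
by apply/dirs_A_corners; exists j.+1.
Qed.

Lemma starting_corner : starting_triple l m P (corner_pt l (a 0) (b 0))
  (scale_pt m%:R^-1 (st (dir 0) P)) (dir 0).
Proof.
split=> //; split; last exact: corner0_unique.
split; first by apply/corners; exists 0%N.
move=> /dirs_A_corners [j /andP [j0 le_j]] E.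
by have := slope_lt j0 le_j; rewrite -E ltxx.
Qed.

(** Any edge strictly between corners j - 1 and j that starts at the end of edge j - 1 would itself
    be a corner, so this end remains the maximizing vertex until slope j. *)
Lemma consecutive j : (0 < j)%N -> (j <= k)%N ->
  ly (sl j) P = hy (sl j.-1) P /\
  dg (sl j) P - sl j * (ly (sl j) P)%:R = dg (sl j.-1) P - sl j.-1 * (hy (sl j.-1) P)%:R.
Proof.
move=> j0 le_j; have lt_j : (j.-1 < j)%N by rewrite prednK.
have le_j1 := leq_trans (ltnW lt_j) le_j; have lt_s := slope_lt lt_j le_j.
have [_ _ /andP [hi1 ab] _ _] := corner_data le_j1.
have [s1 _] := slope_bounds le_j1; have [_ s2] := slope_bounds le_j.
pose r := sl j.-1; rewrite -/r in lt_s hi1 ab s1 *.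
pose e : expo := (dg r P - r * (hy r P)%:R, hy r P).
have wqe t : wq t e = dg r P + (t - r) * (hy r P)%:R by rewrite /wq /=; ring.
have eP : @cf K A P e != 0.
  by rewrite (@lform_cf K A r _ _ P _ (lform_lead r _)); exact: (@lead_hi K A).
have e0 : @mono K A e != 0.
  apply/eqP => E; have := @cf_mono K A e e; rewrite E cf0 eqxx => /esym/eqP.
  by rewrite oner_eq0.
have lo_t t : r < t -> dg t P = wq t e -> ly t P = hy r P.
  move=> lt_t E; apply/eqP; rewrite eqn_leq (@hi_le_lo K A _ _ P P0 lt_t) andbT.
  apply: (@lead_ge_lo K A) => //; rewrite -(@lform_cf K A t _ _ P _ (lform_lead t _)) E wqe.
  by have -> : dg r P + (t - r) * (hy r P)%:R - t * (hy r P)%:R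
    = dg r P - r * (hy r P)%:R by ring.
have E : dg (sl j) P = wq (sl j) e.
  have := @degs_up K A 1 1 P (mono A e) r (sl j) P0 e0 (ltW lt_s).
  rewrite !mul1r !(proj1 (@degs_mono K A _ _)); apply; last by rewrite wqe; ring.
  move=> t /andP [le_t lt_t]; rewrite !mul1r !(proj1 (@degs_mono K A _ _)) => Et.
  have -> : hy t (mono A e) = e.2.
    have [_ El] := leadE (@lform_mono K A t e) (monic_neq0 (monicXn _ _)).
    by rewrite /hi_y El size_polyXn.
  move: le_t; rewrite le_eqVlt => /orP [/eqP <- //|lt_rt].
  have lo_e := lo_t t lt_rt Et.
  suff -> : hy t P = ly t P by rewrite lo_e.
  apply/eqP; rewrite eqn_leq pair_lo_le_hi andbT leqNgt; apply/negP => lt_lh.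
  have t1 : -1 < t by lra.
  have t2 : t <= 0 by lra.
  have [dd st] := slope_dir t; have It := slope_in_I t1 t2.
  have [_ d1 _ _] := proj1 (in_IP _) It.
  have Dt : Dir P (denq t, numq t) by apply/DirE => //; rewrite st.
  have h1 : (1 < ly (slope (denq t, numq t)) P)%N by rewrite st lo_e.
  have h2 : dg (slope (denq t, numq t)) P <
      (1 + slope (denq t, numq t)) * (ly (slope (denq t, numq t)) P)%:R.
    by rewrite st lo_e Et wqe; move: ab; lra.
  have [i le_i Ei] := lower_end_above_corner Dt It h1 h2; have Si : sl i = t by rewrite -Ei.
  have lt_i : (i < j)%N.
    rewrite ltnNge; apply/negP; rewrite leq_eqVlt => /orP [/eqP E|lt_ji].
      by move: lt_t; rewrite -Si E ltxx.
    by have := slope_lt lt_ji le_i; rewrite Si ltNge (ltW lt_t).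
  have gt_i : (j.-1 < i)%N.
    rewrite ltnNge; apply/negP; rewrite leq_eqVlt => /orP [/eqP E|lt_ji].
      by move: lt_rt; rewrite -Si E ltxx.
    by have := slope_lt lt_ji le_j1; rewrite Si -/r ltNge (ltW lt_rt).
  by move: lt_i gt_i; case: (j) j0 => // j' _; rewrite ltnS /= => le1 lt2; rewrite ltnNge le1 in lt2.
have El := lo_t _ lt_s E; rewrite El; split=> //.
by rewrite E wqe; ring.
Qed.

Definition admissible j := (j <= k)%N /\ (j = 0%N -> type_II P Q (dir 0)).

Lemma admissible_gt0 j : (0 < j)%N -> (j <= k)%N -> admissible j.
Proof. by move=> j0 le_j; split=> // E; rewrite E in j0. Qed.

(** For j > 0 the start has ordinate > 1, so 0 is a root and the forms commute; as l(P) is not a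
    monomial, there is a second root. *)
Lemma admissible_roots j : admissible j -> wP (sl j) /\
  exists c1 c2 : K, [/\ c1 != c2, root (ld (sl j) P) c1 & root (ld (sl j) P) c2].
Proof.
case; case: j => [|j] le_j II.
  have [Id _ _ _ _] := corner_data le_j; have [_ d1 _ _] := proj1 (in_IP _) Id.
  exact: type_IIE (II erefl).
have [Id Dd _ _ _] := corner_data le_j; have [_ d1 _ _] := proj1 (in_IP _) Id.
have [lo1 _] := corner_lo (ltn0Sn j) le_j; split; first exact: pair_lo_wrl0.
have [_ lt_lh] := proj1 (DirE d1 P0) Dd.
have l0 : ld (sl j.+1) P != 0 by rewrite (@lead_eq0 K A).
have [i [g]] := multiplicity_XsubC (ld (sl j.+1) P) 0; rewrite l0 subr0 /= => g0 Eg.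
have Ei : ly (sl j.+1) P = i.
  by rewrite /lo_y Eg mupMr // -['X]subr0 mup_XsubCX eqxx.
have gn0 : g != 0 by apply: contraNneq g0 => ->; rewrite root0.
have sg : size g != 1%N.
  apply: contraTneq lt_lh => sg1; rewrite -leqNgt /hi_y Ei Eg.
  by rewrite size_Mmonic ?monicXn // sg1 size_polyXn addnS.
have [c gc] := closed_rootP _ sg; exists 0, c; split.
- by apply: contraNneq g0 => ->.
- by rewrite Eg rootM orbC rootE hornerXn expr0n -Ei (gtn_eqF (ltnW lo1)) eqxx.
by rewrite Eg rootM gc.
Qed.

(** Multiplicities of P and Q are in the ratio m : n, so m divides those of P by coprimality; the
    same holds for the end point. *)
Lemma admissible_frac j : admissible j -> @frac_power K A P (sl j) l m%:R^-1.
Proof.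
move=> aj; have [w0 _] := admissible_roots aj; have [le_j _] := aj.
have [s1 s2] := slope_bounds le_j; have bs := corner_bal le_j (lexx _) s2.
have [_ la _ _] := pair_lattice bs s1 w0; split=> // c.
have [_ _ [c' c0 PQc] _] := pair_data.
have E := @pair_mup K charK A m n P Q c' m_gt0 n_gt0 c0 PQc _ c bs s1 w0.
have /dvdnP [y ->] : (m %| mup c (ld (sl j) P))%N.
  by rewrite -(@Gauss_dvdr m n) // E dvdn_mulr.
by rewrite natrM mulrC mulfK // intr_nat.
Qed.

Lemma hi_gt0 j : (j <= k)%N -> (0 < hy (sl j) P)%N.
Proof. by move=> le_j; have [_ _ /andP [/ltnW h _] _ _] := corner_data le_j. Qed.

Lemma admissible_max j : admissible j -> exists d, max_power l m P (dir j) d.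
Proof.
move=> aj; have [le_j _] := aj.
have [Id _ _ _ _] := corner_data le_j; have [_ d1 _ _] := proj1 (in_IP _) Id.
have [d [d0 pd max_d]] := @exists_max_pow K charK A P (sl j) m l P0 (hi_gt0 le_j) m_gt0 LP
  (admissible_frac aj).
exists d; split=> //; first exact: (proj2 (is_powerE d1 l_gt0 m_gt0 d0 P0) pd).
by move=> e e0 pe; exact: max_d e0 (proj1 (is_powerE d1 l_gt0 m_gt0 e0 P0) pe).
Qed.

Lemma max_pow j d : (j <= k)%N -> max_power l m P (dir j) d ->
  [/\ (0 < d)%N, @pow K A P (sl j) m l d &
    forall e, (0 < e)%N -> @pow K A P (sl j) m l e -> (e <= d)%N].
Proof.
move=> le_j [d0 pd max_d].
have [Id _ _ _ _] := corner_data le_j; have [_ d1 _ _] := proj1 (in_IP _) Id.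
split=> //; first exact: (proj1 (is_powerE d1 l_gt0 m_gt0 d0 P0) pd).
by move=> e e0 pe; exact: max_d e0 (proj2 (is_powerE d1 l_gt0 m_gt0 e0 P0) pe).
Qed.

(** This is m v(F_j) / v(P), since F_j has weight 1 + s; its reduced fraction gives p_j and q_j. *)
Definition weight_ratio j : rat := m%:R * (1 + sl j) / dg (sl j) P.
Definition ratio_num j : nat := `|numq (weight_ratio j)|%N.
Definition ratio_den j : nat := `|denq (weight_ratio j)|%N.

Lemma pq_spec j : (j <= k)%N -> [/\ (0 < ratio_num j)%N, (0 < ratio_den j)%N,
  coprime (ratio_num j) (ratio_den j) & (ratio_num j)%:R / (ratio_den j)%:R = weight_ratio j].
Proof.
move=> le_j; have [s1 s2] := slope_bounds le_j.
have r0 : 0 < weight_ratio j.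
  by rewrite divr_gt0 ?corner_pos // mulr_gt0 ?ltr0n //; lra.
rewrite /ratio_num /ratio_den absz_gt0 numq_eq0 gt_eqF // absz_gt0 denq_eq0; split=> //.
  exact: coprime_num_den.
rewrite !pmulrn absz_denq gez0_abs ?numq_ge0 ?ltW //.
exact: divq_num_den.
Qed.

Lemma eigen_of_assoc j F : (j <= k)%N -> assoc_F l P Q (dir j) F ->
  dg (sl j) F = 1 + sl j /\ wr (1 + sl j) (dg (sl j) P) (ld (sl j) F) (ld (sl j) P) = ld (sl j) P.
Proof.
move=> le_j [_ hF vF brF _].
have [Id _ _ _ _] := corner_data le_j; have [_ d1 _ _] := proj1 (in_IP _) Id.
have dF : dg (sl j) F = 1 + sl j.
  move: vF; rewrite vdegE // intrD -(rho_slope d1) -{2}[(dir j).1%:~R]mulr1 -mulrDr.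
  exact/mulfI/rho_neq0.
split=> //.
have brE : bracket (ell (dir j) F) (ell (dir j) P) = ell (dir j) P.
  exact: (etrans (congr1 (fun G => bracket G (ell (dir j) P)) (esym hF)) brF).
have := etrans (esym (bracket_ell charK d1 F P)) (etrans brE (ellE d1 P)).
have -> : dg (sl j) F + dg (sl j) P - 1 - sl j = dg (sl j) P by rewrite dF; ring.
by move/(@hmg_inj K A); rewrite /wrl dF.
Qed.

(** The weight of F is prescribed, and [eigen_size] gives its upper ordinate; together they
    determine the point. *)
Lemma assoc_en j F : admissible j -> assoc_F l P Q (dir j) F -> en (dir j) F =
  scale_pt ((ratio_num j)%:R / (ratio_den j)%:R) (scale_pt m%:R^-1 (en (dir j) P)).
Proof.
move=> aj aF; have [le_j _] := aj; have [dF eF] := eigen_of_assoc le_j aF.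
have [_ [c1 [c2 [c12 r1 r2]]]] := admissible_roots aj.
have [s1 s2] := slope_bounds le_j; have pP := corner_pos le_j.
have [Id _ _ _ _] := corner_data le_j; have [_ d1 _ _] := proj1 (in_IP _) Id.
have l0 : ld (sl j) P != 0 by rewrite (@lead_eq0 K A).
have s0 : 1 + sl j != 0 by rewrite gt_eqF //; lra.
have := eigen_size charK s0 l0 c12 r1 r2 eF; rewrite -/(hy _ P) -/(hy _ F) => Eh.
have F0 : F != 0 by rewrite -(@lead_eq0 K A (sl j)); exact: eigen_neq0 l0 eF.
have [_ _ _ ->] := pq_spec le_j.
rewrite !enE // /scale_pt /vtx /weight_ratio dF /=.
have pR := lt0r_neq0 pP.
have Ey : (hy (sl j) F)%:R = (1 + sl j) * (hy (sl j) P)%:R / dg (sl j) P.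
  by rewrite Eh mulrC mulKf.
by rewrite Ey; congr (_, _); field; rewrite pR mR.
Qed.

Lemma exists_G0_F j : (j <= k)%N -> exists G0 (f : {poly K}), [/\ @inPQ K A P Q G0,
  @wrl K A (sl j) G0 P != 0,
  forall i, (0 < i)%N -> @wrl K A (sl j) (iter i (@adP K A P) G0) P = 0,
  ld (sl j) G0 * ld (sl j) P = f * @wrl K A (sl j) G0 P &
  wr (1 + sl j) (dg (sl j) P) f (ld (sl j) P) = ld (sl j) P /\ sup_in l (sl j) (1 + sl j) f].
Proof.
move=> le_j; have [_ _ [c c0 PQc] _] := pair_data.
have [s1 s2] := slope_bounds le_j.
exact: (@exists_F K charK A P Q c c0 PQc l (sl j) l_gt0 LP LQ s1 (corner_pos le_j) (hi_gt0 le_j)).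
Qed.

Lemma assoc_exists j : admissible j -> exists F, assoc_F l P Q (dir j) F.
Proof.
move=> aj; have [le_j _] := aj; have [G0 [f [iG nz it0 Ef [ef sf]]]] := exists_G0_F le_j.
have [Id _ _ _ _] := corner_data le_j; have [_ d1 _ _] := proj1 (in_IP _) Id.
have l0 : ld (sl j) P != 0 by rewrite (@lead_eq0 K A).
have f0 := eigen_neq0 l0 ef.
have [dF lF F0] := @hmg_form K (dir j) (1 + sl j) f f0.
exists (hmg A (sl j) (1 + sl j) f); split.
- by apply/in_LE => //; apply/inL_hmg.
- exact: homogeneous_hmg.
- rewrite vdegE // dF mulrDr mulr1 rho_slope // intrD //.
- have Es : 1 + sl j + dg (sl j) P - 1 - sl j = dg (sl j) P by ring.
  have := @brk_hmg K charK A (sl j) (1 + sl j) (dg (sl j) P) f (ld (sl j) P).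
  by rewrite ef Es -(ellE d1 P).
exists G0; split.
- exact: iG.
- apply: contraNneq nz => ->; rewrite /wrl.
  have /eqP -> : ld (sl j) 0 == 0 by rewrite (@lead_eq0 K A).
  by rewrite /wr /wronsk deriv0 !mul0r !scaler0 subrr.
- have := @hmgM K A (sl j) (dg (sl j) G0 + dg (sl j) P - 1 - sl j) (1 + sl j)
    (@wrl K A (sl j) G0 P) f.
  have -> : dg (sl j) G0 + dg (sl j) P - 1 - sl j + (1 + sl j) = dg (sl j) G0 + dg (sl j) P by ring.
  rewrite (_ : @wrl K A (sl j) G0 P * f = ld (sl j) G0 * ld (sl j) P); last by rewrite mulrC Ef.
  move=> E1.
  have E2 := @hmgM K A (sl j) (dg (sl j) G0) (dg (sl j) P) (ld (sl j) G0) (ld (sl j) P).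
  have E3 := etrans E1 (esym E2).
  by rewrite (bracket_ell charK d1 G0 P) (ellE d1 G0) (ellE d1 P).
by move=> i i0; apply/bracket_ell0 => //; exact: it0.
Qed.

Lemma q_ndvd_d j d : admissible j -> max_power l m P (dir j) d -> ~~ (ratio_den j %| d)%N.
Proof.
move=> aj mx; have [le_j _] := aj; have [d0 pd _] := max_pow le_j mx.
have [_ [c1 [c2 [c12 r1 r2]]]] := admissible_roots aj.
have [s1 s2] := slope_bounds le_j; have [p0 q0 _ Epq] := pq_spec le_j.
have [G0 [f [_ _ _ _ [ef _]]]] := exists_G0_F le_j.
apply: (@eigen_ndvd K charK A P (sl j) m l P0 (corner_pos le_j) m_gt0 f c1 c2 (ratio_num j)) => //.
by lra.
Qed.

(** At corner i both G0 and [G0, P], chosen for corner j, have leading forms that are fractional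
    powers of l(P). The two exponents are the same as the weight ratios at j, where v([G0, P]) =
    v(G0) + v(P) - 1 - s_j. *)
Lemma q_dvd_d i j d : admissible j -> (j < i)%N -> (i <= k)%N ->
  max_power l m P (dir i) d -> (ratio_den j %| d)%N.
Proof.
move=> aj lt_ji le_i mx; have [le_j _] := aj.
have [d0 pd max_d] := max_pow le_i mx; have [p0 q0 co Epq] := pq_spec le_j.
apply: (@frac_power_max K charK A P (sl i) m l P0 m_gt0 LP d (ratio_num j)) => //.
have [G0 [f [iG nz it0 Ef [ef _]]]] := exists_G0_F le_j.
have [_ _ [c c0 PQc] _] := pair_data.
have [_ [c1 [c2 [c12 r1 r2]]]] := admissible_roots aj.
have [s1 s2] := slope_bounds le_j; have pP := corner_pos le_j.
have [_ _ /andP [_ ab] _ _] := corner_data le_j.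
have lt_s := slope_lt lt_ji le_i.
have l0 : ld (sl j) P != 0 by rewrite (@lead_eq0 K A).
have s0 : 1 + sl j != 0 by rewrite gt_eqF //; lra.
have := eigen_size charK s0 l0 c12 r1 r2 ef; rewrite -/(hy _ P) => Eh.
have f0 := eigen_neq0 l0 ef.
have [N iN0] := @adP_nilpotent K charK A P Q c PQc G0 iG.
have lG0 : ld (sl j) G0 != 0.
  by apply: contraNneq nz => E; rewrite /wrl E /wr /wronsk deriv0 !mul0r !scaler0 subrr.
have G00 : G0 != 0 by rewrite -(@lead_eq0 K A (sl j)).
have [dG1 lG1] := @degs_brk K charK A (sl j) G0 P nz.
have G10 : @brk K A G0 P != 0 by rewrite -(@lead_eq0 K A (sl j)) lG1.
(* The iterates after G0 commute with P at corner j. For G0 itself the alignment follows from l(G0)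
   l(P) = F l([G0, P]), whose other three factors are aligned. *)
have al i' : iter i' (fun H => @brk K A H P) G0 != 0 ->
     dg (sl j) (iter i' (fun H => @brk K A H P) G0) * (hy (sl j) P)%:R =
     dg (sl j) P * (hy (sl j) (iter i' (fun H => @brk K A H P) G0))%:R.
  case: i' => [_|i' nz']; last first.
    by apply: (wr0_size charK); rewrite ?(@lead_eq0 K A) //; exact: it0.
  have Eh1 := wr0_size charK (_ : ld (sl j) (@brk K A G0 P) != 0) l0 (it0 1%N isT).
  move: Eh1; rewrite (@lead_eq0 K A) => /(_ G10); rewrite dG1 -/(hy _ P) lG1 => Eh1.
  have : ((hy (sl j) G0)%:R + (hy (sl j) P)%:R : rat) =
      (size f).-1%:R + (size (@wrl K A (sl j) G0 P)).-1%:R.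
    rewrite -!natrD; congr (_%:R); have := congr1 (fun g : {poly K} => (size g).-1) Ef.
    have sp (g h : {poly K}) : g != 0 -> h != 0 ->
        (size (g * h)).-1 = ((size g).-1 + (size h).-1)%N.
      move=> g0 h0; rewrite size_mul //.
      move: g0 h0; rewrite -!size_poly_gt0; case: (size g) (size h) => [|x] [|y] // _ _.
      by rewrite addSn addnS.
    by rewrite /= !sp.
  move=> Es; rewrite /= in Es *.
  have : dg (sl j) P * ((hy (sl j) G0)%:R + (hy (sl j) P)%:R) =
     dg (sl j) P * ((size f).-1%:R + (size (@wrl K A (sl j) G0 P)).-1%:R) by rewrite Es.
  rewrite mulrDr [RHS]mulrDr -Eh -Eh1; lra.
have up := @commuting_above K charK A P (sl j) P0 pP s1 ab N.
have [E0 w0] := up G0 iN0 al G00 (sl i) (ltW lt_s).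
have [|i'|E1 w1] := up (@brk K A G0 P) _ _ G10 (sl i) (ltW lt_s).
- by rewrite -iterSr iterS iN0 brk0l.
- by rewrite -iterSr; exact: al.
have iG1 : @inPQ K A P Q (@brk K A G0 P) by exact: (@inPQ_ad K charK A P Q c PQc).
have piP := corner_pos le_i.
have f0' := @commuting_frac_power K charK A P (sl i) l P0 piP G0 G00
  (@inPQ_inL K A P Q l G0 LP LQ iG) (w0 lt_s).
have f1' := @commuting_frac_power K charK A P (sl i) l P0 piP _ G10
  (@inPQ_inL K A P Q l _ LP LQ iG1) (w1 lt_s).
have f1 := @frac_power1 K A P (sl i) l P0 LP.
have := frac_powerD (frac_powerB f0' f1') f1.
(* Transported to corner j, this combination is (1 + s_j) / v(P). *)
suff -> : dg (sl i) G0 / dg (sl i) P - dg (sl i) (@brk K A G0 P) / dg (sl i) P + 1 =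
   (ratio_num j)%:R / (ratio_den j)%:R / m%:R by [].
rewrite Epq /weight_ratio.
have pR := lt0r_neq0 pP; have piR := lt0r_neq0 piP.
have -> : dg (sl i) G0 / dg (sl i) P = dg (sl j) G0 / dg (sl j) P.
  by apply/eqP; rewrite eqr_div // mulrC E0.
have -> : dg (sl i) (@brk K A G0 P) / dg (sl i) P = dg (sl j) (@brk K A G0 P) / dg (sl j) P.
  by apply/eqP; rewrite eqr_div // mulrC E1.
by rewrite dG1; field; rewrite mR pR.
Qed.

(** The vertex of l(P) is m d times the vertex of its root r, whose abscissa is in (1/l) Z; so the
    scaled point (x / l, y) is d times a lattice point. *)
Lemma pow_dvd_vertex j d (r : {poly K}) (z y : nat) (x : int) : (0 < d)%N ->
  sup_in l (sl j) (dg (sl j) P / (m * d)%:R) r -> r`_z != 0 ->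
  (z * (m * d))%N = (m * y)%N ->
  dg (sl j) P - sl j * (m * y)%:R = m%:R * (x%:~R / l%:R) ->
  (d %| `|x|)%N && (d %| y)%N.
Proof.
move=> d0 sr rz Ey Ex; have Ey' : y = (z * d)%N.
  by apply/eqP; rewrite -(eqn_pmul2l m_gt0) -Ey mulnCA.
have dR : d%:R != 0 :> rat by rewrite pnatr_eq0 -lt0n.
have /intrP [i Ei] := sr z rz.
have Exi : x = d%:Z * i.
  apply: (@intr_inj rat); rewrite intrM -Ei -pmulrn.
  have -> : x%:~R = l%:R * (dg (sl j) P - sl j * (m * y)%:R) / m%:R :> rat.
    by rewrite Ex; field; rewrite lR mR.
  by rewrite Ey' !natrM; field; rewrite mR dR.
by rewrite Exi abszM dvdn_mulr //= Ey' dvdn_mull.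
Qed.

(** Apply [pow_dvd_vertex] to both ends of edge j; the lower one is the end of edge j - 1 by
    [consecutive]. *)
Lemma d_dvd_D j d : (0 < j)%N -> (j <= k)%N -> max_power l m P (dir j) d ->
  (d %| gcdn (gcdn `|a j| (b j)) (gcdn `|a j.-1| (b j.-1)))%N.
Proof.
move=> j0 le_j mx; have [d0 [r [Er sr]] _] := max_pow le_j mx.
have l0 : ld (sl j) P != 0 by rewrite (@lead_eq0 K A).
have md0 : (0 < m * d)%N by rewrite muln_gt0 m_gt0.
have r0 : r != 0 by apply: contraNneq l0 => r0; rewrite Er r0 expr0n gtn_eqF.
have [_ _ _ Eh [_ Ex]] := corner_data le_j.
have lt_j : (j.-1 < j)%N by rewrite prednK.
have [_ _ _ Eh1 [_ Ex1]] := corner_data (leq_trans (ltnW lt_j) le_j).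
have [El Elx] := consecutive j0 le_j; rewrite Ex1 El Eh1 in Elx; rewrite Eh in Ex.
have Eh' : ((size r).-1 * (m * d))%N = (m * b j)%N by rewrite -Eh /hi_y Er size_exp.
have El' : (mup 0 r * (m * d))%N = (m * b j.-1)%N.
  by rewrite -Eh1 -El /lo_y Er mupX // mulnC.
have rh : r`_(size r).-1 != 0 by rewrite -lead_coefE lead_coef_eq0.
have [rl _] := mup0_coef r0.
have /andP [h1 h2] := pow_dvd_vertex d0 sr rh Eh' Ex.
have /andP [h3 h4] := pow_dvd_vertex d0 sr rl El' Elx.
by rewrite !dvdn_gcd h1 h2 h3 h4.
Qed.

Lemma finite_choice (R : nat -> nat -> Prop) N : (forall j, exists d, R j d) ->
  exists d : nat -> nat, forall j, (j <= N)%N -> R j (d j).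
Proof.
move=> ex; elim: N => [|N [d Rd]].
  by have [d0 R0] := ex 0%N; exists (fun=> d0) => j; rewrite leqn0 => /eqP ->.
have [x Rx] := ex N.+1; exists (fun j => if j == N.+1 then x else d j) => j.
rewrite leq_eqVlt; case: eqP => [-> //|_] /=; rewrite ltnS; exact: Rd.
Qed.

Lemma corner_divisibility : exists d p q : nat -> nat,
  (forall j : nat, (j <= k)%N -> (j = 0%N -> type_II P Q (dir 0%N)) ->
     max_power l m P (dir j) (d j)) /\
  (forall j : nat, (j <= k)%N -> (j = 0%N -> type_II P Q (dir 0%N)) ->
     [/\ (0 < p j)%N, (0 < q j)%N, coprime (p j) (q j),
         exists F : qlaurent K, assoc_F l P Q (dir j) F
       & forall F : qlaurent K, assoc_F l P Q (dir j) F ->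
           en (dir j) F =
           scale_pt ((p j)%:R / (q j)%:R) (scale_pt m%:R^-1 (en (dir j) P))]) /\
  (forall i : nat, (0 < i <= k)%N -> ~~ (q i %| d i)%N) /\
  (forall i j : nat, (0 < j)%N -> (j < i)%N -> (i <= k)%N -> (q j %| d i)%N) /\
  (forall i j : nat, (0 < j)%N -> (j < i)%N -> (i <= k)%N -> ~~ (q i %| q j)%N) /\
  (forall j : nat, (0 < j <= k)%N ->
     let D := gcdn (gcdn `|a j|%N (b j)) (gcdn `|a j.-1|%N (b j.-1)) in
     [/\ (d j %| D)%N, (Omega (d j) <= Omega D)%N
       & (j.-1 <= Omega (d j))%N]) /\
  (type_II P Q (dir 0%N) ->
     ~~ (q 0 %| d 0)%N /\
     forall i : nat, (0 < i <= k)%N ->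
       [/\ (q 0 %| d i)%N, ~~ (q i %| q 0)%N & (i <= Omega (d i))%N]).
Proof.
(* Allowing any value where [admissible] fails makes the relation total, so that finite choice
   applies. *)
have exd j : exists d, admissible j -> max_power l m P (dir j) d.
  have [aj|naj] := classic (admissible j); last by exists 0%N.
  by have [d md] := admissible_max aj; exists d.
have [d md] := finite_choice k exd.
have mdE j : (j <= k)%N -> (j = 0%N -> type_II P Q (dir 0%N)) ->
    max_power l m P (dir j) (d j) by move=> le_j II; apply: md.
have nd j : admissible j -> ~~ (ratio_den j %| d j)%N.
  by move=> aj; apply: q_ndvd_d => //; case: aj; exact: mdE.
have dv i j : admissible j -> (j < i)%N -> (i <= k)%N -> (ratio_den j %| d i)%N.
  move=> aj lt_j le_i; apply: (q_dvd_d aj lt_j le_i); apply: mdE => // i0.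
  by rewrite i0 in lt_j.
have nq i j : admissible j -> (j < i)%N -> (i <= k)%N -> ~~ (ratio_den i %| ratio_den j)%N.
  move=> aj lt_j le_i; have ai := admissible_gt0 (leq_ltn_trans (leq0n j) lt_j) le_i.
  by apply: contra (nd i ai) => /dvdn_trans; apply; exact: dv.
have pos j : admissible j -> (0 < ratio_den j)%N /\ (0 < d j)%N.
  move=> aj; have [le_j II] := aj; have [_ q0 _ _] := pq_spec le_j.
  by split=> //; have [] := mdE j le_j II.
have chain j0 : admissible j0 -> forall i, (j0 <= i <= k)%N -> (i - j0 <= Omega (d i))%N.
  move=> aj0; have adm j : (j0 <= j <= k)%N -> admissible j.
    case/andP; rewrite leq_eqVlt => /orP [/eqP <- //|lt_j] le_j.
    exact: admissible_gt0 (leq_ltn_trans (leq0n _) lt_j) le_j.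
  apply: (@Omega_chain ratio_den) => [j /adm|i /adm|i j le_j lt_j le_i]; [exact: pos | exact: nd |].
  by apply: dv => //; apply: adm; rewrite le_j ltnW // (leq_trans lt_j).
exists d, ratio_num, ratio_den; split; [exact: mdE | split; [|split; [|split; [|split; [|split]]]]].
- move=> j le_j II; have aj : admissible j by [].
  have [p0 q0 co _] := pq_spec le_j.
  by split=> //; [exact: assoc_exists | move=> F; exact: assoc_en].
- by move=> i /andP [i0 le_i]; apply: nd; exact: admissible_gt0.
- move=> i j j0 lt_j le_i; apply: dv => //; apply: admissible_gt0 j0 _.
  exact: leq_trans (ltnW lt_j) le_i.
- move=> i j j0 lt_j le_i; apply: nq => //; apply: admissible_gt0 j0 _.
  exact: leq_trans (ltnW lt_j) le_i.
- move=> j /andP [j0 le_j] D; have aj := admissible_gt0 j0 le_j.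
  have dD : (d j %| D)%N by apply: d_dvd_D => //; case: aj; exact: mdE.
  split=> //.
    apply: Omega_dvd dD; have [_ _ _ _ [b0 _]] := corner_data le_j.
    by rewrite /D !gcdn_gt0 b0 orbT.
  have a1 : admissible 1 by apply: admissible_gt0 => //; exact: leq_trans j0 le_j.
  by rewrite -subn1; apply: chain => //; rewrite j0.
move=> II; have a0 : admissible 0 by split.
split; first exact: nd.
move=> i /andP [i0 le_i]; split; [exact: dv | exact: nq |].
by rewrite -[X in (X <= _)%N]subn0; exact: chain.
Qed.

End Corners.

Theorem theorem7p6 (K : closedFieldType) (charK : [pchar K] =i pred0)
  (m n l : nat) (m_gt1 : (1 < m)%N) (n_gt1 : (1 < n)%N) (co_mn : coprime m n)
  (l_gt0 : (0 < l)%N)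
  (P Q : qlaurent K) (pairPQ : mn_pair l m n P Q)
  (k : nat) (a : nat -> int) (b : nat -> nat) (dir : nat -> int * int)
  (corners : forall C : (rat * rat) * (int * int),
     regular_corner l m P C <->
     exists2 j : nat, (j <= k)%N & C = (corner_pt l (a j) (b j), dir j))
  (increasing : forall i : nat, (i < k)%N -> dir_lt (dir i) (dir i.+1)) :
  (forall v : int * int,
     dirs_A P v <-> exists2 j : nat, (0 < j <= k)%N & v = dir j) /\
  (standard_mn_pair l m n P Q ->
     starting_triple l m P (corner_pt l (a 0%N) (b 0%N))
       (scale_pt m%:R^-1 (st (dir 0%N) P)) (dir 0%N)) /\
  exists d p q : nat -> nat,
  (forall j : nat, (j <= k)%N -> (j = 0%N -> type_II P Q (dir 0%N)) ->
     max_power l m P (dir j) (d j)) /\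
  (forall j : nat, (j <= k)%N -> (j = 0%N -> type_II P Q (dir 0%N)) ->
     [/\ (0 < p j)%N, (0 < q j)%N, coprime (p j) (q j),
         exists F : qlaurent K, assoc_F l P Q (dir j) F
       & forall F : qlaurent K, assoc_F l P Q (dir j) F ->
           en (dir j) F =
           scale_pt ((p j)%:R / (q j)%:R) (scale_pt m%:R^-1 (en (dir j) P))]) /\
  (forall i : nat, (0 < i <= k)%N -> ~~ (q i %| d i)%N) /\
  (forall i j : nat, (0 < j)%N -> (j < i)%N -> (i <= k)%N -> (q j %| d i)%N) /\
  (forall i j : nat, (0 < j)%N -> (j < i)%N -> (i <= k)%N -> ~~ (q i %| q j)%N) /\
  (forall j : nat, (0 < j <= k)%N ->
     let D := gcdn (gcdn `|a j|%N (b j)) (gcdn `|a j.-1|%N (b j.-1)) in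
     [/\ (d j %| D)%N, (Omega (d j) <= Omega D)%N
       & (j.-1 <= Omega (d j))%N]) /\
  (type_II P Q (dir 0%N) ->
     ~~ (q 0 %| d 0)%N /\
     forall i : nat, (0 < i <= k)%N ->
       [/\ (q 0 %| d i)%N, ~~ (q i %| q 0)%N & (i <= Omega (d i))%N]).
Proof.
split; first exact: (dirs_A_corners charK m_gt1 n_gt1 co_mn l_gt0 pairPQ corners increasing).
split; first by move=> _; exact: (starting_corner charK m_gt1 n_gt1 co_mn l_gt0 pairPQ corners increasing).
exact: (corner_divisibility charK m_gt1 n_gt1 co_mn l_gt0 pairPQ corners increasing).
Qed.
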